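(* Let $0<\beta<1$ and let $\tilde u$ be the random field defined in the context. For any $\lambda>0$, $$\mathbb{P}\left(\limsup_{h\to0+}\frac{|\tilde u(\tau,\lambda+h)-\tilde u(\tau,\lambda)|}{\sqrt{(\tau+\lambda)h^{2-\beta}\log\log(1/h)}}\ge K_\beta\ \text{ for all }\tau\in[0,\infty)\right)=1,$$ where $$K_\beta=\left(\frac{2^{(1-\beta)/2}}{(2-\beta)(1-\beta)}\right)^{1/2}.$$
   Context: Fix $0<\beta<1$ and a complete probability space $(\Omega,\mathscr{F},\mathbb{P})$. Let $W$ be a mean zero Gaussian noise, white in time and colored in space: $\{W(\varphi)\}$ is a mean zero Gaussian process indexed by $\varphi\in C_c^\infty(\mathbb{R}_+\times\mathbb{R})$ with $\mathbb{E}[W(\varphi)W(\psi)]=\int_{\mathbb{R}_+}ds\int_{\mathbb{R}}dy\int_{\mathbb{R}}dy'\,\varphi(s,y)|y-y'|^{-\beta}\psi(s,y')$, extended by $L^2(\mathbb{P})$-limits to bounded Borel sets $A\subset\mathbb{R}_+\times\mathbb{R}$ (writing $W(A)$ for the value at $\mathbf{1}_A$), so that $\{W(A)\}$ is a mean zero Gaussian family with $$\mathbb{E}[W(A)W(B)]=\int_{\mathbb{R}_+}ds\int_{\mathbb{R}}dy\int_{\mathbb{R}}dy'\,\mathbf{1}_A(s,y)|y-y'|^{-\beta}\mathbf{1}_B(s,y').$$ For $t\ge 0$, $x\in\mathbb{R}$, let $\Delta(t,x)=\{(s,y)\in\mathbb{R}_+\times\mathbb{R}:0\le s\le t,\ |x-y|\le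 t-s\}$ and $u(t,x)=\frac12 W(\Delta(t,x))$. This is the mild solution of $\partial_t^2u-\partial_x^2u=\dot W$ with zero initial data $u(0,x)=\partial_tu(0,x)=0$. The random field $u$ is taken to be its continuous version. For $\tau\ge0$, $\lambda\ge0$ put $$\tilde u(\tau,\lambda)=u\Big(\frac{\tau+\lambda}{\sqrt2},\frac{-\tau+\lambda}{\sqrt2}\Big).$$ *)

(* Defs.v *)
From HB Require Import structures.
From mathcomp Require Import all_boot all_order all_algebra.
From mathcomp Require Import all_classical all_reals all_analysis.

Set Implicit Arguments.
Unset Strict Implicit.
Unset Printing Implicit Defensive.

Import Order.TTheory GRing.Theory Num.Theory.
Import numFieldNormedType.Exports.

Local Open Scope classical_set_scope.
Local Open Scope ring_scope.

Definition bounded_borel (R : realType) (A : set (R * R)) : Prop :=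
  [/\ measurable (A : set (measurableTypeR R * measurableTypeR R)),
      bounded_set A &
      A `<=` [set p | 0 <= p.1]].

Fixpoint Cn (R : realType) (n : nat) (f : R * R -> R) : Prop :=
  if n is k.+1 then
    [/\ continuous f,
        forall p v, derivable f p v,
        Cn k ('D_((1, 0) : R * R) f) &
        Cn k ('D_((0, 1) : R * R) f)]
  else continuous f.

(* A function of C_c^oo(R_+ x R) is represented by any extension of it in
   C_c^oo(R x R); only its values on R_+ x R enter [noise_cov]. *)
Definition test_function (R : realType) (phi : R * R -> R) : Prop :=
  (forall n, Cn n phi) /\ compact (closure [set p | phi p != 0]).

Definition noise_cov (R : realType) (beta : R) (f g : R * R -> R) : \bar R :=
  let mu := @lebesgue_measure R in
  (\int[mu]_(s in `[0%R, +oo[) \int[mu]_y \int[mu]_y'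
     (f (s, y) * `|y - y'| `^ (- beta) * g (s, y'))%:E)%E.

(* Normal law of mean m and standard deviation s; the case s = 0 is separated
   because [normal_prob m 0] is not the Dirac mass at m. *)
Definition gaussian_law (R : realType) (m s : R) (B : set R) : \bar R :=
  if s == 0 then \d_m B else normal_prob m s B.

Definition gaussian_rv d (T : measurableType d) (R : realType)
    (P : probability T R) (X : T -> R) : Prop :=
  exists m s : R, forall B : set (measurableTypeR R),
    measurable B -> P (X @^-1` B) = gaussian_law m s B.

(* Degenerate normal laws are allowed for the linear combinations. *)
Definition gaussian_process d (T : measurableType d) (R : realType)
    (P : probability T R) (I : Type) (D : set I) (X : I -> T -> R) : Prop :=
  forall (n : nat) (i : 'I_n -> I) (a : 'I_n -> R),
    (forall k, D (i k)) -> gaussian_rv P (fun w => \sum_(k < n) a k * X (i k) w).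

Definition integrand (R : realType) : set (R * R -> R) :=
  [set f | test_function f \/ exists2 A, bounded_borel A & f = \1_A].

(* W(A) is W \1_A.  Test functions and indicators are put in one centered
   Gaussian process: by bilinearity, the covariances between W(phi) and W(A)
   give E[(W(phi) - W(A))^2] = noise_cov beta (phi - \1_A) (phi - \1_A), that
   is, W(A) is the L^2(P)-limit of W(phi_n) when phi_n tends to \1_A in the
   seminorm defined by noise_cov. *)
Definition colored_noise d (T : measurableType d) (R : realType)
    (P : probability T R) (beta : R) (W : (R * R -> R) -> {RV P >-> R}) : Prop :=
  [/\ gaussian_process P (@integrand R) (fun f => W f),
      forall f, integrand f -> ('E_P[W f])%E = 0%E &
      forall f g, integrand f -> integrand g ->
        ('E_P[W f \* W g])%E = noise_cov beta f g].

Definition light_cone (R : realType) (t x : R) : set (R * R) :=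
  [set p | [/\ 0 <= p.1, p.1 <= t & `|x - p.2| <= t - p.1]].

(* u is a continuous version of (t, x) |-> W(light_cone t x) / 2 on R_+ x R;
   u t x is not constrained for t < 0. *)
Definition wave_solution d (T : measurableType d) (R : realType)
    (P : probability T R) (W : (R * R -> R) -> {RV P >-> R})
    (u : R -> R -> {RV P >-> R}) : Prop :=
  (forall t x : R, 0 <= t ->
     {ae P, forall w, u t x w = 2^-1 * W \1_(light_cone t x) w})
  /\ (forall w, {within [set p : R * R | 0 <= p.1],
                   continuous (fun p : R * R => u p.1 p.2 w)}).

Definition utilde d (T : measurableType d) (R : realType) (P : probability T R)
    (u : R -> R -> {RV P >-> R}) (tau lambda : R) : {RV P >-> R} :=
  u ((tau + lambda) / Num.sqrt 2) ((- tau + lambda) / Num.sqrt 2).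

Definition K_const (R : realType) (beta : R) : R :=
  Num.sqrt (2 `^ ((1 - beta) / 2) / ((2 - beta) * (1 - beta))).

(* Main.v *)
(** In the characteristic coordinates s + y and s - y, the increment
    utilde(tau, lambda + h) - utilde(tau, lambda) is half the noise of a strip
    of width proportional to h, and its variance is at least
    (K^2 / 2) (tau + lambda) h^(2 - beta).

    Fix tau and put h_n = M^(- k n) for n <= M.  The normalized increments X_n
    at these scales are nearly uncorrelated.  Applying Chebyshev's inequality
    to the sum of f(X_n), for a trigonometric polynomial f concentrated near
    the levels +-L with L = sqrt(2 r log M), only requires pairwise
    decorrelation, and shows that all |X_n| stay below r L with probability
    O(M^(- (1 - r))).  With M = 2^(Q J) and Q large this beats the number of
    points of the grid of mesh 2^(- J) on [0, m].  Between grid points a dyadic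
    chaining argument bounds the oscillation in tau by O(h_n^((2 - beta) / 2))
    for all n <= M at once, which is negligible against
    sqrt(h_n^(2 - beta) log M), while log log (1 / h_n) ~ log M.  Both
    exceptional events have probability O(2^(- J)), so almost surely infinitely
    many J are good for all tau in [0, m] at once; then let r tend to 1 and m to
    infinity. *)

(* One null set must serve uncountably many tau, so the union bound over the grid needs a failure
   probability polynomially small in the number of scales, although the increments at different
   scales are dependent. Pairwise information suffices because a Gaussian pair (X, Y) enters only
   through E cos(aX + bY), a Lipschitz function of the variance of aX + bY, so that decorrelation is
   read off from the correlation. The test function is a power, of order log M, of sin^2(pi x / (2
   L)): it is at most 1/M for |x| <= r L, while its mean is at least of order exp(-L^2 / 2) =
   M^(-r). Its frequencies are of order sqrt(log M), so correlations of size M^(-3) are harmless;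
   this dictates k beta >= 8 in the scales. K is the product of K / sqrt 2, from the standard
   deviation, and sqrt 2, from the height sqrt(2 log M) of the maximum of M independent standard
   normal variables. Since log(1 / h_n) is linear in n, the index may run up to M at the cost of one
   log M in log log(1 / h_n). The noise describes an increment only almost surely for each fixed
   tau; path continuity carries the estimates off the dyadic points. *)
Require Import Defs.
From HB Require Import structures.
From mathcomp Require Import all_boot all_order all_algebra.
From mathcomp Require Import all_classical all_reals all_analysis.
From mathcomp Require Import measurable_realfun simple_functions.
From mathcomp Require Import ring lra.
Set Implicit Arguments.
Unset Strict Implicit.
Unset Printing Implicit Defensive.
Import Order.TTheory GRing.Theory Num.Theory.
Import numFieldNormedType.Exports.
Local Open Scope classical_set_scope.
Local Open Scope ring_scope.

(** * Normal laws *)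

Section normal_integrals.
Import HBNNSimple.
Context {R : realType}.
Local Notation mu := (@lebesgue_measure R).
Implicit Types (m s t v x y : R).

Lemma ge0_integral_normal_prob m s (f : measurableTypeR R -> \bar R) :
  measurable_fun [set: R] f -> (forall x, 0 <= f x)%E ->
  (\int[normal_prob m s]_x f x =
   \int[mu]_x (f x * (normal_pdf m s x)%:E))%E.
Proof.
move=> mf f0.
have mpdf : measurable_fun setT (fun x => (normal_pdf m s x)%:E).
  by apply/measurable_EFinP; exact: measurable_normal_pdf.
(* On sets the density formula is the definition of [normal_prob]; simple functions and monotone
   convergence extend it to [f]. *)
pose g := nnsfun_approx measurableT mf.
have gcvg x : ((g n x)%:E @[n --> \oo] --> f x)%E.
  by apply: cvg_nnsfun_approx => //= *; exact: f0.
have gmon x : {homo (fun n => (g n x)%:E) : a b / (a <= b)%N >-> (a <= b)%E}.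
  by move=> a b ab; rewrite lee_fin; exact/lefP/nd_nnsfun_approx.
have mg n : measurable_fun [set: R] (fun x => (g n x)%:E).
  exact/measurable_EFinP/measurable_funP.
have mgi n k : measurable_fun [set: R] (fun x => (\1_(g n @^-1` [set k]) x : R)).
  exact: measurable_indic.
have mgiE n k : measurable_fun [set: R] (fun x => (\1_(g n @^-1` [set k]) x : R)%:E).
  exact/measurable_EFinP.
have mgk n k : measurable_fun [set: R] (fun x => (k * \1_(g n @^-1` [set k]) x)%:E).
  by apply/measurable_EFinP/measurable_funM.
transitivity (limn (fun n => \int[normal_prob m s]_x (g n x)%:E)%E).
  rewrite -monotone_convergence//.
  - by apply: eq_integral => y _; apply/esym/cvg_lim.
  - by move=> n y _; rewrite lee_fin.
rewrite [X in limn X](_ : _ =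
    (fun n => \int[mu]_x ((g n x)%:E * (normal_pdf m s x)%:E)))%E.
  rewrite -monotone_convergence//.
  - apply: eq_integral => y _; apply/cvg_lim => //.
    by apply: cvgeZr => //.
  - move=> n; apply: emeasurable_funM => //.
    exact: mg.
  - by move=> n y _; rewrite mule_ge0// lee_fin// normal_pdf_ge0.
  - by move=> x _ a b ab; rewrite lee_wpmul2r// ?lee_fin ?normal_pdf_ge0// -lee_fin gmon.
apply/funext => n.
transitivity (\sum_(k \in range (g n))
    \int[mu]_x ((k * \1_(g n @^-1` [set k]) x)%:E * (normal_pdf m s x)%:E))%E; last first.
  rewrite -ge0_integral_fsum//.
  - apply: eq_integral => x _; rewrite [in RHS]fimfunE -fsumEFin// ge0_mule_fsuml//.
    by move=> k; rewrite nnfun_muleindic_ge0.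
  - by move=> k; apply: emeasurable_funM => //; exact: mgk.
  - by move=> k x _; rewrite mule_ge0// ?nnfun_muleindic_ge0// lee_fin normal_pdf_ge0.
under eq_integral do rewrite fimfunE -fsumEFin//.
rewrite ge0_integral_fsum//; last 2 first.
- by move=> y; exact: mgk.
- by move=> y x _; rewrite nnfun_muleindic_ge0.
apply: eq_fsbigr => r; rewrite inE => -[z _ <-].
under eq_integral do rewrite EFinM.
rewrite ge0_integralZl//; last first.
- by rewrite lee_fin.
- exact: mgiE.
under [RHS]eq_integral do rewrite EFinM -muleA.
rewrite [RHS]ge0_integralZl//; last first.
- by rewrite lee_fin.
- by move=> x _; rewrite mule_ge0// lee_fin normal_pdf_ge0.
- by apply: emeasurable_funM => //; exact: mgiE.
congr (_ * _)%E.
have mA : measurable (g n @^-1` [set g n z] : set R) by exact: measurable_sfunP.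
rewrite integral_indic//.
have -> : g n @^-1` [set g n z] `&` setT = g n @^-1` [set g n z] by exact: setIT.
rewrite [LHS]integral_mkcond.
apply: eq_integral => x _; rewrite patchE indicE.
by case: ifPn => _; rewrite ?mul1e ?mul0e.
Qed.

(** Completing the square: an exponential tilt shifts the mean by t s^2. Integrated, this is the
    moment generating function. *)
Lemma expR_normal_pdf m s t x : s != 0 ->
  expR (t * x) * normal_pdf m s x =
  expR (t * m + t ^+ 2 * s ^+ 2 / 2) * normal_pdf (m + t * s ^+ 2) s x.
Proof.
move=> s0; rewrite !normal_pdfE// /normal_fun [LHS]mulrCA [RHS]mulrCA -!expRD.
by congr (_ * expR _); field.
Qed.

(** A Gaussian tilt of a centered normal density changes its variance to s^2 / (1 - 2 t s^2). Both
    the second moment and the tail bound come from this identity. *)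
Lemma expR_sqr_normal_pdf s t x : s != 0 -> 0 < 1 - 2 * t * s ^+ 2 ->
  expR (t * x ^+ 2) * normal_pdf 0 s x =
  (Num.sqrt (1 - 2 * t * s ^+ 2))^-1 *
  normal_pdf 0 (s / Num.sqrt (1 - 2 * t * s ^+ 2)) x.
Proof.
move=> s0; set a := 1 - _ => a0.
have sa0 : Num.sqrt a != 0 by rewrite sqrtr_eq0 -ltNge.
have sa2 : s / Num.sqrt a != 0 by rewrite mulf_neq0// invr_neq0.
rewrite !normal_pdfE// /normal_fun mulrCA [RHS]mulrA -expRD.
have -> : (s / Num.sqrt a) ^+ 2 = s ^+ 2 / a.
  by rewrite expr_div_n sqr_sqrtr// ltW.
congr (_ * expR _).
  rewrite /normal_peak -mulrnAr.
  rewrite (sqrtrM (pi *+ 2)) ?sqr_ge0// -[(s / _) ^+ 2 * pi *+ 2]mulrnAr expr_div_n sqr_sqrtr ?(ltW a0)//.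
  rewrite (sqrtrM (pi *+ 2)) ?divr_ge0 ?sqr_ge0 ?(ltW a0)//.
  rewrite [Num.sqrt (s ^+ 2 / a)]sqrtrM ?sqr_ge0// sqrtrV ?(ltW a0)//.
  have p0 : Num.sqrt (pi *+ 2 : R) != 0.
    by rewrite sqrtr_eq0 -ltNge mulrn_wgt0// pi_gt0.
  have q0 : Num.sqrt (s ^+ 2) != 0 by rewrite sqrtr_sqr normr_eq0.
  by field; rewrite p0 q0 sa0.
rewrite /a subr0; field; rewrite s0 /=.
by rewrite gt_eqF.
Qed.

(** For independent X1, X2 the joint density of (X1 + e X2, X2) factors into the density of X1 + e
    X2 and the conditional density of X2. The sign [e] treats the sum and the difference
    together. *)
Lemma normal_pdf_convolution s1 s2 (e : R) x y : s1 != 0 -> s2 != 0 -> e ^+ 2 = 1 ->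
  let S := Num.sqrt (s1 ^+ 2 + s2 ^+ 2) in
  normal_pdf 0 s1 (x - e * y) * normal_pdf 0 s2 y =
  normal_pdf 0 S x * normal_pdf (e * x * s2 ^+ 2 / S ^+ 2) (s1 * s2 / S) y.
Proof.
move=> s10 s20 e2 S.
have q1 : 0 < s1 ^+ 2 by rewrite exprn_even_gt0.
have q2 : 0 < s2 ^+ 2 by rewrite exprn_even_gt0.
have S2 : S ^+ 2 = s1 ^+ 2 + s2 ^+ 2 by rewrite sqr_sqrtr// addr_ge0 ?sqr_ge0.
have S0 : S != 0 by rewrite sqrtr_eq0 -ltNge addr_gt0.
have S20 : s1 * s2 / S != 0 by rewrite !mulf_neq0// invr_neq0.
rewrite !normal_pdfE// /normal_fun [LHS]mulrACA [RHS]mulrACA -!expRD.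
congr (_ * expR _).
  rewrite /normal_peak -!mulrnAr !(sqrtrM (pi *+ 2)) ?sqr_ge0//.
  rewrite !sqrtr_sqr !normrM normfV.
  have p0 : Num.sqrt (pi *+ 2 : R) != 0.
    by rewrite sqrtr_eq0 -ltNge mulrn_wgt0// pi_gt0.
  by field; rewrite p0 !normr_eq0 S0 s10 s20.
rewrite expr_div_n exprMn S2.
have e3 : e * e = 1 by rewrite -e2 expr2.
have E1 : (x - e * y - 0) ^+ 2 = x ^+ 2 - 2 * (e * x * y) + y ^+ 2.
  by rewrite -[X in _ = _ + X]mul1r -[X in _ = _ + X * _]e2; ring.
have E2 (c : R) : (y - e * x * s2 ^+ 2 / c) ^+ 2 =
   y ^+ 2 - 2 * (e * x * y) * s2 ^+ 2 / c + x ^+ 2 * s2 ^+ 4 / c ^+ 2.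
  by rewrite -[x ^+ 2]mul1r -[X in _ = _ + X * _ * _ / _]e2 -exprVn; ring.
rewrite E1 E2 !subr0.
have q3 : s1 ^+ 2 + s2 ^+ 2 != 0 by rewrite gt_eqF// addr_gt0.
by field; rewrite s10 s20 q3.
Qed.

Lemma integral_shift (f : R -> R) (a : R) : continuous f -> (forall x, 0 <= f x) ->
  (\int[mu]_x (f x)%:E = \int[mu]_x (f (x + a))%:E)%E.
Proof.
move=> cf f0; pose F := (fun x => x + a : R^o).
have dF x : is_derive x 1 F 1.
  by rewrite /F -[X in is_derive _ _ _ X]addr0; apply: is_deriveD.
have F1 : F^`()%classic = cst 1.
  by apply/funext => x; rewrite derive1E; exact: derive_val.
rewrite (@increasing_ge0_integration_by_substitutionT _ F f)//.
- by apply: eq_integral => x _; rewrite F1 /= mulr1.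
- by move=> x y; rewrite /F ltrD2r.
- by rewrite F1 => x; exact: cvg_cst.
- by rewrite F1; exact: is_cvg_cst.
- by rewrite F1; exact: is_cvg_cst.
- exact: cvg_addrr_Ny.
- exact: cvg_addrr.
Qed.

Lemma integral_expR_normal m s t : s != 0 ->
  (\int[normal_prob m s]_x (expR (t * x))%:E =
   (expR (t * m + t ^+ 2 * s ^+ 2 / 2))%:E)%E.
Proof.
move=> s0; rewrite ge0_integral_normal_prob; last 2 first.
- by apply/measurable_EFinP; apply: (measurableT_comp (f := expR)).
- by move=> x; rewrite lee_fin expR_ge0.
under eq_integral do rewrite -EFinM expR_normal_pdf// EFinM.
rewrite ge0_integralZl_EFin ?expR_ge0//; last 2 first.
- by move=> x _; rewrite lee_fin normal_pdf_ge0.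
- by apply/measurable_EFinP; exact: measurable_normal_pdf.
by rewrite integral_normal_pdf mule1.
Qed.

Lemma integral_expR_sqr_normal s t : s != 0 -> 0 < 1 - 2 * t * s ^+ 2 ->
  (\int[normal_prob 0 s]_x (expR (t * x ^+ 2))%:E =
   ((Num.sqrt (1 - 2 * t * s ^+ 2))^-1)%:E)%E.
Proof.
move=> s0 t0; rewrite ge0_integral_normal_prob; last 2 first.
- apply/measurable_EFinP; apply: measurableT_comp => //.
  by apply: measurable_funM => //; exact: measurable_funX.
- by move=> x; rewrite lee_fin expR_ge0.
under eq_integral do rewrite -EFinM expR_sqr_normal_pdf// EFinM.
rewrite ge0_integralZl_EFin ?invr_ge0 ?sqrtr_ge0//; last 2 first.
- by move=> x _; rewrite lee_fin normal_pdf_ge0.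
- by apply/measurable_EFinP; exact: measurable_normal_pdf.
by rewrite integral_normal_pdf mule1.
Qed.

Lemma eq_of_small_gap (a b c t0 : R) : 0 < t0 -> 0 <= c ->
  (forall t, 0 < t -> t <= t0 -> `|a - b| <= c * t) -> a = b.
Proof.
move=> t00 c0 H; apply/eqP; rewrite -subr_eq0 -normr_le0.
apply/ler_addgt0Pl => e e0; rewrite addr0.
have p : 0 < e / (c + 1) by rewrite divr_gt0// ltr_wpDl.
have [h|h] := leP (e / (c + 1)) t0.
  apply: (le_trans (H _ p h)); rewrite mulrCA ler_piMr ?(ltW e0)//.
  by rewrite ler_pdivrMr ?mul1r ?lerDl ?ltr_wpDl.
apply: (le_trans (H _ t00 (lexx _))); apply: (@le_trans _ _ (c * (e / (c + 1)))).
  by rewrite ler_wpM2l// ltW.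
rewrite mulrCA ler_piMr ?(ltW e0)//.
by rewrite ler_pdivrMr ?mul1r ?lerDl ?ltr_wpDl.
Qed.

Lemma inv_sqrt_le (a b : R) : 0 < a -> 0 <= b -> 1 <= a * b ^+ 2 ->
  (Num.sqrt a)^-1 <= b.
Proof.
move=> a0 b0 h; rewrite -[leLHS]mulr1 ler_pdivrMl ?sqrtr_gt0//.
rewrite -(@ler_pXn2r _ 2)// ?nnegrE ?mulr_ge0 ?sqrtr_ge0//.
by rewrite expr1n exprMn sqr_sqrtr// ltW.
Qed.

(** The second moment V is the derivative at 0 of E exp(t x^2) = (1 - 2 t s^2)^(-1/2). Integrating 1
    + t x^2 <= exp(t x^2) and 1 - t x^2 <= exp(- t x^2) confines V to within 4 s^4 t of s^2 for
    small t. *)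
Lemma integral_sqr_normal s : s != 0 ->
  (\int[normal_prob 0 s]_x (x ^+ 2)%:E = (s ^+ 2)%:E)%E.
Proof.
move=> s0; set V := (X in X = _).
have s20 : 0 < s ^+ 2 by rewrite exprn_even_gt0.
have mx2 : measurable_fun [set: R] (fun x : R => (x ^+ 2)%:E).
  by apply/measurable_EFinP; exact: measurable_funX.
have mex t : measurable_fun [set: R] (fun x : R => (expR (t * x ^+ 2))%:E).
  apply/measurable_EFinP; apply: measurableT_comp => //.
  by apply: measurable_funM => //; exact: measurable_funX.
have V0 : (0 <= V)%E by apply: integral_ge0 => x _; rewrite lee_fin sqr_ge0.
(* For [t <= t0] the quantity a = t s^2 is at most 1/4, where the second order bounds on (1 -
   2a)^(-1/2) and (1 + 2a)^(-1/2) hold. *)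
pose t0 : R := 1 / (4 * s ^+ 2).
have t00 : 0 < t0 by rewrite divr_gt0// mulr_gt0.
have nT : (\int[normal_prob 0 s]_x (cst 1 x))%E = 1%E.
  by rewrite integral_cst// mul1e; exact: integral_normal_pdf.
have up t : 0 < t -> t <= t0 -> (1 + t%:E * V <= (1 + t * s ^+ 2 + (2 * t * s ^+ 2) ^+ 2)%:E)%E.
  move=> tp tt0.
  have ta : t * s ^+ 2 <= 1 / 4.
    by rewrite -ler_pdivlMr// (le_trans tt0)// /t0 !div1r invfM.
  have ta0 : 0 <= t * s ^+ 2 by rewrite mulr_ge0 ?ltW.
  have a0 : 0 < 1 - 2 * t * s ^+ 2 by rewrite -mulrA; lra.
  apply: (@le_trans _ _ (\int[normal_prob 0 s]_x (expR (t * x ^+ 2))%:E)%E).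
    rewrite -ge0_integralZl_EFin ?(ltW tp)//; last by move=> x _; rewrite lee_fin sqr_ge0.
    rewrite -nT.
    rewrite -ge0_integralD//; last 2 first.
    - by move=> x _; rewrite mule_ge0// lee_fin ?sqr_ge0 ?ltW.
    - by apply/measurable_EFinP; apply: measurable_funM => //; exact/measurable_EFinP.
    apply: ge0_le_integral => //.
    - by move=> x _; rewrite adde_ge0// mule_ge0// lee_fin ?sqr_ge0 ?ltW.
    - apply: emeasurable_funD => //.
      by apply/measurable_EFinP; apply: measurable_funM => //; exact/measurable_EFinP.
    - exact: mex.
    - by move=> x _ /=; rewrite lee_fin expR_ge1Dx.
  rewrite integral_expR_sqr_normal// lee_fin.
  apply: inv_sqrt_le => //; rewrite -?mulrA; set a := t * _ in ta ta0 *.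
    by rewrite !addr_ge0// sqr_ge0.
  rewrite -subr_ge0.
  have -> : (1 - 2 * a) * (1 + a + (2 * a) ^+ 2) ^+ 2 - 1 = a ^+ 2 * (5 - 10 * a - 32 * a ^+ 3) by ring.
  rewrite mulr_ge0 ?sqr_ge0//.
  have : a ^+ 3 <= (1 / 4) ^+ 3 by rewrite lerXn2r// nnegrE; lra.
  lra.
have dn t : 0 < t -> t <= t0 -> (1 <= t%:E * V + (1 - t * s ^+ 2 + (2 * t * s ^+ 2) ^+ 2)%:E)%E.
  move=> tp tt0.
  have ta0 : 0 <= t * s ^+ 2 by rewrite mulr_ge0 ?ltW.
  have ta : t * s ^+ 2 <= 1 / 4.
    by rewrite -ler_pdivlMr// (le_trans tt0)// /t0 !div1r invfM.
  have a0 : 0 < 1 - 2 * (- t) * s ^+ 2 by rewrite mulrN mulNr -mulrA; lra.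
  apply: (@le_trans _ _ (t%:E * V + \int[normal_prob 0 s]_x (expR (- t * x ^+ 2))%:E)%E).
    rewrite -ge0_integralZl_EFin ?(ltW tp)//; last by move=> x _; rewrite lee_fin sqr_ge0.
    rewrite -nT.
    rewrite -ge0_integralD//; last 3 first.
    - by move=> x _; rewrite mule_ge0// lee_fin ?sqr_ge0 ?ltW.
    - by apply/measurable_EFinP; apply: measurable_funM => //; exact/measurable_EFinP.
    - exact: mex.
    apply: ge0_le_integral => //.
    - apply: emeasurable_funD => //.
      by apply/measurable_EFinP; apply: measurable_funM => //; exact/measurable_EFinP.
    - exact: mex.
    - move=> x _ /=; rewrite lee_fin -lerBlDl.
      by have := expR_ge1Dx (- t * x ^+ 2); rewrite mulNr.
  rewrite integral_expR_sqr_normal// leeD2l// lee_fin.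
  apply: inv_sqrt_le => //; rewrite -?mulrA ?(mulNr t); set a := t * _ in ta ta0 *.
    by rewrite addr_ge0 ?sqr_ge0//; lra.
  rewrite -subr_ge0.
  have -> : (1 - 2 * - a) * (1 - a + (2 * a) ^+ 2) ^+ 2 - 1 = a ^+ 2 * (5 + 10 * a + 32 * a ^+ 3) by ring.
  by rewrite mulr_ge0 ?sqr_ge0// !addr_ge0// mulr_ge0// exprn_ge0.
have Vf : V \is a fin_num.
  rewrite ge0_fin_numE// ltNge leye_eq; apply/negP => /eqP VE.
  by have := up _ t00 (lexx _); rewrite VE gt0_muley ?lte_fin// addey.
rewrite -(fineK Vf); congr (_%:E).
apply: (@eq_of_small_gap _ _ (4 * s ^+ 4) _ t00).
  by rewrite mulr_ge0// exprn_even_ge0.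
move=> t tp tt0.
have := up _ tp tt0; have := dn _ tp tt0; rewrite -(fineK Vf) /= !lee_fin => h1 h2.
rewrite ler_norml; apply/andP; split; rewrite -(ler_pM2l tp); lra.
Qed.

End normal_integrals.

Section trigonometric_bounds.
Context {R : realType}.
Implicit Types x : R.

Lemma normr_sin_le x : `|sin x| <= `|x|.
Proof.
wlog x0 : x / 0 <= x.
  move=> H; have [/H//|/ltW x0] := leP 0 x.
  by rewrite -normrN -sinN -(normrN x) H// oppr_ge0.
have [c _] := @MVT_segment R sin cos 0 x x0 (fun x _ => is_derive_sin x)
  (continuous_subspaceT (@continuous_sin R)).
rewrite sin0 !subr0 => ->; rewrite normrM ler_piMl//.
exact: cos_max.
Qed.

Lemma cos_ge_quadratic x : 1 - x ^+ 2 / 2 <= cos x.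
Proof.
have E : cos x = 1 - 2 * sin (x / 2) ^+ 2.
  rewrite {1}(splitr x) cosD -!expr2 cos2sin2; ring.
have h : sin (x / 2) ^+ 2 <= (x / 2) ^+ 2.
  by rewrite -(real_normK (num_real (sin _))) -(real_normK (num_real (x / 2))) lerXn2r ?nnegrE// normr_sin_le.
rewrite E; have -> : x ^+ 2 = 4 * (x / 2) ^+ 2 by field.
lra.
Qed.

Lemma measurable_cos_mul (t : R) : measurable_fun [set: R] (fun x => cos (t * x)).
Proof.
apply: continuous_measurable_fun => x; apply: continuous_comp.
  exact: mulrl_continuous.
exact: continuous_cos.
Qed.

Lemma measurable_cos : measurable_fun [set: R] (@cos R).
Proof. by apply: continuous_measurable_fun; exact: continuous_cos. Qed.

End trigonometric_bounds.

(** * Centered Gaussian laws and their identification by two moments *)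

Section centered_gaussian.
Context {R : realType} d (T : measurableType d) (P : probability T R).
Implicit Types (X Y : T -> R) (v s : R).

Definition centered_normal s : probability (measurableTypeR R) R :=
  if s == 0 then (\d_(0 : measurableTypeR R) : probability (measurableTypeR R) R)
  else (normal_prob 0 s : probability (measurableTypeR R) R).

(** The parameter is the variance, which is polynomial in the coefficients of a linear combination;
    it may be 0. *)
Definition centered_gaussian X v :=
  [/\ measurable_fun [set: T] X, 0 <= v &
      forall A : set (measurableTypeR R), measurable A ->
        P (X @^-1` A) = centered_normal (Num.sqrt v) A].

Lemma ge0_integral_law (nu : measure (measurableTypeR R) R) X (f : R -> R) :
  measurable_fun [set: T] X ->
  (forall A : set (measurableTypeR R), measurable A -> P (X @^-1` A) = nu A) ->
  measurable_fun [set: R] f -> (forall x, 0 <= f x) ->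
  (\int[P]_w (f (X w))%:E = \int[nu]_x (f x)%:E)%E.
Proof.
move=> mX XA mf f0.
have mfE : measurable_fun [set: measurableTypeR R] (fun x => (f x)%:E).
  exact/measurable_EFinP.
have := @ge0_integral_pushforward _ _ T (measurableTypeR R) R X mX P setT _ measurableT mfE.
rewrite preimage_setT => <-//; last by move=> x _; rewrite lee_fin.
by apply: eq_measure_integral => A mA _; exact: XA.
Qed.

Lemma Rintegral_law (nu : probability (measurableTypeR R) R) X (f : R -> R) M :
  measurable_fun [set: T] X ->
  (forall A : set (measurableTypeR R), measurable A -> P (X @^-1` A) = nu A) ->
  measurable_fun [set: R] f -> (forall x, `|f x| <= M) ->
  (\int[P]_w (f (X w)) = \int[nu]_x (f x))%R.
Proof.
move=> mX XA mf f0.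
have mfE : measurable_fun [set: measurableTypeR R] (fun x => (f x)%:E).
  exact/measurable_EFinP.
have mfX : measurable_fun [set: T] (f \o X) by exact: measurableT_comp.
have := @integral_pushforward _ _ T (measurableTypeR R) R X mX P setT _ mfE.
rewrite preimage_setT => H; rewrite /Rintegral -[in LHS]H//.
  by congr fine; apply: eq_measure_integral => A mA _; exact: XA.
apply: (@measurable_bounded_integrable _ _ _ _ (f \o X)) => //.
  exact: (le_lt_trans (probability_le1 P measurableT) (ltry 1)).
by exists M; split; rewrite ?num_real// => x Mx y _ /=; rewrite (le_trans (f0 _))// ltW.
Qed.

Lemma bounded_integrable (Q : probability T R) (f : T -> R) M :
  measurable_fun [set: T] f -> (forall x, `|f x| <= M) -> Q.-integrable setT (EFin \o f).
Proof.
move=> mf f0; apply: measurable_bounded_integrable => //.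
  exact: (le_lt_trans (probability_le1 Q measurableT) (ltry 1)).
by exists M; split; rewrite ?num_real// => x Mx y _ /=; rewrite (le_trans (f0 _))// ltW.
Qed.

(** [gaussian_rv] leaves the mean and the standard deviation unspecified; the first two moments pin
    them down. For [s != 0] the mean vanishes because 1 = E(1 + tX) <= E exp(tX) makes the exponent
    t m + t^2 s^2 / 2 nonnegative for every t. *)
Lemma gaussian_rv_centered X v : gaussian_rv P X -> measurable_fun [set: T] X ->
  P.-integrable setT (EFin \o X) -> (\int[P]_w (X w)%:E = 0)%E ->
  (\int[P]_w (X w ^+ 2)%:E = v%:E)%E -> centered_gaussian X v.
Proof.
move=> [m [s Xms]] mX iX X0 Xv.
have m0 : m = 0 /\ v = s ^+ 2.
  have [s0|s0] := eqVneq s 0.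
    pose nu : measure (measurableTypeR R) R := \d_(m : measurableTypeR R).
    have XA (A : set (measurableTypeR R)) : measurable A -> P (X @^-1` A) = nu A.
      by move=> mA; rewrite Xms// /gaussian_law s0 eqxx.
    have mm : m = 0.
      have : (\int[P]_w (X w)%:E = m%:E)%E.
        rewrite -(@integral_pushforward _ _ T (measurableTypeR R) R X mX P setT EFin)//.
          rewrite (@eq_measure_integral _ _ _ _ nu).
            by rewrite integral_dirac// diracT mul1e.
          by move=> A mA _; exact: XA.
      by rewrite X0 => -[].
    split => //; apply: EFin_inj; rewrite -Xv (@ge0_integral_law _ X (fun x => x ^+ 2) mX XA).
    - rewrite integral_dirac//; last by apply/measurable_EFinP; exact: measurable_funX.
      by rewrite diracT mul1e mm s0.
    - exact: measurable_funX.
    - by move=> x; exact: sqr_ge0.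
  have XA (A : set (measurableTypeR R)) : measurable A -> P (X @^-1` A) = normal_prob m s A.
    by move=> mA; rewrite Xms// /gaussian_law (negbTE s0).
  have mgf t : 0 <= t * m + t ^+ 2 * s ^+ 2 / 2.
    have mt : measurable_fun [set: R] (fun x => expR (t * x)).
      by apply: (measurableT_comp (f := expR)).
    have mtX : measurable_fun [set: T] (fun w => (expR (t * X w))%:E).
      by apply/measurable_EFinP; apply: (measurableT_comp mt).
    have v_mgf : (\int[P]_w (expR (t * X w))%:E =
        (expR (t * m + t ^+ 2 * s ^+ 2 / 2))%:E)%E.
      rewrite (@ge0_integral_law _ X (fun x => expR (t * x)) mX XA)//.
      exact: integral_expR_normal.
    have i2 : P.-integrable setT (fun w => (t%:E * (X w)%:E)%E) by exact: integrableZl.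
    have i1 : P.-integrable setT (fun _ : T => (1%:E : \bar R)).
      exact: finite_measure_integrable_cst.
    have h : (1 <= \int[P]_w (expR (t * X w))%:E)%E.
      have -> : (1 = \int[P]_w (1%:E + t%:E * (X w)%:E))%E.
        rewrite integralD//= integralZl// X0 mule0 adde0 integral_cst// mul1e.
        exact/esym/(probability_setT P).
      apply: le_integral => //.
      - exact: integrableD.
      - apply/integrableP; split => //.
        under eq_integral do rewrite gee0_abs ?lee_fin ?expR_ge0//.
        by rewrite v_mgf ltry.
      - by move=> w _; rewrite lee_fin expR_ge1Dx.
    by move: h; rewrite v_mgf lee_fin -[leLHS]expR0 ler_expR.
  have m0 : m = 0.
    have s2 : 0 < s ^+ 2 by rewrite exprn_even_gt0.
    (* The minimizer of the exponent, where its value is - m^2 / (2 s^2). *)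
    have := mgf (- m / s ^+ 2).
    have -> : - m / s ^+ 2 * m + (- m / s ^+ 2) ^+ 2 * s ^+ 2 / 2 = - (m ^+ 2 / (2 * s ^+ 2)).
      by field.
    have h2 : 0 < 2 * s ^+ 2 by rewrite mulr_gt0.
    rewrite oppr_ge0 pmulr_lle0 ?invr_gt0// => h.
    by apply/eqP; rewrite -sqrf_eq0 eq_le h sqr_ge0.
  split => //; apply: EFin_inj; rewrite -Xv (@ge0_integral_law _ X (fun x => x ^+ 2) mX XA).
  - by rewrite m0 integral_sqr_normal.
  - exact: measurable_funX.
  - by move=> x; exact: sqr_ge0.
case: m0 => m0 vs; split => //; first by rewrite vs sqr_ge0.
(* [s] may be negative: the law depends on |s| = sqrt(s^2) only. *)
move=> A mA; rewrite Xms// /gaussian_law m0 vs sqrtr_sqr /centered_normal normr_eq0.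
case: ifPn => [_|s0]; first by [].
rewrite /normal_prob; apply: eq_integral => x _; congr EFin.
by rewrite !normal_pdfE ?normr_eq0// /normal_peak /normal_fun real_normK ?num_real.
Qed.

End centered_gaussian.

(** * The characteristic function of a centered normal law *)

Section chi.
Context {R : realType}.
Local Notation mu := (@lebesgue_measure R).

Lemma continuous_mul (f g : R -> R) :
  continuous f -> continuous g -> continuous (fun x => f x * g x).
Proof. by move=> cf cg x; apply: cvgM; [exact: cf|exact: cg]. Qed.

(** This is exp(- s^2 / 2). It enters through its multiplicativity in the variance, the bound by 1
    and a quadratic lower bound. *)
Definition chi (s : R) : R := \int[centered_normal s]_x cos x.

(** Tonelli's theorem combined with [normal_pdf_convolution]. The constant 1 added to the cosine
    makes the integrand nonnegative. *)
Lemma shifted_cos_convolution (s1 s2 e : R) : s1 != 0 -> s2 != 0 -> e ^+ 2 = 1 ->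
  (\int[normal_prob 0%R s2]_y \int[normal_prob 0%R s1]_x (1 + cos (x + e * y))%:E =
   \int[normal_prob 0%R (Num.sqrt (s1 ^+ 2 + s2 ^+ 2))]_x (1 + cos x)%:E)%E.
Proof.
move=> s10 s20 e2; set S := Num.sqrt _.
pose g (x : R) := 1 + cos x.
have g0 x : 0 <= g x by rewrite /g -lerBlDl sub0r cos_geN1.
have mg : measurable_fun [set: R] g.
  by apply: measurable_funD => //; exact: measurable_cos.
have cg : continuous g.
  move=> x; apply: (@continuousD _ R^o R^o); [exact: cst_continuous|exact: continuous_cos].
pose n1 := normal_pdf 0 s1. pose n2 := normal_pdf 0 s2.
have inner y : (\int[normal_prob 0%R s1]_x (g (x + e * y))%:E =
   \int[mu]_x (g x * n1 (x - e * y))%:E)%E.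
  rewrite ge0_integral_normal_prob; last 2 first.
  - apply/measurable_EFinP; apply: measurableT_comp => //.
    exact: measurable_funD.
  - by move=> x; rewrite lee_fin.
  under eq_integral do rewrite -EFinM.
  rewrite (@integral_shift _ (fun x => g (x + e * y) * n1 x) (- (e * y))).
  - by apply: eq_integral => x _; rewrite subrK.
  - apply: continuous_mul; last exact: continuous_normal_pdf.
    move=> x; apply: (@continuous_comp _ _ _ (fun x => x + e * y) g); last exact: cg.
    by apply: cvgD; [exact: cvg_id|exact: cvg_cst].
  - by move=> x; rewrite mulr_ge0// normal_pdf_ge0.
pose F (p : R * R) : \bar R := (g p.1 * n1 (p.1 - e * p.2) * n2 p.2)%:E.
have mF : measurable_fun [set: R * R] F.
  apply/measurable_EFinP; apply: measurable_funM; first apply: measurable_funM.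
  - exact: measurableT_comp.
  - apply: measurableT_comp; first exact: measurable_normal_pdf.
    apply: measurable_funB => //; exact: measurable_funM.
  - by apply: measurableT_comp => //; exact: measurable_normal_pdf.
have F0 p : (0 <= F p)%E by rewrite lee_fin !mulr_ge0// normal_pdf_ge0.
have mG : measurable_fun [set: R] (fun y => \int[mu]_x (g x * n1 (x - e * y))%:E)%E.
  apply: (@measurable_fun_fubini_tonelli_G _ _ _ _ _ mu (fun p : R * R => (g p.1 * n1 (p.1 - e * p.2))%:E)).
  - apply/measurable_EFinP; apply: measurable_funM; first exact: measurableT_comp.
    apply: measurableT_comp; first exact: measurable_normal_pdf.
    by apply: measurable_funB => //; exact: measurable_funM.
  - by move=> p; rewrite lee_fin mulr_ge0// normal_pdf_ge0.
under eq_integral do rewrite inner.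
rewrite [LHS]ge0_integral_normal_prob//; last first.
  by move=> y; apply: integral_ge0 => x _; rewrite lee_fin mulr_ge0// normal_pdf_ge0.
transitivity (\int[mu]_y \int[mu]_x F (x, y))%E.
  apply: eq_integral => y _; rewrite -ge0_integralZr//.
  - apply/measurable_EFinP; apply: measurable_funM => //.
    apply: measurableT_comp; first exact: measurable_normal_pdf.
    exact: measurable_funB.
  - by move=> x _; rewrite lee_fin mulr_ge0// normal_pdf_ge0.
  - by rewrite lee_fin normal_pdf_ge0.
rewrite -(@fubini_tonelli _ _ _ _ _ mu mu F)//.
rewrite [RHS]ge0_integral_normal_prob//; last exact/measurable_EFinP.
apply: eq_integral => x _.
under eq_integral do rewrite /F /= -mulrA /n1 /n2 normal_pdf_convolution// -/S mulrA EFinM.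
rewrite ge0_integralZl_EFin//.
- by rewrite integral_normal_pdf mule1.
- by move=> y _; rewrite lee_fin normal_pdf_ge0.
- by apply/measurable_EFinP; exact: measurable_normal_pdf.
- by rewrite mulr_ge0// normal_pdf_ge0.
Qed.

Lemma measurable_cos_shift (y e : R) : measurable_fun [set: R] (fun x => cos (x + e * y)).
Proof.
by apply: (measurableT_comp (f := cos)); [exact: measurable_cos|exact: measurable_funD].
Qed.

Lemma Rintegral_normal_le1 (Q : probability (measurableTypeR R) R) (f : R -> R) :
  measurable_fun [set: R] f -> (forall x, `|f x| <= 1) ->
  `|\int[Q]_x f x| <= 1.
Proof.
move=> mf f1; have fi : Q.-integrable setT (EFin \o f) by exact: bounded_integrable.
apply: (le_trans (le_normr_Rintegral _ _)) => //.
have -> : (1 : R) = \int[Q]_x (1 : R).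
  rewrite Rintegral_cst//= mul1r.
  by rewrite [X in fine X](_ : _ = 1%E)//; exact: probability_setT.
apply: le_Rintegral => //.
- apply: (@bounded_integrable _ _ _ _ _ 1); first exact: measurableT_comp.
  by move=> x; rewrite normr_id.
- apply: (@bounded_integrable _ _ _ _ _ 1) => // x.
  by rewrite normr1.
Qed.

Lemma integral_1Dcos (s : R) :
  (\int[normal_prob 0%R s]_x (1 + cos x)%:E = (1 + \int[normal_prob 0%R s]_x cos x)%:E)%E.
Proof.
have ic : (normal_prob 0 s).-integrable setT (EFin \o cos).
  apply: (@bounded_integrable _ _ _ _ _ 1); first exact: measurable_cos.
  by move=> x; exact: cos_max.
have ic1 : (normal_prob 0 s).-integrable setT (fun=> 1%E : \bar R).
  exact: finite_measure_integrable_cst.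
under eq_integral do rewrite EFinD.
rewrite integralD//= integral_cst// mul1e EFinD; congr (_ + _)%E.
  exact: (@probability_setT _ _ _ (normal_prob 0 s)).
by rewrite /Rintegral fineK//; exact: integral_fune_fin_num.
Qed.

Lemma measurable_inner_1Dcos (s e : R) : measurable_fun [set: R]
  (fun y => \int[normal_prob 0%R s]_x (1 + cos (x + e * y))%:E)%E.
Proof.
have mF : measurable_fun [set: R * R] (fun p : R * R => (1 + cos (p.1 + e * p.2))%:E).
  apply/measurable_EFinP; apply: measurable_funD => //.
  apply: (measurableT_comp (f := cos)); first exact: measurable_cos.
  by apply: measurable_funD => //; exact: measurable_funM.
apply: (@measurable_fun_fubini_tonelli_G _ _ _ _ _ (normal_prob 0 s) _ mF).
by move=> p; rewrite lee_fin -lerBlDl sub0r cos_geN1.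
Qed.

Lemma inner_1Dcos_ge0 (s e y : R) :
  (0 <= \int[normal_prob 0%R s]_x (1 + cos (x + e * y))%:E)%E.
Proof. by apply: integral_ge0 => x _; rewrite lee_fin -lerBlDl sub0r cos_geN1. Qed.

Lemma integral_affine_cos (s y : R) : (\int[normal_prob 0%R s]_x (2 + 2 * (cos x * y))%:E =
    (2 + 2 * ((\int[normal_prob 0%R s]_x cos x) * y))%:E)%E.
Proof.
have ic1 : (normal_prob 0 s).-integrable setT (fun=> 2%:E : \bar R).
  exact: finite_measure_integrable_cst.
have ic : (normal_prob 0 s).-integrable setT (EFin \o cos).
  apply: (@bounded_integrable _ _ _ _ _ 1); first exact: measurable_cos.
  by move=> x; exact: cos_max.
have icy : (normal_prob 0 s).-integrable setT (fun x => ((2 * y)%:E * (cos x)%:E)%E).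
  exact: integrableZl.
have -> : (\int[normal_prob 0%R s]_x (2 + 2 * (cos x * y))%:E =
    \int[normal_prob 0%R s]_x (2%:E + (2 * y)%:E * (cos x)%:E))%E.
  by apply: eq_integral => x _; rewrite -EFinM -EFinD; congr EFin; ring.
rewrite integralD//= integral_cst// [X in (_ * X)%E](_ : _ = 1%E); last first.
  exact: (@probability_setT _ _ _ (normal_prob 0 s)).
rewrite mule1 [RHS]EFinD; congr (_ + _)%E.
rewrite integralZl//= -[X in (_ * X)%E]fineK; last exact: integral_fune_fin_num.
by rewrite -EFinM; congr EFin; rewrite /Rintegral; ring.
Qed.

Lemma inner_1Dcos_sum (s y : R) :
  (\int[normal_prob 0%R s]_x (1 + cos (x + 1 * y))%:E +
   \int[normal_prob 0%R s]_x (1 + cos (x + -1 * y))%:E =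
   (2 + 2 * ((\int[normal_prob 0%R s]_x cos x) * cos y))%:E)%E.
Proof.
rewrite -integral_affine_cos -ge0_integralD//.
- apply: eq_integral => x _; rewrite -EFinD; congr EFin.
  by rewrite mul1r mulN1r cosD cosB; ring.
- apply/measurable_EFinP; apply: measurable_funD => //; exact: measurable_cos_shift.
- apply/measurable_EFinP; apply: measurable_funD => //; exact: measurable_cos_shift.
Qed.

(** For independent X, Y both cos(X + Y) and cos(X - Y) have mean [chi S], and half their sum is cos
    X cos Y; averaging over the two signs removes the sine terms. *)
Lemma chiM (s1 s2 : R) : 0 <= s1 -> 0 <= s2 ->
  chi s1 * chi s2 = chi (Num.sqrt (s1 ^+ 2 + s2 ^+ 2)).
Proof.
move=> s1_ge0 s2_ge0; have chi0 : chi 0 = 1.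
  rewrite /chi /centered_normal eqxx /Rintegral integral_dirac//; last first.
    by apply/measurable_EFinP; exact: measurable_cos.
  by rewrite diracT mul1e/= cos0.
have [->|s10] := eqVneq s1 0.
  by rewrite chi0 mul1r expr0n add0r sqrtr_sqr ger0_norm.
have [->|s20] := eqVneq s2 0.
  by rewrite chi0 mulr1 expr0n addr0 sqrtr_sqr ger0_norm.
set S := Num.sqrt _.
have S0 : S != 0 by rewrite sqrtr_eq0 -ltNge addr_gt0// exprn_even_gt0.
rewrite /chi /centered_normal (negbTE s10) (negbTE s20) (negbTE S0).
set c1 := \int[_]_x _; set c2 := \int[_]_x _; set c3 := \int[_]_x _.
have e1 : 1 ^+ 2 = 1 :> R by rewrite expr1n.
have e2 : (-1) ^+ 2 = 1 :> R by rewrite sqrrN expr1n.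
have H1 := shifted_cos_convolution s10 s20 e1.
have H2 := shifted_cos_convolution s10 s20 e2.
have mI e := measurable_inner_1Dcos s1 e.
have H : (\int[normal_prob 0%R s2]_y (2 + 2 * (cos y * c1))%:E = (1 + c3)%:E + (1 + c3)%:E)%E.
  rewrite -integral_1Dcos -{1}H1 -H2 -ge0_integralD; first last.
  - exact: mI.
  - by move=> y _; exact: inner_1Dcos_ge0.
  - exact: mI.
  - by move=> y _; exact: inner_1Dcos_ge0.
  - exact: measurableT.
  by apply: eq_integral => y _; rewrite inner_1Dcos_sum (mulrC c1).
move: H; rewrite integral_affine_cos -EFinD => -[] H.
move: H; rewrite -/c2 => {H1 H2 mI}; clearbody c1 c2 c3 => H.
lra.
Qed.

Lemma chi_le1 (s : R) : `|chi s| <= 1.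
Proof.
apply: Rintegral_normal_le1; first exact: measurable_cos.
by move=> x; exact: cos_max.
Qed.

Lemma chi_ge (s : R) : 1 - s ^+ 2 / 2 <= chi s.
Proof.
have [->|s0] := eqVneq s 0.
  rewrite /chi /centered_normal eqxx /Rintegral integral_dirac//; last first.
    by apply/measurable_EFinP; exact: measurable_cos.
  by rewrite diracT mul1e/= cos0 expr0n mul0r subr0.
have ic : (normal_prob 0 s).-integrable setT (EFin \o cos).
  apply: (@bounded_integrable _ _ _ _ _ 1); first exact: measurable_cos.
  by move=> x; exact: cos_max.
have iq : (normal_prob 0 s).-integrable setT (fun x => (x ^+ 2)%:E).
  apply/integrableP; split; first by apply/measurable_EFinP; exact: measurable_funX.
  under eq_integral do rewrite gee0_abs ?lee_fin ?sqr_ge0//.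
  by rewrite integral_sqr_normal// ltry.
have i1 : (normal_prob 0 s).-integrable setT (fun=> 1%:E : \bar R).
  exact: finite_measure_integrable_cst.
have iz : (normal_prob 0 s).-integrable setT (fun x => ((2^-1)%:E * (x ^+ 2)%:E)%E : \bar R).
  exact: integrableZl.
rewrite /chi /centered_normal (negbTE s0) -lee_fin /Rintegral fineK; last first.
  exact: integral_fune_fin_num.
have -> : ((1 - s ^+ 2 / 2)%:E = \int[normal_prob 0%R s]_x (1%:E - (2^-1)%:E * (x ^+ 2)%:E))%E.
  rewrite integralB//= integralZl// integral_sqr_normal// integral_cst//.
  rewrite [X in (_ * X)%E](_ : _ = 1%E); last first.
    exact: (@probability_setT _ _ _ (normal_prob 0 s)).
  by rewrite mule1 -EFinM -EFinB mulrC.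
apply: le_integral => //; first exact: integrableB.
by move=> x _; rewrite -EFinM -EFinB lee_fin (mulrC 2^-1) cos_ge_quadratic.
Qed.

Opaque chi.

(** For p <= q multiplicativity gives chi(sqrt q) = chi(sqrt p) chi(sqrt(q - p)), so the difference
    is at most 1 - chi(sqrt(q - p)) <= (q - p) / 2. *)
Lemma chi_sqrt_lipschitz (p q : R) : 0 <= p -> 0 <= q ->
  `|chi (Num.sqrt p) - chi (Num.sqrt q)| <= `|p - q| / 2.
Proof.
wlog pq : p q / p <= q.
  move=> H p0 q0; have [pq|/ltW qp] := leP p q; first exact: H.
  by rewrite (distrC (chi _)) (distrC p); exact: H.
move=> p0 q0; have qp : 0 <= q - p by rewrite subr_ge0.
have -> : chi (Num.sqrt q) = chi (Num.sqrt p) * chi (Num.sqrt (q - p)).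
  rewrite (chiM (sqrtr_ge0 p) (sqrtr_ge0 (q - p))) (sqr_sqrtr p0) (sqr_sqrtr qp).
  by rewrite [p + _]addrC subrK.
rewrite -{1}[chi (Num.sqrt p)]mulr1 -mulrBr normrM.
apply: (@le_trans _ _ `|1 - chi (Num.sqrt (q - p))|).
  by rewrite ler_piMl// chi_le1.
have := chi_ge (Num.sqrt (q - p)); rewrite sqr_sqrtr// => h.
have h1 : chi (Num.sqrt (q - p)) <= 1 by rewrite (le_trans (ler_norm _))// chi_le1.
rewrite ger0_norm ?subr_ge0// distrC ger0_norm//; lra.
Qed.

End chi.

(** * Second moment method for Gaussian maxima *)

Section bounded_measurable.
Context {R : realType} d (T : measurableType d) (P : probability T R).
Implicit Types f g : T -> R.

Definition bounded_mfun f :=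
  measurable_fun [set: T] f /\ exists M, forall w, `|f w| <= M.

Lemma bounded_mfun_integrable f : bounded_mfun f -> P.-integrable setT (EFin \o f).
Proof. by move=> [mf [M fM]]; exact: bounded_integrable fM. Qed.

Lemma bounded_mfun_cst c : bounded_mfun (fun=> c).
Proof. by split => //; exists `|c|. Qed.

Lemma bounded_mfunD f g : bounded_mfun f -> bounded_mfun g ->
  bounded_mfun (fun w => f w + g w).
Proof.
move=> [mf [M fM]] [mg [N gN]]; split; first exact: measurable_funD.
by exists (M + N) => w; rewrite (le_trans (ler_normD _ _))// lerD.
Qed.

Lemma bounded_mfunM f g : bounded_mfun f -> bounded_mfun g ->
  bounded_mfun (fun w => f w * g w).
Proof.
move=> [mf [M fM]] [mg [N gN]]; split; first exact: measurable_funM.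
by exists (M * N) => w; rewrite normrM ler_pM.
Qed.

Lemma bounded_mfunZ c f : bounded_mfun f -> bounded_mfun (fun w => c * f w).
Proof. by move=> hf; apply: bounded_mfunM => //; exact: bounded_mfun_cst. Qed.

Lemma bounded_mfun_sum (I : Type) (s : seq I) (F : I -> T -> R) :
  (forall i, bounded_mfun (F i)) -> bounded_mfun (fun w => \sum_(i <- s) F i w).
Proof.
move=> hF; elim: s => [|i s IH].
  rewrite (_ : (fun _ => _) = fun=> 0); first exact: bounded_mfun_cst.
  by apply/funext => w; rewrite big_nil.
rewrite (_ : (fun _ => _) = fun w => F i w + \sum_(j <- s) F j w); first exact: bounded_mfunD.
by apply/funext => w; rewrite big_cons.
Qed.

Lemma Rint_cst c : \int[P]_w (c : R) = c.
Proof.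
rewrite Rintegral_cst// [X in fine X](_ : _ = 1%E) ?mulr1//.
exact: (probability_setT P).
Qed.

Lemma Rint_D f g : bounded_mfun f -> bounded_mfun g ->
  \int[P]_w (f w + g w) = \int[P]_w f w + \int[P]_w g w.
Proof. by move=> hf hg; rewrite RintegralD//; exact: bounded_mfun_integrable. Qed.

Lemma Rint_Z c f : bounded_mfun f -> \int[P]_w (c * f w) = c * \int[P]_w f w.
Proof. by move=> hf; rewrite RintegralZl//; exact: bounded_mfun_integrable. Qed.

Lemma Rint_le f g : bounded_mfun f -> bounded_mfun g -> (forall w, f w <= g w) ->
  \int[P]_w f w <= \int[P]_w g w.
Proof. by move=> hf hg fg; apply: le_Rintegral => //; exact: bounded_mfun_integrable. Qed.

Lemma Rint_sum (I : Type) (s : seq I) (F : I -> T -> R) :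
  (forall i, bounded_mfun (F i)) ->
  \int[P]_w (\sum_(i <- s) F i w) = \sum_(i <- s) \int[P]_w F i w.
Proof.
move=> hF; elim: s => [|i s IH].
  by rewrite big_nil; under eq_Rintegral do rewrite big_nil; exact: Rint_cst.
rewrite big_cons -IH -Rint_D//; last exact: bounded_mfun_sum.
by apply: eq_Rintegral => w _; rewrite big_cons.
Qed.

Lemma Rint_indic (A : set T) : measurable A -> (\int[P]_w (\1_A w : R))%:E = P A.
Proof.
move=> mA; rewrite /Rintegral fineK; last first.
  apply: integral_fune_fin_num => //; apply: (@bounded_integrable _ _ _ _ _ 1).
    exact: measurable_indic.
  by move=> w; rewrite indicE; case: (_ \in _); rewrite ?normr1 ?normr0.
by rewrite integral_indic// setIT.
Qed.

Lemma bounded_mfun_indic (A : set T) : measurable A -> bounded_mfun (\1_A : T -> R).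
Proof.
move=> mA; split; first exact: measurable_indic.
by exists 1 => w; rewrite indicE; case: (_ \in _); rewrite ?normr1 ?normr0.
Qed.

(* Chebyshev's inequality for the sum of the F i: on A it deviates from its mean by half of it. *)
Lemma second_moment_bound (M : nat) (F : 'I_M -> T -> R) (A : set T) (p c eta : R) :
  (forall i, bounded_mfun (F i)) -> measurable A -> 0 < p -> 0 <= c -> (0 < M)%N ->
  (forall i w, 0 <= F i w <= 1) ->
  (forall i, \int[P]_w F i w = p) ->
  (forall i j, i != j -> \int[P]_w (F i w * F j w) <= p ^+ 2 + c) ->
  (forall i w, A w -> F i w <= eta) -> eta <= p / 2 ->
  (P A <= (4 / (M%:R * p) + 4 * c / p ^+ 2)%:E)%E.
Proof.
move=> hF mA p0 c0 M0 F01 Fp Fc FA etap.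
have M0' : 0 < M%:R :> R by rewrite ltr0n.
pose G i w := F i w - p.
have hG i : bounded_mfun (G i) by apply: bounded_mfunD => //; exact: bounded_mfun_cst.
have hGG i j : bounded_mfun (fun w => G i w * G j w) by exact: bounded_mfunM.
pose S w := \sum_i \sum_j (G i w * G j w).
have hS : bounded_mfun S.
  by apply: bounded_mfun_sum => i; exact: bounded_mfun_sum.
have SE w : S w = (\sum_i G i w) ^+ 2.
  rewrite /S expr2 mulr_suml; apply: eq_bigr => i _.
  by rewrite mulr_sumr.
have IGG i j : \int[P]_w (G i w * G j w) <= (if i == j then p else 0) + c.
  have -> : \int[P]_w (G i w * G j w) = \int[P]_w (F i w * F j w) - p ^+ 2.
    transitivity (\int[P]_w (F i w * F j w + (- p * F i w + (- p * F j w + p ^+ 2)))).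
      by apply: eq_Rintegral => w _; rewrite /G; ring.
    have h1 : bounded_mfun (fun w => - p * F j w + p ^+ 2).
      by apply: bounded_mfunD; [exact: bounded_mfunZ|exact: bounded_mfun_cst].
    rewrite Rint_D; [|exact: bounded_mfunM|]; last first.
      by apply: bounded_mfunD => //; exact: bounded_mfunZ.
    rewrite Rint_D//; last exact: bounded_mfunZ.
    rewrite Rint_D//; [|exact: bounded_mfunZ|exact: bounded_mfun_cst].
    by rewrite (Rint_Z _ (hF i)) (Rint_Z _ (hF j)) !Fp Rint_cst; ring.
  (* On the diagonal F_i^2 <= F_i, since F_i takes values in [0, 1]. *)
  case: eqVneq => [<-|ij]; last by rewrite add0r lerBlDl Fc.
  have : \int[P]_w (F i w * F i w) <= p.
    rewrite -(Fp i); apply: Rint_le => //; first exact: bounded_mfunM.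
    by move=> w; have /andP[a b] := F01 i w; rewrite ler_piMr.
  by move=> h; have := sqr_ge0 p; lra.
have IS : \int[P]_w S w <= M%:R * p + M%:R ^+ 2 * c.
  rewrite /S Rint_sum; last by move=> i; exact: bounded_mfun_sum.
  apply: (@le_trans _ _ (\sum_(i < M) (p + M%:R * c))); last first.
    by rewrite sumr_const card_ord -mulr_natl; lra.
  apply: ler_sum => i _; rewrite Rint_sum//.
  apply: (@le_trans _ _ (\sum_(j < M) ((if i == j then p else 0) + c))).
    by apply: ler_sum.
  rewrite big_split/= -big_mkcond/= (big_pred1 i); last by move=> j; rewrite eq_sym.
  by rewrite sumr_const card_ord -[c *+ M]mulr_natl.
have AS w : (M%:R * p / 2) ^+ 2 * \1_A w <= S w.
  rewrite SE indicE; have [wA|_] := boolP (w \in A); last by rewrite mulr0 sqr_ge0.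
  have SN : - (\sum_i G i w) = \sum_i (p - F i w).
    by rewrite -sumrN; apply: eq_bigr => i _; rewrite opprB.
  have q0' : 0 <= M%:R * p / 2 by rewrite divr_ge0// mulr_ge0// ltW.
  have h : M%:R * p / 2 <= \sum_i (p - F i w).
    have -> : M%:R * p / 2 = \sum_(i < M) (p / 2).
      by rewrite sumr_const card_ord -[(p / 2) *+ M]mulr_natl mulrA.
    by apply: ler_sum => i _; have := FA i w (set_mem wA); lra.
  rewrite mulr1 -[leRHS]sqrrN SN lerXn2r// nnegrE//.
  exact: le_trans h.
rewrite -(Rint_indic mA) lee_fin.
have q0 : 0 < (M%:R * p / 2) ^+ 2 by rewrite exprn_gt0// divr_gt0// mulr_gt0.
have h : (M%:R * p / 2) ^+ 2 * \int[P]_w (\1_A w : R) <= M%:R * p + M%:R ^+ 2 * c.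
  rewrite -Rint_Z; last exact: bounded_mfun_indic.
  apply: le_trans IS; apply: Rint_le => //; apply: bounded_mfunZ; exact: bounded_mfun_indic.
rewrite -(ler_pM2l q0) (le_trans h)//.
rewrite le_eqVlt; apply/orP; left; apply/eqP; field.
by rewrite !gt_eqF.
Qed.

End bounded_measurable.

(** * Trigonometric polynomials as test functions *)

Section trigonometric_polynomials.
Context {R : realType}.

(* Frequencies are at most A and the coefficients have l^1 norm c. *)
Inductive trigpoly (A : R) : R -> (R -> R) -> Prop :=
| trigpoly_cos a : `|a| <= A -> trigpoly A 1 (fun x => cos (a * x))
| trigpolyD c c' f g : trigpoly A c f -> trigpoly A c' g ->
    trigpoly A (c + c') (fun x => f x + g x)
| trigpolyZ k c f : trigpoly A c f -> trigpoly A (`|k| * c) (fun x => k * f x).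

Lemma trigpoly_bound A c f : trigpoly A c f ->
  [/\ 0 <= c, measurable_fun [set: R] f & forall x, `|f x| <= c].
Proof.
elim=> [a aA|c1 c2 f1 f2 _ [h1 h2 h3] _ [k1 k2 k3]|k c1 f1 _ [h1 h2 h3]].
- by split => //; [exact: measurable_cos_mul|move=> x; exact: cos_max].
- split; [exact: addr_ge0|exact: measurable_funD|move=> x].
  by rewrite (le_trans (ler_normD _ _))// lerD.
- split; [exact: mulr_ge0|exact: measurable_funM|move=> x].
  by rewrite normrM ler_wpM2l.
Qed.

(** This is sin^2(w x / 2). For w = pi / L it increases in |x| on [-L, L] up to the value 1 at +-L,
    so on that interval its high powers concentrate near the two ends. *)
Definition hump (w x : R) : R := (1 - cos (w * x)) / 2.

Lemma hump_ge0 w x : 0 <= hump w x.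
Proof. by rewrite divr_ge0// subr_ge0 cos_le1. Qed.

Lemma hump_le1 w x : hump w x <= 1.
Proof. by rewrite ler_pdivrMr// mul1r; have := cos_geN1 (w * x); lra. Qed.

(** The product formula turns hump times cosine into three cosines with coefficients 1/2, -1/4,
    -1/4. Their l^1 norm is 1, so powers of the hump keep norm 1 while their frequencies grow only
    linearly. *)
Lemma trigpoly_hump A w c f : 0 <= w -> trigpoly A c f ->
  trigpoly (A + w) c (fun x => hump w x * f x).
Proof.
move=> w0; elim=> [a aA|c1 c2 f1 f2 _ h1 _ h2|k c1 f1 _ h1].
- have -> : (fun x => hump w x * cos (a * x)) = (fun x => 2^-1 * cos (a * x) +
      ((- 4^-1) * cos ((a + w) * x) + (- 4^-1) * cos ((a - w) * x))).
    by apply/funext => x; rewrite mulrDl mulrBl cosD cosB /hump; field.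
  have c1E : `|2^-1| * 1 + (`|- 4^-1| * 1 + `|- 4^-1| * 1) = 1 :> R.
    by rewrite !normrN !ger0_norm ?invr_ge0//; field.
  rewrite -[X in trigpoly _ X]c1E.
  apply: trigpolyD; [|apply: trigpolyD]; apply: trigpolyZ; apply: trigpoly_cos.
  + by rewrite (le_trans aA)// lerDl.
  + by rewrite (le_trans (ler_normD _ _))// lerD// ger0_norm.
  + by rewrite (le_trans (ler_normB _ _))// lerD// ger0_norm.
- have -> : (fun x => hump w x * (f1 x + f2 x)) = (fun x => hump w x * f1 x + hump w x * f2 x).
    by apply/funext => x; rewrite mulrDr.
  exact: trigpolyD.
- have -> : (fun x => hump w x * (k * f1 x)) = (fun x => k * (hump w x * f1 x)).
    by apply/funext => x; rewrite mulrCA.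
  exact: trigpolyZ.
Qed.

Lemma trigpoly_hump_exp w n : 0 <= w -> trigpoly (n%:R * w) 1 (fun x => hump w x ^+ n).
Proof.
move=> w0; elim: n => [|n IH].
  have -> : (fun x => hump w x ^+ 0) = (fun x => cos (0 * x)).
    by apply/funext => x; rewrite expr0 mul0r cos0.
  by apply: trigpoly_cos; rewrite normr0 mul0r.
have -> : (fun x => hump w x ^+ n.+1) = (fun x => hump w x * hump w x ^+ n).
  by apply/funext => x; rewrite exprS.
by rewrite -natr1 mulrDl mul1r; exact: trigpoly_hump.
Qed.

End trigonometric_polynomials.

(** * Decorrelation of Gaussian pairs *)

Section decorrelation.
Context {R : realType} d (T : measurableType d) (P : probability T R).
Implicit Types X Y : T -> R.

(** Joint normality expressed by all linear combinations: unit variances and correlation [rho]. *)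
Definition gaussian_pair X Y rho := forall s t : R,
  centered_gaussian P (fun w => s * X w + t * Y w) (s ^+ 2 + 2 * s * t * rho + t ^+ 2).

Lemma expect_cos X v : centered_gaussian P X v ->
  \int[P]_w cos (X w) = chi (Num.sqrt v).
Proof.
move=> [mX v0 XA].
rewrite (@Rintegral_law _ _ _ P (centered_normal (Num.sqrt v)) X cos 1 mX XA)//.
- exact: measurable_cos.
- by move=> x; exact: cos_max.
Qed.

Lemma gaussian_pair_measurable X Y rho : gaussian_pair X Y rho ->
  measurable_fun [set: T] X /\ measurable_fun [set: T] Y.
Proof.
move=> H; have [m1 _ _] := H 1 0; have [m2 _ _] := H 0 1.
split.
- by rewrite (_ : X = fun w => 1 * X w + 0 * Y w)//; apply/funext => w; rewrite mul1r mul0r addr0.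
- by rewrite (_ : Y = fun w => 0 * X w + 1 * Y w)//; apply/funext => w; rewrite mul1r mul0r add0r.
Qed.

Lemma trigpoly_bounded_mfun A c f X : trigpoly A c f -> measurable_fun [set: T] X ->
  bounded_mfun (fun w => f (X w)).
Proof.
move=> /trigpoly_bound[c0 mf fc] mX; split; first exact: (measurableT_comp mf).
by exists c.
Qed.

(** The product of cosines is the average of cos(aX + bY) and cos(aX - bY), of variances a^2 + b^2
    +- 2ab rho. At rho = 0 both means equal chi|a| chi|b| by multiplicativity, and the Lipschitz
    bound in the variance charges |ab rho| for each sign. *)
Lemma cos_decorrelation X Y rho a b : gaussian_pair X Y rho ->
  `|\int[P]_w (cos (a * X w) * cos (b * Y w)) -
    \int[P]_w cos (a * X w) * \int[P]_w cos (b * Y w)| <= `|a| * `|b| * `|rho|.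
Proof.
move=> H; have [mX mY] := gaussian_pair_measurable H.
have bc X' c : measurable_fun [set: T] X' -> bounded_mfun (fun w => cos (c * X' w)).
  move=> mX'; split; last by exists 1 => w; exact: cos_max.
  exact: (measurableT_comp (measurable_cos_mul c)).
have bcc s t : bounded_mfun (fun w => cos (s * X w + t * Y w)).
  split; last by exists 1 => w; exact: cos_max.
  have [m1 _ _] := H s t; exact: (measurableT_comp measurable_cos).
have Ea : \int[P]_w cos (a * X w) = chi `|a|.
  rewrite -sqrtr_sqr -(@expect_cos (fun w => a * X w + 0 * Y w)).
    by apply: eq_Rintegral => w _; rewrite mul0r addr0.
  by have := H a 0; rewrite mulr0 mul0r expr0n !addr0.
have Eb : \int[P]_w cos (b * Y w) = chi `|b|.
  rewrite -sqrtr_sqr -(@expect_cos (fun w => 0 * X w + b * Y w)).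
    by apply: eq_Rintegral => w _; rewrite mul0r add0r.
  by have := H 0 b; rewrite mulr0 !mul0r expr0n !add0r.
pose q := a ^+ 2 + b ^+ 2.
have Eab : \int[P]_w (cos (a * X w) * cos (b * Y w)) =
    2^-1 * chi (Num.sqrt (q + 2 * a * b * rho)) + 2^-1 * chi (Num.sqrt (q - 2 * a * b * rho)).
  transitivity (\int[P]_w (2^-1 * cos (a * X w + b * Y w) + 2^-1 * cos (a * X w + - b * Y w))).
    by apply: eq_Rintegral => w _; rewrite mulNr cosD cosB; field.
  rewrite Rint_D ?Rint_Z//; [|exact: bounded_mfunZ|exact: bounded_mfunZ].
  rewrite (expect_cos (H a b)) (expect_cos (H a (- b))).
  have -> : a ^+ 2 + 2 * a * b * rho + b ^+ 2 = q + 2 * a * b * rho by rewrite /q; ring.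
  have -> : a ^+ 2 + 2 * a * - b * rho + (- b) ^+ 2 = q - 2 * a * b * rho by rewrite /q; ring.
  by [].
have p1 : 0 <= q + 2 * a * b * rho.
  by have [_ + _] := H a b; rewrite /q; congr (0 <= _); ring.
have p2 : 0 <= q - 2 * a * b * rho.
  by have [_ + _] := H a (- b); rewrite /q; congr (0 <= _); ring.
have q0 : 0 <= q by rewrite addr_ge0 ?sqr_ge0.
rewrite Ea Eb Eab chiM// !real_normK ?num_real// -/q.
have h1 := chi_sqrt_lipschitz p1 q0; have h2 := chi_sqrt_lipschitz p2 q0.
have e1 : q + 2 * a * b * rho - q = 2 * (a * b * rho) by ring.
have e2 : q - 2 * a * b * rho - q = - (2 * (a * b * rho)) by ring.
move: h1 h2; rewrite e1 e2 normrN normrM normr_nat !normrM.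
move: (chi _) (chi _) (chi _) => u v z.
rewrite !ler_norml => /andP[h1 h2] /andP[h3 h4]; clear -h1 h2 h3 h4.
by apply/andP; split; lra.
Qed.

(** The covariance is bilinear in [f] and [g] and the bound follows the l^1 norms, so two inductions
    reduce the claim to a pair of cosines. *)
Lemma trigpoly_decorrelation X Y rho A B c1 c2 f g : gaussian_pair X Y rho ->
  0 <= A -> 0 <= B -> trigpoly A c1 f -> trigpoly B c2 g ->
  `|\int[P]_w (f (X w) * g (Y w)) -
    \int[P]_w f (X w) * \int[P]_w g (Y w)| <= c1 * c2 * (A * B * `|rho|).
Proof.
move=> H A0 B0 tf tg; have [mX mY] := gaussian_pair_measurable H.
elim: tf => [a aA|k1 k2 f1 f2 t1 h1 t2 h2|k k1 f1 t1 h1]; last 2 first.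
- have b1 := trigpoly_bounded_mfun t1 mX; have b2 := trigpoly_bounded_mfun t2 mX.
  have b3 := trigpoly_bounded_mfun tg mY.
  rewrite (Rint_D P b1 b2); under eq_Rintegral do rewrite mulrDl.
  rewrite (Rint_D P (bounded_mfunM b1 b3) (bounded_mfunM b2 b3)).
  rewrite mulrDl opprD addrACA (le_trans (ler_normD _ _))//.
  by rewrite -mulrA mulrDl lerD// mulrA.
- have b1 := trigpoly_bounded_mfun t1 mX.
  have b3 := trigpoly_bounded_mfun tg mY.
  rewrite (Rint_Z P k b1); under eq_Rintegral do rewrite -mulrA.
  rewrite (Rint_Z P k (bounded_mfunM b1 b3)) -[X in _ - X]mulrA -mulrBr normrM -!mulrA.
  by rewrite ler_wpM2l//; move: h1; rewrite -!mulrA.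
elim: tg => [b bB|k1 k2 f1 f2 t1 h1 t2 h2|k k1 f1 t1 h1]; last 2 first.
- have b1 := trigpoly_bounded_mfun t1 mY; have b2 := trigpoly_bounded_mfun t2 mY.
  have b3 := trigpoly_bounded_mfun (trigpoly_cos aA) mX.
  rewrite (Rint_D P b1 b2); under eq_Rintegral do rewrite mulrDr.
  rewrite (Rint_D P (bounded_mfunM b3 b1) (bounded_mfunM b3 b2)).
  rewrite mulrDr opprD addrACA (le_trans (ler_normD _ _))//.
  by rewrite mulrDr mulrDl lerD.
- have b1 := trigpoly_bounded_mfun t1 mY.
  have b3 := trigpoly_bounded_mfun (trigpoly_cos aA) mX.
  rewrite (Rint_Z P k b1); under eq_Rintegral do rewrite mulrCA.
  rewrite (Rint_Z P k (bounded_mfunM b3 b1)) mulrCA -mulrBr normrM.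
  by rewrite [1 * (_ * _)]mulrCA -[leRHS]mulrA ler_wpM2l.
rewrite !mul1r (le_trans (cos_decorrelation a b H))//.
by rewrite ler_wpM2r// ler_pM.
Qed.

End decorrelation.

(** * Polynomial tail bounds *)

Section tails.
Context {R : realType} d (T : measurableType d) (P : probability T R).
Implicit Types X : T -> R.

Lemma measurable_norm_ge X (x : R) : measurable_fun [set: T] X ->
  measurable [set w | (x <= `|X w|)%R].
Proof.
move=> mX; rewrite -[X in measurable X]setTI; apply: measurable_fun_le => //.
exact: (measurableT_comp (@normr_measurable R setT)).
Qed.

(** Markov's inequality for exp(X^2 / (4v)), whose mean is sqrt 2 <= 2, followed by e^z >= z^n / n!.
    A power of arbitrary order [n] lets the chaining absorb any polynomial number of events. *)
Lemma centered_gaussian_tail (n : nat) X v (x : R) : centered_gaussian P X v -> 0 < x ->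
  (P [set w | (x <= `|X w|)%R] <= (2 * n`!%:R * (4 * v / x ^+ 2) ^+ n)%:E)%E.
Proof.
move=> [mX v0 XA] x0.
have mXx := measurable_norm_ge x mX.
set S := [set w | _] in mXx *.
have [v00|v00] := eqVneq v 0.
  rewrite v00 mulr0 mul0r.
  have -> : P S = 0%E.
    pose A : set (measurableTypeR R) := [set y | x <= `|y|].
    have mA : measurable A.
      have -> : A = [set: R] `&` A by rewrite setTI.
      by apply: measurable_fun_le => //; exact: normr_measurable.
    have := XA A mA; rewrite v00 sqrtr0 /centered_normal eqxx => ->.
    by rewrite /= diracE memNset//= /A /= normr0 leNgt x0.
  by rewrite lee_fin !mulr_ge0// exprn_ge0.
have vp : 0 < v by rewrite lt_neqAle eq_sym v00.
pose f (y : R) := expR ((4 * v)^-1 * y ^+ 2).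
have mf : measurable_fun [set: R] f.
  apply: (measurableT_comp (f := expR)) => //.
  by apply: measurable_funM => //; exact: measurable_funX.
have Ef : (\int[P]_w (f (X w))%:E <= 2%:E)%E.
  rewrite (@ge0_integral_law _ _ _ P _ X f mX XA)//; last by move=> y; exact: expR_ge0.
  have s0 : Num.sqrt v != 0 by rewrite sqrtr_eq0 -ltNge.
  have e : 1 - 2 * (4 * v)^-1 * Num.sqrt v ^+ 2 = 2^-1.
    by rewrite sqr_sqrtr//; field.
  rewrite /centered_normal (negbTE s0) integral_expR_sqr_normal//; last by rewrite e.
  by rewrite e lee_fin; apply: inv_sqrt_le => //; lra.
pose z := x ^+ 2 / (4 * v).
have z0 : 0 < z by rewrite divr_gt0 ?exprn_gt0// mulr_gt0.
have h : ((expR z)%:E * P S <= 2%:E)%E.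
  apply: le_trans Ef.
  rewrite -[X in (_ * P X)%E]setIT -integral_indic// -ge0_integralZl_EFin ?expR_ge0//; last first.
    by apply/measurable_EFinP; exact: measurable_indic.
  apply: ge0_le_integral => //.
  - by apply/measurable_EFinP; apply: measurable_funM => //; exact: measurable_indic.
  - by apply/measurable_EFinP; exact: (measurableT_comp mf).
  - move=> w _; rewrite indicE lee_fin; have [/set_mem/= wA|_] := boolP (_ \in _); last first.
      by rewrite mulr0 expR_ge0.
    rewrite mulr1 ler_expR /z mulrC ler_pM2l ?invr_gt0 ?mulr_gt0//.
    by rewrite -(real_normK (num_real (X w))) lerXn2r ?nnegrE// ltW.
have Pf : P S \is a fin_num by exact: fin_num_measure.
move: h; rewrite -(fineK Pf) -EFinM !lee_fin => h.
have zn : z ^+ n / n`!%:R <= expR z.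
  case: n => [|n]; first by rewrite expr0 fact0 divr1 -expR0 ler_expR ltW.
  by apply: le_trans (expR_ge1Dxn n (ltW z0)); rewrite lerDr.
have zn0 : 0 < z ^+ n / n`!%:R by rewrite divr_gt0 ?exprn_gt0 ?ltr0n ?fact_gt0.
apply: (@le_trans _ _ (2 / (z ^+ n / n`!%:R))).
  rewrite ler_pdivlMr// mulrC; apply: le_trans h; rewrite ler_wpM2r//.
  by rewrite fine_ge0.
rewrite le_eqVlt; apply/orP; left; apply/eqP.
by rewrite /z -[4 * v / x ^+ 2]invrK invf_div exprVn invf_div mulrA.
Qed.

End tails.

Section hump_estimates.
Context {R : realType}.
Implicit Types r x : R.

Lemma bernoulli_inequality (a : R) n : 0 <= a -> a <= 1 -> 1 - n%:R * a <= (1 - a) ^+ n.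
Proof.
move=> a0 a1; elim: n => [|n IH]; first by rewrite mul0r subr0 expr0.
rewrite exprS -natr1; apply: (@le_trans _ _ ((1 - a) * (1 - n%:R * a))); last first.
  by rewrite ler_wpM2l// subr_ge0.
have : 0 <= n%:R * a * a by rewrite !mulr_ge0.
lra.
Qed.

Lemma hump_near (L x : R) : 0 < L -> 1 - (pi / L * (L - x)) ^+ 2 / 4 <= hump (pi / L) x.
Proof.
move=> L0; have -> : hump (pi / L) x = (1 + cos (pi / L * (L - x))) / 2.
  rewrite /hump mulrBr mulfVK ?gt_eqF// cosB cospi sinpi; ring.
have := cos_ge_quadratic (pi / L * (L - x)); lra.
Qed.

Lemma hump_far (r L x : R) : 0 < r -> r < 1 -> 0 < L -> `|x| <= r * L ->
  hump (pi / L) x <= hump pi r.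
Proof.
move=> r0 r1 L0 xr; rewrite /hump ler_pM2r ?invr_gt0// lerD2l lerN2.
have -> : cos (pi / L * x) = cos (pi / L * `|x|).
  by case: (ger0P x) => // _; rewrite mulrN cosN.
have p0 := pi_gt0 R.
have pL : 0 < pi / L :> R by rewrite divr_gt0.
have xL : pi / L * `|x| <= pi * r.
  apply: (@le_trans _ _ (pi / L * (r * L))); first by rewrite ler_pM2l.
  by rewrite le_eqVlt; apply/orP; left; apply/eqP; field; rewrite gt_eqF.
have i1 : pi * r \in `[0, pi] by rewrite in_itv/= mulr_ge0 ?(ltW p0) ?(ltW r0)//= ler_piMr ?(ltW p0) ?(ltW r1).
have i2 : pi / L * `|x| \in `[0, pi].
  by rewrite in_itv/= mulr_ge0 ?(ltW pL)//= (le_trans xL)// ler_piMr ?(ltW p0) ?(ltW r1).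
by rewrite leNgt ltr_cos// -leNgt.
Qed.

Lemma hump_pi_lt1 r : 0 < r -> r < 1 -> 0 < hump pi r < 1.
Proof.
move=> r0 r1; have p0 := pi_gt0 R.
have i1 : pi * r \in `[0, pi] by rewrite in_itv/= mulr_ge0 ?(ltW p0) ?(ltW r0)//= ler_piMr ?(ltW p0) ?(ltW r1).
have i2 : (pi : R) \in `[0, pi] by rewrite in_itv/= lexx ltW.
have i3 : (0 : R) \in `[0, pi] by rewrite in_itv/= lexx ltW.
have h1 : cos pi < cos (pi * r) by rewrite ltr_cos// gtr_pMr.
have h2 : cos (pi * r) < cos 0 by rewrite ltr_cos// mulr_gt0.
by move: h1 h2; rewrite cospi cos0 /hump => h1 h2; apply/andP; split; lra.
Qed.

End hump_estimates.

(** * Maxima of weakly correlated Gaussian variables *)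

Section gaussian_maxima.
Context {R : realType}.
Local Notation mu := (@lebesgue_measure R).

Lemma measurable_hump_exp (w : R) k : measurable_fun [set: R] (fun x => hump w x ^+ k).
Proof.
apply: measurable_funX; apply: measurable_funM => //; apply: measurable_funB => //.
exact: measurable_cos_mul.
Qed.

Lemma hump_exp_01 (w x : R) k : 0 <= hump w x ^+ k <= 1.
Proof. by rewrite exprn_ge0 ?hump_ge0//= exprn_ile1 ?hump_ge0 ?hump_le1. Qed.

(* On the window [L - de, L], of width of order 1, the hump is at least 1/2. *)
Lemma hump_exp_mean_ge (L de : R) k : 1 <= L -> 0 < de -> de <= 1 ->
  k%:R * ((pi / L * de) ^+ 2 / 4) <= 1 / 2 ->
  de / 2 * normal_peak 1 * expR (- (L ^+ 2 / 2)) <=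
  \int[centered_normal 1]_x (hump (pi / L) x ^+ k).
Proof.
move=> L1 de0 de1 kd; have L0 : 0 < L by exact: lt_le_trans L1.
have n10 : (1 : R) != 0 by rewrite oner_neq0.
rewrite /centered_normal (negbTE n10) -lee_fin /Rintegral fineK; last first.
  apply: integral_fune_fin_num => //; apply: (@bounded_integrable _ _ _ _ _ 1).
    exact: measurable_hump_exp.
  by move=> x; have /andP[a b] := hump_exp_01 (pi / L) x k; rewrite ger0_norm.
rewrite ge0_integral_normal_prob; last 2 first.
- by apply/measurable_EFinP; exact: measurable_hump_exp.
- by move=> x; rewrite lee_fin; have /andP[] := hump_exp_01 (pi / L) x k.
pose c := 2^-1 * normal_peak 1 * expR (- (L ^+ 2 / 2)).
have c0 : 0 <= c by rewrite !mulr_ge0 ?normal_peak_ge0 ?expR_ge0.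
have pw (x : R) : c * \1_`[L - de, L]%classic x <= hump (pi / L) x ^+ k * normal_pdf 0 1 x.
rewrite indicE.
have [/set_mem/=|_] := boolP (_ \in _); last first.
  by rewrite mulr0 mulr_ge0 ?normal_pdf_ge0//; have /andP[] := hump_exp_01 (pi / L) x k.
rewrite in_itv/= mulr1 => /andP[x1 x2].
rewrite /c -mulrA; apply: ler_pM.
- by [].
- by rewrite mulr_ge0 ?normal_peak_ge0 ?expR_ge0.
- pose a := (pi / L * (L - x)) ^+ 2 / 4.
  have pL : 0 <= pi / L :> R by rewrite divr_ge0// ?pi_ge0 ?(ltW L0).
  have a0 : 0 <= a by rewrite divr_ge0 ?sqr_ge0.
  have ad : a <= (pi / L * de) ^+ 2 / 4.
    have xL : 0 <= L - x by rewrite subr_ge0.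
    rewrite ler_pM2r ?invr_gt0// lerXn2r ?nnegrE ?(mulr_ge0 pL) ?(ltW de0)//.
    by rewrite ler_wpM2l//; lra.
  have ka : k%:R * a <= 1 / 2 by rewrite (le_trans _ kd)// ler_wpM2l.
  have [k0|k0] := posnP k; first by rewrite k0 expr0; lra.
  have a1 : a <= 1.
    have : a <= k%:R * a by rewrite ler_peMl// ler1n.
    lra.
  (* Bernoulli's inequality: (1 - a)^k >= 1 - k a >= 1/2. *)
  apply: (@le_trans _ _ ((1 - a) ^+ k)).
    by have := bernoulli_inequality k a0 a1; lra.
  by rewrite lerXn2r ?nnegrE ?subr_ge0 ?hump_ge0// hump_near.
(* Since [de <= 1 <= L], the window lies in [0, L], where the density is at least its value at L. *)
- rewrite normal_pdfE// ler_wpM2l ?normal_peak_ge0// /normal_fun ler_expR subr0 expr1n.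
  rewrite mulNr lerN2 ler_pM2r ?invr_gt0// lerXn2r ?nnegrE ?(ltW L0)//; lra.
have mI : measurable (`[L - de, L]%classic : set R) by exact: measurable_itv.
have -> : ((de / 2 * normal_peak 1 * expR (- (L ^+ 2 / 2)))%:E =
    \int[mu]_x (c%:E * (\1_`[L - de, L]%classic x)%:E))%E.
  rewrite ge0_integralZl_EFin//; last by apply/measurable_EFinP; exact: measurable_indic.
  rewrite integral_indic//= setIT lebesgue_measure_itv/= lte_fin ltrBlDr ltrDl de0 -EFinD -EFinM.
  by congr EFin; rewrite /c; ring.
apply: ge0_le_integral => //.
- by move=> x _; rewrite -EFinM lee_fin mulr_ge0.
- by apply/measurable_EFinP; apply: measurable_funM => //; exact: measurable_indic.
- apply: emeasurable_funM; apply/measurable_EFinP; first exact: measurable_hump_exp.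
  exact: measurable_normal_pdf.
by move=> x _; rewrite -EFinM lee_fin; exact: pw.
Qed.

(** The second moment bound is applied to f(X_i) for f a power of the hump peaking at L = sqrt(2 r
    ln M). Below r L one has f <= 1/M, whereas p = E f(X_i) >= c0 M^(-r). The diagonal part is then
    of order 1 / (M p) <= M^(-(1-r)) / c0, and the correlations contribute only O(M^(-2(1-r))). *)
Lemma gaussian_maximum_small d (T : measurableType d) (P : probability T R) (r : R) :
  0 < r -> r < 1 -> exists2 C, 0 < C &
  forall (M : nat) (X : 'I_M -> T -> R), (0 < M)%N ->
    (forall i, centered_gaussian P (X i) 1) ->
    (forall i j, i != j -> exists2 rho, gaussian_pair P (X i) (X j) rho &
       `|rho| <= expR (- 3 * ln M%:R)) ->
    forall A, measurable A ->
    (forall w, A w -> forall i, `|X i w| <= r * Num.sqrt (2 * r * ln M%:R)) ->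
    (P A <= (C * expR (- (1 - r) * ln M%:R))%:E)%E.
Proof.
move=> r0 r1; have /andP[th0 th1] := hump_pi_lt1 r0 r1.
(* [th] is the value of the hump at r L, hence its maximum over |x| <= r L, whatever L is. *)
set th := hump pi r in th0 th1; pose la := - ln th.
have la0 : 0 < la by rewrite oppr_gt0 ln_lt0// th0.
(* The exponent l / la + 1 is at most [K1 * l] as soon as l >= 1. *)
pose K1 := la^-1 + 1; have K10 : 0 < K1 by rewrite addr_gt0// invr_gt0.
have p0 := pi_gt0 R.
(* A width with K1 pi^2 de^2 <= 4 r, which is what makes k (pi de / L)^2 / 4 <= 1/2 independently of
   M. *)
pose de := 4 * r / (4 * r + K1 * pi ^+ 2).
have D0 : 0 < 4 * r + K1 * pi ^+ 2 by rewrite addr_gt0 ?mulr_gt0 ?exprn_gt0.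
have de0 : 0 < de by rewrite divr_gt0 ?mulr_gt0.
have de1 : de <= 1 by rewrite ler_pdivrMr// mul1r lerDl mulr_ge0 ?(ltW K10) ?sqr_ge0.
have Kde : K1 * pi ^+ 2 * de ^+ 2 <= 4 * r.
  apply: (@le_trans _ _ (K1 * pi ^+ 2 * de)).
    rewrite ler_wpM2l//; first by rewrite mulr_ge0 ?(ltW K10) ?sqr_ge0.
    by rewrite expr2 ler_piMr// ltW.
  rewrite /de mulrCA ler_piMr//; first by rewrite mulr_ge0// ltW.
  by rewrite ler_pdivrMr// mul1r lerDr mulr_ge0// ltW.
clearbody de.
pose c0 := de / 2 * normal_peak 1 : R.
have c00 : 0 < c0.
  by apply: mulr_gt0; [exact: divr_gt0|apply: normal_peak_gt0; exact: oner_neq0].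
pose K2 := K1 ^+ 2 * pi ^+ 2 / (2 * r).
have K20 : 0 < K2 by rewrite divr_gt0 ?mulr_gt0 ?exprn_gt0.
(* From [l0 <= l] follow l >= 1 and L^2 = 2 r l >= 1. *)
pose l0 := 1 + (2 * r)^-1.
(* The first two terms make the bound exceed 1 when l < l0 or q > c0 / 2; the last two come from the
   second moment bound. *)
pose C := expR l0 + 2 / c0 + (4 / c0 + 4 * K2 / c0 ^+ 2).
have e1 : 0 < 2 / c0 by rewrite divr_gt0.
have e2 : 0 < 4 / c0 by rewrite divr_gt0.
have e3 : 0 < 4 * K2 / c0 ^+ 2 by rewrite divr_gt0 ?exprn_gt0// mulr_gt0.
have e4 := expR_gt0 l0.
exists C; first by rewrite /C; lra.
move=> M X M0 X1 XX A mA AX; set l := ln M%:R in XX AX *.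
have Mp : 0 < M%:R :> R by rewrite ltr0n.
have lM : expR l = M%:R by rewrite lnK// posrE.
have l_ge0 : 0 <= l by rewrite ln_ge0// ler1n.
set q := expR (- (1 - r) * l).
have q0 : 0 < q by exact: expR_gt0.
have triv : 1 <= C * q -> (P A <= (C * q)%:E)%E.
  by move=> h; apply: (le_trans (probability_le1 P mA)); rewrite lee_fin.
have [ll0|ll0] := ltP l l0.
  apply: triv; apply: (@le_trans _ _ (expR l0 * q)); last first.
    by rewrite ler_wpM2r ?(ltW q0)// /C; lra.
  rewrite -expRD -[leLHS]expR0 ler_expR.
  have : 0 <= r * l by rewrite mulr_ge0 ?(ltW r0).
  lra.
have [qs|qs] := ltP (q^-1) (2 / c0).
  apply: triv; apply: (@le_trans _ _ (2 / c0 * q)); last first.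
    by rewrite ler_wpM2r ?(ltW q0)// /C; lra.
  by rewrite -ler_pdivrMr// div1r ltW.
have l1 : 1 <= l.
  by apply: le_trans ll0; rewrite /l0 lerDl invr_ge0 mulr_ge0 ?(ltW r0).
have l0' : 0 < l by exact: lt_le_trans l1.
pose L := Num.sqrt (2 * r * l).
have L2 : L ^+ 2 = 2 * r * l by rewrite sqr_sqrtr// !mulr_ge0 ?(ltW r0).
have L1 : 1 <= L.
  rewrite -[leLHS]sqrtr1 ler_sqrt ?mulr_ge0 ?(ltW r0)//.
  apply: (@le_trans _ _ (2 * r * l0)); last by rewrite ler_wpM2l// mulr_ge0 ?(ltW r0).
  rewrite /l0 mulrDr mulfV; last by rewrite gt_eqF ?mulr_gt0.
  by rewrite lerDr mulr1 mulr_ge0 ?(ltW r0).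
have L0 : 0 < L by exact: lt_le_trans L1.
(* An exponent for which th^k <= exp(-l) = 1/M. *)
pose k := (Num.truncn (l / la)).+1.
have k1 : l / la <= k%:R by apply: ltW; exact: truncnS_gt.
have k2 : k%:R <= K1 * l.
  rewrite /k -natr1 /K1 mulrDl mul1r lerD//.
  rewrite [la^-1 * l]mulrC truncn_le.
  by rewrite divr_ge0 ?(ltW la0).
pose f (x : R) := hump (pi / L) x ^+ k.
pose p := \int[centered_normal 1]_x f x.
have kL : k%:R * ((pi / L * de) ^+ 2 / 4) <= 1 / 2.
  apply: (@le_trans _ _ (K1 * l * ((pi / L * de) ^+ 2 / 4))).
    by rewrite ler_wpM2r// divr_ge0 ?sqr_ge0.
  rewrite !exprMn exprVn L2.
  have -> : K1 * l * (pi ^+ 2 / (2 * r * l) * de ^+ 2 / 4) = K1 * pi ^+ 2 * de ^+ 2 / (8 * r).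
    by field; rewrite !gt_eqF.
  by rewrite ler_pdivrMr ?mulr_gt0//; lra.
have pge : c0 * expR (- r * l) <= p.
  have := hump_exp_mean_ge L1 de0 de1 kL; rewrite L2.
  by have -> : - (2 * r * l / 2) = - r * l by field.
clearbody c0.
have pp : 0 < p by apply: lt_le_trans pge; rewrite mulr_gt0// expR_gt0.
have wL : 0 <= pi / L by rewrite divr_ge0 ?(ltW p0) ?(ltW L0).
have tf := trigpoly_hump_exp k wL.
have Ef i : \int[P]_w f (X i w) = p.
  have [mX _ XA] := X1 i; rewrite /p -(sqrtr1 R).
  rewrite (@Rintegral_law _ _ _ P (centered_normal (Num.sqrt 1)) (X i) f 1 mX XA)//.
    exact: measurable_hump_exp.
  by move=> x; have /andP[a b] := hump_exp_01 (pi / L) x k; rewrite ger0_norm.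
have bf i : bounded_mfun (fun w => f (X i w)).
  by have [mX _ _] := X1 i; exact: trigpoly_bounded_mfun tf mX.
pose c := K2 * expR (- 2 * l).
have c_ge0 : 0 <= c by rewrite mulr_ge0 ?expR_ge0 ?(ltW K20).
have H := @second_moment_bound _ _ _ P M (fun i w => f (X i w)) A p c (expR (- l))
  bf mA pp c_ge0 M0 (fun i w => hump_exp_01 _ _ _) Ef.
apply: le_trans (H _ _ _) _.
- move=> i j ij; have [rho g rhol] := XX i j ij.
  have kw : 0 <= k%:R * (pi / L) by rewrite mulr_ge0.
  have := trigpoly_decorrelation g kw kw tf tf.
  rewrite -/f !Ef mul1r -expr2 => /ler_normlW h.
  rewrite -lerBlDl (le_trans h)// mul1r /c.
  (* The squared frequency (k pi / L)^2 is at most K2 l <= K2 M, which costs one of the three powers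
     of M in the correlation. *)
  have -> : - 2 * l = - 3 * l + l by ring.
  rewrite expRD [expR _ * expR l]mulrC [K2 * (_ * _)]mulrA; apply: ler_pM => //.
    by apply: mulr_ge0.
  rewrite -expr2 exprMn exprMn exprVn L2.
  apply: (@le_trans _ _ ((K1 * l) ^+ 2 * (pi ^+ 2 / (2 * r * l)))).
    rewrite ler_wpM2r//; first by rewrite divr_ge0 ?sqr_ge0 ?mulr_ge0 ?(ltW r0).
    by rewrite lerXn2r ?nnegrE// mulr_ge0 ?(ltW K10).
  have -> : (K1 * l) ^+ 2 * (pi ^+ 2 / (2 * r * l)) = K2 * l.
    by rewrite /K2; field; rewrite !gt_eqF.
  by rewrite ler_wpM2l ?(ltW K20)//; have := expR_ge1Dx l; lra.
- move=> i w Aw; have := AX w Aw i; rewrite -/L => h.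
  apply: (@le_trans _ _ (th ^+ k)).
    by rewrite lerXn2r ?nnegrE ?hump_ge0// hump_far.
  rewrite -[th]lnK ?posrE// -expRM_natl ler_expR.
  have : l <= k%:R * la by rewrite -ler_pdivrMr.
  by rewrite /la; lra.
- rewrite ler_pdivlMr//; apply: le_trans pge.
  (* With q = M^(-(1-r)) this says 1/M <= c0 M^(-r) / 2 <= p / 2; the opposite case was settled by
     [triv]. *)
  have h : 2 * q <= c0.
    by rewrite -ler_pdivlMr// [c0 / q]mulrC -ler_pdivrMr.
  have -> : - r * l = - l - (- (1 - r) * l) by ring.
  rewrite expRD [expR (- (- (1 - r) * l))]expRN -/q [c0 * _]mulrCA ler_wpM2l ?expR_ge0//.
  by rewrite ler_pdivlMr.
rewrite lee_fin /C.
have h1 : 4 / (M%:R * p) <= 4 / c0 * q.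
  have b : c0 / q <= M%:R * p.
    have -> : c0 / q = M%:R * (c0 * expR (- r * l)).
      by rewrite -lM mulrCA -expRD /q -expRN; congr (_ * expR _); ring.
    by rewrite ler_wpM2l// ltW.
  have -> : 4 / c0 * q = 4 / (c0 / q) by field; rewrite !gt_eqF.
  have cq : 0 < c0 / q by rewrite divr_gt0.
  by rewrite ler_wpM2l// lef_pV2 ?posrE// (lt_le_trans cq).
have h2 : 4 * c / p ^+ 2 <= 4 * K2 / c0 ^+ 2 * q.
  apply: (@le_trans _ _ (4 * c / (c0 * expR (- r * l)) ^+ 2)).
    have c4 : 0 <= 4 * c by apply: mulr_ge0.
    have u0 : 0 < c0 * expR (- r * l) by apply: mulr_gt0 => //; exact: expR_gt0.
    rewrite (ler_wpM2l c4)// lef_pV2 ?posrE; [|exact: exprn_gt0|exact: exprn_gt0].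
    by rewrite lerXn2r// nnegrE ltW.
  have -> : 4 * c / (c0 * expR (- r * l)) ^+ 2 = 4 * K2 / c0 ^+ 2 * (q * q).
    have -> : q * q = expR (- 2 * l) / expR (- r * l) ^+ 2.
      by rewrite -expRM_natl -expRN -!expRD; congr expR; ring.
    by rewrite /c; field; rewrite !gt_eqF ?expR_gt0.
  rewrite ler_wpM2l ?(ltW e3)// ler_piMr ?(ltW q0)//.
  rewrite -expR0 ler_expR mulNr oppr_le0 mulr_ge0// subr_ge0 ltW//.
have : 0 <= (expR l0 + 2 / c0) * q by rewrite mulr_ge0 ?(ltW q0)//; lra.
lra.
Qed.

End gaussian_maxima.

(** * Energy of the noise *)

Section power_integrals.
Context {R : realType}.
Local Notation mu := (@lebesgue_measure R).
Implicit Types a b p x y : R.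

Lemma integral_indicM (D : set R) (f : R -> R) :
  (\int[mu]_(x in D) (f x)%:E = \int[mu]_x (f x * \1_D x)%:E)%E.
Proof.
rewrite integral_mkcond; apply: eq_integral => x _; rewrite patchE indicE.
by case: ifPn => _; rewrite ?mulr1 ?mulr0.
Qed.

(** The margin removed at each end of an interval of length [l]; the offset 3 keeps the trimmed
    interval nondegenerate already for n = 0. *)
Definition shrink (l : R) (n : nat) : R := l / (n + 3)%:R.

Lemma shrink_gt0 l n : 0 < l -> 0 < shrink l n.
Proof. by move=> l0; rewrite divr_gt0// ltr0n addn3. Qed.

Lemma shrink_le l n : 0 < l -> shrink l n <= l / 3.
Proof.
move=> l0; rewrite /shrink ler_pM2l// lef_pV2 ?posrE ?ltr0n ?addn3//.
by rewrite ler_nat.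
Qed.

Lemma shrink_nonincreasing l n m : 0 < l -> (n <= m)%N -> shrink l m <= shrink l n.
Proof.
move=> l0 nm; rewrite /shrink ler_pM2l// lef_pV2 ?posrE ?ltr0n ?addn3//.
by rewrite ler_nat !ltnS.
Qed.

Lemma cvg_shrink l : shrink l n @[n --> \oo] --> (0 : R).
Proof.
have h : (@harmonic R (n + 2)%N @[n --> \oo] --> (0 : R)).
  exact: (cvg_comp _ _ (cvg_addnr 2) (@cvg_harmonic R)).
have : (l * harmonic (n + 2)%N) @[n --> \oo] --> l * 0.
  by apply: cvgM => //; exact: cvg_cst.
rewrite mulr0; apply: cvg_trans; apply: near_eq_cvg.
by apply: nearW => n; rewrite /shrink /harmonic/= addn2 addn3.
Qed.

(* The endpoints may be singular for f and for the derivative of F. *)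
Lemma ge0_FTC_open (f F : R -> R) a b (la lb : R) : a < b ->
  {in `]a, b[, continuous f} ->
  (forall x, a < x -> x < b -> is_derive x 1 F (f x)) ->
  (forall x, 0 <= f x) ->
  F (a + shrink (b - a) n) @[n --> \oo] --> la ->
  F (b - shrink (b - a) n) @[n --> \oo] --> lb ->
  (\int[mu]_(x in `]a, b[) (f x)%:E = (lb - la)%:E)%E.
Proof.
move=> ab cf dF f0 cla clb; have l0 : 0 < b - a by rewrite subr_gt0.
pose I n : set R := `[a + shrink (b - a) n, b - shrink (b - a) n]%classic.
have IS n : I n `<=` `]a, b[%classic.
  move=> x; rewrite /I/= !in_itv/= => /andP[x1 x2]; have s0 := shrink_gt0 n l0.
  by apply/andP; split; lra.
have ablt n : a + shrink (b - a) n < b - shrink (b - a) n.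
  by have := shrink_le n l0; lra.
have IE n : (\int[mu]_(x in I n) (f x)%:E =
    (F (b - shrink (b - a) n) - F (a + shrink (b - a) n))%:E)%E.
  rewrite EFinB; apply: continuous_FTC2 => //.
  - apply: continuous_in_subspaceT => x xI; apply: cf.
    by have := IS n x; rewrite inE in xI; move=> /(_ xI).
  - have dF' x : I n x -> derivable F x 1.
      by move=> /IS/=; rewrite in_itv/= => /andP[x1 x2]; case: (dF x x1 x2).
    have cF x : I n x -> {for x, continuous F}.
      by move=> /dF'/derivable1_diffP; exact: differentiable_continuous.
    split.
    + move=> x xI; apply: dF'; rewrite /I/=; exact: subset_itv_oo_cc xI.
    + apply: cvg_at_right_filter; apply: cF; rewrite /I/= in_itv/= lexx ltW//.
    + apply: cvg_at_left_filter; apply: cF; rewrite /I/= in_itv/= lexx ltW//.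
  - move=> x xI; rewrite derive1E.
    have /IS/= : I n x by rewrite /I/=; exact: subset_itv_oo_cc xI.
    by rewrite in_itv/= => /andP[x1 x2]; case: (dF x x1 x2).
have bI : \bigcup_n I n = `]a, b[%classic.
  rewrite eqEsubset; split=> [x [n _]/IS//|x /=]; rewrite in_itv/= => /andP[x1 x2].
  have e0 : 0 < Num.min (x - a) (b - x) by rewrite lt_min !subr_gt0 x1.
  have /cvgr0_norm_lt/(_ _ e0)[N _ HN] := cvg_shrink (b - a).
  exists N => //; rewrite /I/= in_itv/=.
  have := HN N (leqnn N); rewrite /= ger0_norm ?(ltW (shrink_gt0 _ _))// lt_min => /andP[h1 h2].
  by apply/andP; split; lra.
have mf : measurable_fun (`]a, b[%classic : set R) f.
  apply: open_continuous_measurable_fun; first exact: interval_open.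
  by move=> x; rewrite inE => xI; exact: cf.
have cI : (\int[mu]_(x in I n) (f x)%:E @[n --> \oo] --> \int[mu]_(x in `]a, b[) (f x)%:E)%E.
  rewrite -bI; apply: ge0_nondecreasing_set_cvg_integral.
  - move=> n m nm; apply/subsetPset => x; rewrite /I/= !in_itv/= => /andP[x1 x2].
    by have := shrink_nonincreasing l0 nm; move=> h; apply/andP; split; lra.
  - by move=> n; exact: measurable_itv.
  - by move=> n; apply/measurable_EFinP; exact: (measurable_funS _ (IS n) mf).
  - by move=> n x _; rewrite lee_fin.
have cF : ((F (b - shrink (b - a) n) - F (a + shrink (b - a) n))%:E @[n --> \oo] --> (lb - la)%:E)%E.
  by apply: cvg_EFin; [exact: nearW|apply: cvgB].
have E : (fun n => \int[mu]_(x in I n) (f x)%:E)%E =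
    (fun n => (F (b - shrink (b - a) n) - F (a + shrink (b - a) n))%:E).
  by apply/funext => n; exact: IE.
rewrite E in cI.
by rewrite -(cvg_lim (@ereal_hausdorff R) cI) (cvg_lim (@ereal_hausdorff R) cF).
Qed.

Lemma continuous_powR_pos p x : 0 < x -> {for x, continuous (fun y => y `^ p)}.
Proof.
move=> x0; apply: differentiable_continuous; apply/derivable1_diffP.
by apply: derivable_powR; rewrite in_itv/= x0.
Qed.

Lemma cvg_shrink_powR l p : 0 < l -> 0 < p -> shrink l n `^ p @[n --> \oo] --> (0 : R).
Proof.
move=> l0 p0; have := powR_cvg0 p0 => /cvg_at_rightP; apply; split; last exact: cvg_shrink.
by move=> n; exact: shrink_gt0.
Qed.

Lemma cvg_subr_shrink_powR l p : 0 < l -> (l - shrink l n) `^ p @[n --> \oo] --> l `^ p.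
Proof.
move=> l0; apply: (@cvg_comp _ _ _ (fun n => l - shrink l n) (fun y => y `^ p) _ (nbhs l)).
  have : l - shrink l n @[n --> \oo] --> l - 0.
    by apply: cvgB; [exact: cvg_cst|exact: cvg_shrink].
  by rewrite subr0.
exact: continuous_powR_pos.
Qed.

Lemma integral_powR_left a b p : a < b -> 0 < p ->
  (\int[mu]_(x in `]a, b[) ((x - a) `^ (p - 1))%:E = ((b - a) `^ p / p)%:E)%E.
Proof.
move=> ab p0; have l0 : 0 < b - a by rewrite subr_gt0.
rewrite -[X in X%:E]subr0.
apply: (@ge0_FTC_open _ (fun x => (x - a) `^ p / p)) => //.
- move=> x; rewrite in_itv/= => /andP[ax _].
  apply: (@continuous_comp _ _ _ (fun x => x - a) (fun y => y `^ (p - 1))).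
    by apply: cvgB; [exact: cvg_id|exact: cvg_cst].
  by apply: continuous_powR_pos; rewrite subr_gt0.
- move=> x ax _; have xa : 0 < x - a by rewrite subr_gt0.
  have h := is_derive1_powR p xa.
  have dd : is_derive x 1 (fun x => x - a : R^o) 1.
    by rewrite -[X in is_derive _ _ _ X]subr0; apply: is_deriveB.
  have H := @is_derive1_comp R (fun y => y `^ p) (fun x => x - a) x _ _ h dd.
  have -> : (fun x0 => (x0 - a) `^ p / p) = p^-1 \*: ((fun y => y `^ p) \o (fun x => x - a)).
    by apply/funext => z /=; rewrite mulrC.
  apply: (is_derive_eq (is_deriveZ p^-1 H)).
  by rewrite mulr1 -[_ *: _]/(_ * _) mulrA mulVf ?gt_eqF// mul1r.
- by move=> x; exact: powR_ge0.
- under eq_fun do rewrite addrAC subrr add0r.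
  have : shrink (b - a) n `^ p / p @[n --> \oo] --> 0 / p.
    by apply: cvgM; [exact: cvg_shrink_powR|exact: cvg_cst].
  by rewrite mul0r.
- under eq_fun do rewrite addrAC.
  by apply: cvgM; [exact: cvg_subr_shrink_powR|exact: cvg_cst].
Qed.

Lemma integral_powR_right a b p : a < b -> 0 < p ->
  (\int[mu]_(x in `]a, b[) ((b - x) `^ (p - 1))%:E = ((b - a) `^ p / p)%:E)%E.
Proof.
move=> ab p0; have l0 : 0 < b - a by rewrite subr_gt0.
have -> : (b - a) `^ p / p = 0 - - ((b - a) `^ p / p) by rewrite sub0r opprK.
apply: (@ge0_FTC_open _ (fun x => - ((b - x) `^ p / p))) => //.
- move=> x; rewrite in_itv/= => /andP[_ xb].
  apply: (@continuous_comp _ _ _ (fun x => b - x) (fun y => y `^ (p - 1))).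
    by apply: cvgB; [exact: cvg_cst|exact: cvg_id].
  by apply: continuous_powR_pos; rewrite subr_gt0.
- move=> x _ xb; have xa : 0 < b - x by rewrite subr_gt0.
  have h := is_derive1_powR p xa.
  have dd : is_derive x 1 (fun x => b - x : R^o) (- 1).
    by rewrite -[X in is_derive _ _ _ X]sub0r; apply: is_deriveB.
  have H := @is_derive1_comp R (fun y => y `^ p) (fun x => b - x) x _ _ h dd.
  have -> : (fun x0 => - ((b - x0) `^ p / p)) = (- p^-1) \*: ((fun y => y `^ p) \o (fun x => b - x)).
    by apply/funext => z /=; rewrite -[RHS]/(_ * _) mulNr mulrC.
  apply: (is_derive_eq (is_deriveZ (- p^-1) H)).
  by rewrite mulrN1 -[_ *: _]/(_ * _) mulrNN mulrA mulVf ?gt_eqF// mul1r.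
- by move=> x; exact: powR_ge0.
- apply: cvgN; under eq_fun do rewrite opprD addrA.
  by apply: cvgM; [exact: cvg_subr_shrink_powR|exact: cvg_cst].
- under eq_fun do rewrite opprB addrC subrK.
  have : - (shrink (b - a) n `^ p / p) @[n --> \oo] --> - (0 / p).
    by apply: cvgN; apply: cvgM; [exact: cvg_shrink_powR|exact: cvg_cst].
  by rewrite mul0r oppr0.
Qed.

End power_integrals.

(** * The covariance functional on nonnegative functions *)

Section noise_covariance.
Context {R : realType} (beta : R).
Hypotheses (beta_gt0 : 0 < beta) (beta_lt1 : beta < 1).
Local Notation mu := (@lebesgue_measure R).
Implicit Types f g : R * R -> R.

Definition nonneg_mfun f := measurable_fun [set: R * R] f /\ forall q, 0 <= f q.

Lemma measurable_riesz : measurable_fun [set: R * R] (fun q => `|q.1 - q.2| `^ (- beta)).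
Proof.
apply: (measurableT_comp (f := fun y => y `^ (- beta))); first exact: measurable_powR.
by apply: measurableT_comp => //; exact: measurable_funB.
Qed.

(** The nesting ((s, y), y') matches the order of integration in [noise_cov], so each integral is a
    section of a product to which Tonelli's theorem applies. *)
Definition cov_density f g (q : (R * R) * R) : \bar R :=
  (f (q.1.1, q.1.2) * `|q.1.2 - q.2| `^ (- beta) * g (q.1.1, q.2))%:E.

Lemma cov_density_ge0 f g q : nonneg_mfun f -> nonneg_mfun g -> (0 <= cov_density f g q)%E.
Proof. by move=> [_ f0] [_ g0]; rewrite lee_fin !mulr_ge0// powR_ge0. Qed.

Lemma measurable_cov_density f g : nonneg_mfun f -> nonneg_mfun g ->
  measurable_fun [set: (R * R) * R] (cov_density f g).
Proof.
move=> [mf f0] [mg g0]; apply/measurable_EFinP.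
have m1 : measurable_fun [set: (R * R) * R] (fun q : (R * R) * R => q.1.1).
  by apply: (measurableT_comp (f := fst)).
have m2 : measurable_fun [set: (R * R) * R] (fun q : (R * R) * R => q.1.2).
  by apply: (measurableT_comp (f := snd)).
have m3 : measurable_fun [set: (R * R) * R] (fun q : (R * R) * R => q.2) by exact: measurable_snd.
apply: measurable_funM; first apply: measurable_funM.
- exact: (measurableT_comp mf (measurable_fun_pair m1 m2)).
- exact: (measurableT_comp measurable_riesz (measurable_fun_pair m2 m3)).
- exact: (measurableT_comp mg (measurable_fun_pair m1 m3)).
Qed.

Lemma measurable_cov_inner f g : nonneg_mfun f -> nonneg_mfun g ->
  measurable_fun [set: R * R] (fun q => \int[mu]_y' cov_density f g (q, y'))%E.
Proof.
move=> hf hg; apply: (@measurable_fun_fubini_tonelli_F _ _ _ _ _ mu (cov_density f g)).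
  exact: measurable_cov_density.
by move=> q; exact: cov_density_ge0.
Qed.

Lemma cov_inner_ge0 f g q : nonneg_mfun f -> nonneg_mfun g ->
  (0 <= \int[mu]_y' cov_density f g (q, y'))%E.
Proof. by move=> hf hg; apply: integral_ge0 => y' _; exact: cov_density_ge0. Qed.

Lemma measurable_cov_slice f g : nonneg_mfun f -> nonneg_mfun g ->
  measurable_fun [set: R] (fun s => \int[mu]_y \int[mu]_y' cov_density f g ((s, y), y'))%E.
Proof.
move=> hf hg; apply: (@measurable_fun_fubini_tonelli_F _ _ _ _ _ mu
  (fun q => \int[mu]_y' cov_density f g (q, y'))%E).
  exact: measurable_cov_inner.
by move=> q; exact: cov_inner_ge0.
Qed.

Lemma cov_slice_ge0 f g s : nonneg_mfun f -> nonneg_mfun g ->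
  (0 <= \int[mu]_y \int[mu]_y' cov_density f g ((s, y), y'))%E.
Proof. by move=> hf hg; apply: integral_ge0 => y _; exact: cov_inner_ge0. Qed.

Lemma noise_covDl f1 f2 g : nonneg_mfun f1 -> nonneg_mfun f2 -> nonneg_mfun g ->
  noise_cov beta (fun q => f1 q + f2 q) g = (noise_cov beta f1 g + noise_cov beta f2 g)%E.
Proof.
move=> h1 h2 hg; rewrite /noise_cov -ge0_integralD//; first last.
- by apply: measurable_funTS; exact: (measurable_cov_slice h2 hg).
- by move=> s _; exact: (cov_slice_ge0 s h2 hg).
- by apply: measurable_funTS; exact: (measurable_cov_slice h1 hg).
- by move=> s _; exact: (cov_slice_ge0 s h1 hg).
apply: eq_integral => s _.
have ms f : nonneg_mfun f ->
    measurable_fun [set: R] (fun y => \int[mu]_y' cov_density f g ((s, y), y'))%E.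
  by move=> hf; exact: (measurableT_comp (measurable_cov_inner hf hg) (@pair1_measurable _ _ R R s)).
rewrite -ge0_integralD//; first last.
- exact: (ms _ h2).
- by move=> y _; exact: (cov_inner_ge0 (s, y) h2 hg).
- exact: (ms _ h1).
- by move=> y _; exact: (cov_inner_ge0 (s, y) h1 hg).
apply: eq_integral => y _.
have my f : nonneg_mfun f -> measurable_fun [set: R] (fun y' => cov_density f g ((s, y), y')).
  by move=> hf; exact: (measurableT_comp (measurable_cov_density hf hg) (@pair1_measurable _ _ _ R (s, y))).
rewrite -ge0_integralD//; first last.
- exact: (my _ h2).
- by move=> y' _; exact: (cov_density_ge0 ((s, y), y') h2 hg).
- exact: (my _ h1).
- by move=> y' _; exact: (cov_density_ge0 ((s, y), y') h1 hg).
by apply: eq_integral => y' _; rewrite -EFinD !mulrDl.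
Qed.

Lemma noise_covC f g : nonneg_mfun f -> nonneg_mfun g -> noise_cov beta f g = noise_cov beta g f.
Proof.
move=> hf hg; rewrite /noise_cov; apply: eq_integral => s _.
pose G (q : R * R) := cov_density f g ((s, q.1), q.2).
have mG : measurable_fun [set: R * R] G.
  apply: (measurableT_comp (measurable_cov_density hf hg)).
  apply: measurable_fun_pair; last by [].
  by apply: measurable_fun_pair.
have G0 q : (0 <= G q)%E by exact: cov_density_ge0.
rewrite [LHS](@fubini_tonelli _ _ _ _ _ mu mu G mG G0).
apply: eq_integral => y _; apply: eq_integral => y' _.
by rewrite /G /cov_density /=; congr EFin; rewrite distrC; ring.
Qed.

End noise_covariance.

(** * Upper and lower energy bounds *)

Section cone_increments.
Context {R : realType} (beta : R).
Hypotheses (beta_gt0 : 0 < beta) (beta_lt1 : beta < 1).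
Local Notation mu := (@lebesgue_measure R).
Implicit Types (A B : set (R * R)) (f g : R * R -> R).

(* The inner integral over |y - y'| < l is computed exactly, elsewhere the kernel is at most l^-beta. *)
Lemma riesz_potential_le (c l y : R) (g : R -> R) : 0 < l ->
  measurable_fun [set: R] g -> (forall z, 0 <= g z) ->
  (forall z, g z <= \1_`[c, c + l]%classic z) ->
  (\int[mu]_z (`|y - z| `^ (- beta) * g z)%:E <= (3 * l `^ (1 - beta) / (1 - beta))%:E)%E.
Proof.
move=> l0 mg g0 gI; have b1 : 0 < 1 - beta by rewrite subr_gt0.
pose K (z : R) := `|y - z| `^ (- beta).
have mK : measurable_fun [set: R] K.
  apply: (measurableT_comp (f := fun y => y `^ (- beta))); first exact: measurable_powR.
  by apply: measurableT_comp => //; exact: measurable_funB.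
pose F1 (z : R) : R := (y - z) `^ (1 - beta - 1) * \1_`]y - l, y[%classic z.
pose F2 (z : R) : R := (z - y) `^ (1 - beta - 1) * \1_`]y, y + l[%classic z.
pose F3 (z : R) : R := l `^ (- beta) * \1_`[c, c + l]%classic z.
have mF1 : measurable_fun [set: R] F1.
  apply: measurable_funM; last exact: measurable_indic.
  apply: (measurableT_comp (f := fun y => y `^ (1 - beta - 1))); first exact: measurable_powR.
  exact: measurable_funB.
have mF2 : measurable_fun [set: R] F2.
  apply: measurable_funM; last exact: measurable_indic.
  apply: (measurableT_comp (f := fun y => y `^ (1 - beta - 1))); first exact: measurable_powR.
  exact: measurable_funB.
have mF3 : measurable_fun [set: R] F3.
  by apply: measurable_funM => //; exact: measurable_indic.
have F10 z : 0 <= F1 z by rewrite mulr_ge0 ?powR_ge0.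
have F20 z : 0 <= F2 z by rewrite mulr_ge0 ?powR_ge0.
have F30 z : 0 <= F3 z by rewrite mulr_ge0 ?powR_ge0.
have pw z : K z * g z <= F1 z + (F2 z + F3 z).
  have g1 : g z <= 1 by rewrite (le_trans (gI z))// indicE; case: (_ \in _).
  have [->|yz] := eqVneq z y.
    rewrite /K subrr normr0 powR0 ?mul0r; last by rewrite oppr_eq0 gt_eqF.
    by rewrite !addr_ge0.
  have [yzl|lyz] := ltP `|y - z| l.
    have Kp : 0 <= K z by exact: powR_ge0.
    apply: (@le_trans _ _ (K z)); first by rewrite ler_piMr.
    have bE : 1 - beta - 1 = - beta by ring.
    have [zy|zy|zy] := ltgtP z y.
    - have -> : F1 z = K z.
        rewrite /F1 /K indicE mem_set ?mulr1 ?bE ?ger0_norm ?subr_ge0 ?(ltW zy)//=.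
        rewrite in_itv/= zy andbT; rewrite ger0_norm ?subr_ge0 ?(ltW zy)// in yzl; lra.
      by rewrite lerDl addr_ge0.
    - have -> : F2 z = K z.
        rewrite /F2 /K indicE mem_set ?mulr1 ?bE; last first.
          by rewrite /= in_itv/= zy; rewrite distrC ger0_norm ?subr_ge0 ?(ltW zy)// in yzl; lra.
        by rewrite distrC ger0_norm ?subr_ge0 ?(ltW zy).
      by rewrite addrCA lerDl addr_ge0.
    - by rewrite zy eqxx in yz.
  apply: (@le_trans _ _ (F3 z)); last by rewrite addrA lerDr addr_ge0.
  apply: ler_pM => //; first exact: powR_ge0.
  rewrite /K !powRN lef_pV2 ?posrE ?powR_gt0//; last exact: lt_le_trans lyz.
  by rewrite ge0_ler_powR ?nnegrE ?(ltW beta_gt0) ?(ltW l0).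
apply: (@le_trans _ _ (\int[mu]_z ((F1 z)%:E + ((F2 z)%:E + (F3 z)%:E)))%E).
  apply: ge0_le_integral => //.
  - by move=> z _; rewrite lee_fin mulr_ge0// powR_ge0.
  - by apply/measurable_EFinP; exact: measurable_funM.
  - by apply/measurable_EFinP; apply: measurable_funD => //; exact: measurable_funD.
  - by move=> z _; rewrite lee_fin; exact: pw.
rewrite ge0_integralD//; last 4 first.
- by move=> z _; rewrite lee_fin.
- exact/measurable_EFinP.
- by move=> z _; rewrite -EFinD lee_fin addr_ge0.
- by apply/measurable_EFinP; exact: measurable_funD.
rewrite ge0_integralD//; last 4 first.
- by move=> z _; rewrite lee_fin.
- exact/measurable_EFinP.
- by move=> z _; rewrite lee_fin.
- exact/measurable_EFinP.
have -> : (\int[mu]_z (F1 z)%:E = (l `^ (1 - beta) / (1 - beta))%:E)%E.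
  rewrite -(integral_indicM _ (fun z => (y - z) `^ (1 - beta - 1))) integral_powR_right//.
    by rewrite opprB addrC subrK.
  by rewrite ltrBlDr ltrDl.
have -> : (\int[mu]_z (F2 z)%:E = (l `^ (1 - beta) / (1 - beta))%:E)%E.
  rewrite -(integral_indicM _ (fun z => (z - y) `^ (1 - beta - 1))) integral_powR_left//.
    by rewrite addrAC subrr add0r.
  by rewrite ltrDl.
have -> : (\int[mu]_z (F3 z)%:E = (l `^ (1 - beta))%:E)%E.
  rewrite /F3; under eq_integral do rewrite EFinM.
  rewrite ge0_integralZl_EFin ?powR_ge0//; last by apply/measurable_EFinP; exact: measurable_indic.
  rewrite integral_indic//= setIT lebesgue_measure_itv/= lte_fin ltrDl l0 -EFinD -EFinM.
  congr EFin; rewrite addrAC subrr add0r mulrC -{1}(powRr1 (ltW l0)) -powRD ?gt_eqF//.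
rewrite -!EFinD lee_fin.
have : l `^ (1 - beta) <= l `^ (1 - beta) / (1 - beta).
  by rewrite ler_pdivlMr// ler_piMr ?powR_ge0// gerBl ltW.
lra.
Qed.

Lemma indic_nonneg_mfun A : measurable A -> nonneg_mfun (\1_A : R * R -> R).
Proof. by move=> mA; split; [exact: measurable_indic|move=> q; rewrite indicE]. Qed.

(** The potential of each time slice of B is at most 3 l2^(1 - beta) / (1 - beta) everywhere, and A
    has area at most k l1. The slices may move with s, through [ca] and [cb], because the regions of
    interest are bounded by characteristic lines. *)
Lemma noise_cov_le A B (k0 k l1 l2 : R) (ca cb : R -> R) : measurable A -> measurable B ->
  0 <= k0 -> 0 < k -> 0 < l1 -> 0 < l2 ->
  (forall s y, A (s, y) -> k0 <= s <= k0 + k /\ ca s <= y <= ca s + l1) ->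
  (forall s y, B (s, y) -> cb s <= y <= cb s + l2) ->
  (noise_cov beta \1_A \1_B <= (k * l1 * (3 * l2 `^ (1 - beta) / (1 - beta)))%:E)%E.
Proof.
move=> mA mB k00 kp l10 l20 hA hB.
have hfA := indic_nonneg_mfun mA; have hfB := indic_nonneg_mfun mB.
have b1 : 0 < 1 - beta by rewrite subr_gt0.
set Q := 3 * l2 `^ (1 - beta) / (1 - beta).
have Q0 : 0 <= Q by rewrite divr_ge0 ?(ltW b1)// mulr_ge0// powR_ge0.
have inner s y : (\int[mu]_y' cov_density beta \1_A \1_B ((s, y), y') <= (Q * \1_A (s, y))%:E)%E.
  rewrite /cov_density /=; under eq_integral do rewrite -mulrA EFinM.
  rewrite ge0_integralZl_EFin//; last first.
    apply/measurable_EFinP; apply: measurable_funM.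
      apply: (measurableT_comp (f := fun y => y `^ (- beta))); first exact: measurable_powR.
      by apply: measurableT_comp => //; exact: measurable_funB.
    exact: (measurableT_comp hfB.1 (@pair1_measurable _ _ R R s)).
  rewrite mulrC EFinM lee_wpmul2l// ?lee_fin//.
  apply: (@riesz_potential_le (cb s)) => //.
    exact: (measurableT_comp hfB.1 (@pair1_measurable _ _ R R s)).
  move=> z; rewrite !indicE; have [/set_mem/hB zB|//] := boolP ((s, z) \in B).
  by rewrite mem_set.
have slice s : (\int[mu]_y \int[mu]_y' cov_density beta \1_A \1_B ((s, y), y') <=
    (Q * l1 * \1_`[k0, k0 + k]%classic s)%:E)%E.
  apply: (@le_trans _ _ (\int[mu]_y (Q * \1_`[k0, k0 + k]%classic s * \1_`[ca s, ca s + l1]%classic y)%:E)%E).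
    apply: ge0_le_integral => //.
    - by move=> y _; exact: (cov_inner_ge0 beta (s, y) hfA hfB).
    - exact: (measurableT_comp (measurable_cov_inner beta hfA hfB) (@pair1_measurable _ _ R R s)).
    - by apply/measurable_EFinP; apply: measurable_funM => //; exact: measurable_indic.
    - move=> y _; apply: (le_trans (inner s y)); rewrite lee_fin -mulrA ler_wpM2l//.
      rewrite !indicE; have [/set_mem/hA[h1 h2]|//] := boolP ((s, y) \in A); last first.
        by rewrite mulr_ge0.
      by rewrite mem_set//= mem_set//= mulr1.
  under eq_integral do rewrite EFinM.
  have c0 : 0 <= Q * \1_`[k0, k0 + k]%classic s by rewrite mulr_ge0// indicE.
  rewrite ge0_integralZl_EFin//; last by apply/measurable_EFinP; exact: measurable_indic.
  rewrite integral_indic//= setIT lebesgue_measure_itv/= lte_fin ltrDl l10 -EFinD -EFinM lee_fin.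
  by rewrite addrAC subrr add0r mulrAC.
apply: (@le_trans _ _ (\int[mu]_(s in `[0%R, +oo[) (Q * l1 * \1_`[k0, k0 + k]%classic s)%:E)%E).
  apply: ge0_le_integral => //.
  - by move=> s _; exact: (cov_slice_ge0 beta s hfA hfB).
  - by apply: measurable_funTS; exact: (measurable_cov_slice beta hfA hfB).
  - apply: measurable_funTS; apply/measurable_EFinP; apply: measurable_funM => //.
  - by move=> s _; exact: slice.
under eq_integral do rewrite EFinM.
have Ql0 : 0 <= Q * l1 by apply: mulr_ge0 => //; exact: ltW.
rewrite ge0_integralZl_EFin//; last first.
  by apply: measurable_funTS; apply/measurable_EFinP; exact: measurable_indic.
rewrite integral_indic//=.
pose I : set R := `[k0, k0 + k]%classic.
apply: (@le_trans _ _ ((Q * l1)%:E * mu I)%E).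
  rewrite lee_wpmul2l ?lee_fin//.
  apply: le_measure; [rewrite inE; exact: measurableI|rewrite inE; exact: measurable_itv|by move=> x []].
rewrite lebesgue_measure_itv/= lte_fin ltrDl kp -EFinD -EFinM lee_fin.
by rewrite addrAC subrr add0r le_eqVlt; apply/orP; left; apply/eqP; ring.
Qed.

Definition strip (a a' b : R) : set (R * R) :=
  [set q | [/\ 0 <= q.1, a < q.1 + q.2, q.1 + q.2 <= a' & q.1 - q.2 <= b]].

(* The strip contains the parallelogram over [0, (a + b) / 2] whose slices all have length a' - a. *)
Lemma noise_cov_strip_ge (a a' b : R) : a < a' -> 0 < a + b -> measurable (strip a a' b) ->
  (((a + b) / 2 * (2 * (a' - a) `^ (2 - beta) / ((2 - beta) * (1 - beta))))%:E <=
   noise_cov beta \1_(strip a a' b) \1_(strip a a' b))%E.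
Proof.
move=> aa ab mS; set S := strip a a' b in mS *.
have hS := indic_nonneg_mfun mS.
have b1 : 0 < 1 - beta by rewrite subr_gt0.
have b2 : 0 < 2 - beta by rewrite subr_gt0 (lt_trans beta_lt1)// ltr1n.
set l := a' - a; have l0 : 0 < l by rewrite subr_gt0.
(* The energy of an interval of length l for the kernel |y - y'|^(-beta). *)
set J := 2 * l `^ (2 - beta) / ((2 - beta) * (1 - beta)).
have J0 : 0 <= J by rewrite divr_ge0 ?mulr_ge0 ?powR_ge0 ?ltW.
have Sin s y : 0 <= s -> s <= (a + b) / 2 -> a - s < y -> y < a' - s -> S (s, y).
  by move=> h1 h2 h3 h4; split => /=; lra.
have bE : 1 - beta - 1 = - beta by ring.
have bE2 : 2 - beta - 1 = 1 - beta by ring.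
have mK y : measurable_fun [set: R] (fun z : R => `|y - z| `^ (- beta)).
  apply: (measurableT_comp (f := fun y => y `^ (- beta))); first exact: measurable_powR.
  by apply: measurableT_comp => //; exact: measurable_funB.
have mS1 s : measurable_fun [set: R] (fun z : R => \1_S (s, z) : R).
  exact: (measurableT_comp hS.1 (@pair1_measurable _ _ R R s)).
have inner s y : 0 <= s -> s <= (a + b) / 2 -> a - s < y -> y < a' - s ->
  ((((y - (a - s)) `^ (1 - beta) + (a' - s - y) `^ (1 - beta)) / (1 - beta))%:E <=
   \int[mu]_y' cov_density beta \1_S \1_S ((s, y), y'))%E.
  move=> s0 s1 y0 y1; rewrite mulrDl EFinD.
  rewrite -(integral_powR_right y0 b1) -(integral_powR_left y1 b1).
  rewrite (integral_indicM `]a - s, y[%classic (fun z => (y - z) `^ (1 - beta - 1))).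
  rewrite (integral_indicM `]y, a' - s[%classic (fun z => (z - y) `^ (1 - beta - 1))).
  rewrite -ge0_integralD//; last 4 first.
  - by move=> z _; rewrite lee_fin mulr_ge0 ?powR_ge0.
  - apply/measurable_EFinP; apply: measurable_funM; last exact: measurable_indic.
    apply: (measurableT_comp (f := fun y => y `^ (1 - beta - 1))); first exact: measurable_powR.
    exact: measurable_funB.
  - by move=> z _; rewrite lee_fin mulr_ge0 ?powR_ge0.
  - apply/measurable_EFinP; apply: measurable_funM; last exact: measurable_indic.
    apply: (measurableT_comp (f := fun y => y `^ (1 - beta - 1))); first exact: measurable_powR.
    exact: measurable_funB.
  apply: ge0_le_integral => //.
  - by move=> z _; rewrite -EFinD lee_fin addr_ge0// mulr_ge0 ?powR_ge0.
  - apply/measurable_EFinP; apply: measurable_funD.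
      apply: measurable_funM; last exact: measurable_indic.
      apply: (measurableT_comp (f := fun y => y `^ (1 - beta - 1))); first exact: measurable_powR.
      exact: measurable_funB.
    apply: measurable_funM; last exact: measurable_indic.
    apply: (measurableT_comp (f := fun y => y `^ (1 - beta - 1))); first exact: measurable_powR.
    exact: measurable_funB.
  - exact: (measurableT_comp (measurable_cov_density beta hS hS) (@pair1_measurable _ _ _ R (s, y))).
  move=> z _; rewrite -EFinD lee_fin /= bE.
  rewrite [\1_S (s, y)]indicE mem_set ?mul1r; last exact: Sin.
  have K0 u : 0 <= u `^ (- beta) :> R by exact: powR_ge0.
  rewrite !indicE !mem_setE !in_itv/=.
  have [yz|zy|->] := ltgtP z y.
  - rewrite andbT /= mulr0 addr0 (ger0_norm (_ : 0 <= y - z)) ?subr_ge0 ?(ltW yz)//.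
    rewrite ler_wpM2l//; case: (ltP (a - s) z) => // az.
    by rewrite mem_set//; apply: Sin => //; exact: lt_trans y1.
  - rewrite andbF /= mulr0 add0r distrC (ger0_norm (_ : 0 <= z - y)) ?subr_ge0 ?(ltW zy)//.
    rewrite ler_wpM2l//; case: (ltP z (a' - s)) => // az.
    by rewrite mem_set//; apply: Sin => //; exact: lt_trans zy.
  - by rewrite andbF /= !mulr0 addr0 mulr_ge0.
have slice s : 0 <= s -> s <= (a + b) / 2 ->
    (J%:E <= \int[mu]_y \int[mu]_y' cov_density beta \1_S \1_S ((s, y), y'))%E.
  move=> s0 s1; have lt_as : a - s < a' - s by rewrite ltrD2r.
  pose G1 (y : R) : R := (y - (a - s)) `^ (2 - beta - 1) * \1_`]a - s, a' - s[%classic y.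
  pose G2 (y : R) : R := (a' - s - y) `^ (2 - beta - 1) * \1_`]a - s, a' - s[%classic y.
  have mG1 : measurable_fun [set: R] G1.
    apply: measurable_funM; last exact: measurable_indic.
    apply: (measurableT_comp (f := fun y => y `^ (2 - beta - 1))); first exact: measurable_powR.
    exact: measurable_funB.
  have mG2 : measurable_fun [set: R] G2.
    apply: measurable_funM; last exact: measurable_indic.
    apply: (measurableT_comp (f := fun y => y `^ (2 - beta - 1))); first exact: measurable_powR.
    exact: measurable_funB.
  have G10 y : 0 <= G1 y by rewrite mulr_ge0 ?powR_ge0.
  have G20 y : 0 <= G2 y by rewrite mulr_ge0 ?powR_ge0.
  have -> : (J%:E = \int[mu]_y ((1 - beta)^-1%:E * ((G1 y)%:E + (G2 y)%:E)))%E.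
    rewrite ge0_integralZl_EFin ?invr_ge0 ?(ltW b1)//; last 2 first.
    - by move=> y _; rewrite -EFinD lee_fin addr_ge0.
    - by apply/measurable_EFinP; exact: measurable_funD.
    rewrite ge0_integralD//; last 4 first.
    - by move=> y _; rewrite lee_fin.
    - exact/measurable_EFinP.
    - by move=> y _; rewrite lee_fin.
    - exact/measurable_EFinP.
    rewrite -(integral_indicM _ (fun y => (y - (a - s)) `^ (2 - beta - 1))).
    rewrite -(integral_indicM _ (fun y => (a' - s - y) `^ (2 - beta - 1))).
    rewrite (integral_powR_right lt_as b2) (integral_powR_left lt_as b2) -EFinD -EFinM.
    have -> : a' - s - (a - s) = l by rewrite /l; ring.
    by congr EFin; rewrite /J; field; rewrite !gt_eqF.
  apply: ge0_le_integral => //.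
  - by move=> y _; rewrite -EFinD -EFinM lee_fin mulr_ge0 ?invr_ge0 ?(ltW b1)//; exact: (addr_ge0 (G10 y) (G20 y)).
  - apply/measurable_EFinP; apply: measurable_funM => //; exact: measurable_funD.
  - exact: (measurableT_comp (measurable_cov_inner beta hS hS) (@pair1_measurable _ _ R R s)).
  move=> y _; rewrite -EFinD -EFinM /G1 /G2 !indicE mem_setE in_itv/=.
  case: (boolP (_ && _)) => [/andP[y0 y1]|_]; last first.
    by rewrite !mulr0 addr0 mulr0; exact: (cov_inner_ge0 beta (s, y) hS hS).
  by apply: le_trans (inner s y s0 s1 y0 y1); rewrite lee_fin !mulr1 bE2 mulrC.
have I0 : 0 <= (a + b) / 2 by rewrite divr_ge0// ltW.
apply: (@le_trans _ _ (\int[mu]_(s in `[0%R, +oo[) (J * \1_`[0, (a + b) / 2]%classic s)%:E)%E).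
  under eq_integral do rewrite EFinM.
  rewrite ge0_integralZl_EFin//; last first.
    by apply: measurable_funTS; apply/measurable_EFinP; exact: measurable_indic.
  rewrite integral_indic//=.
  have -> : `[0, (a + b) / 2]%classic `&` `[0, +oo[%classic = `[0, (a + b) / 2]%classic :> set R.
    by apply/setIidPl => x /=; rewrite !in_itv/= andbT => /andP[].
  rewrite lebesgue_measure_itv/= lte_fin divr_gt0// -EFinD -EFinM subr0.
  by rewrite lee_fin mulrC.
apply: ge0_le_integral => //.
- by move=> s _; rewrite lee_fin mulr_ge0.
- apply: measurable_funTS; apply/measurable_EFinP; apply: measurable_funM => //.
- by apply: measurable_funTS; exact: (measurable_cov_slice beta hS hS).
move=> s _; rewrite indicE mem_setE in_itv/=.
case: (boolP (_ && _)) => [/andP[s0 s1]|_]; first by rewrite mulr1; exact: slice.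
by rewrite mulr0; exact: (cov_slice_ge0 beta s hS hS).
Qed.

End cone_increments.

(** * The L^2 geometry of the noise *)

Section square_integrable.
Context {R : realType} d (T : measurableType d) (P : probability T R).
Implicit Types X Y Z : T -> R.

Definition sq_integrable X := measurable_fun [set: T] X /\
  P.-integrable setT (fun w => (X w ^+ 2)%:E).

Lemma sq_integrable_mul X Y : sq_integrable X -> sq_integrable Y ->
  P.-integrable setT (EFin \o (fun w => X w * Y w)).
Proof.
move=> [mX iX] [mY iY].
have iS : P.-integrable setT (fun w => (X w ^+ 2)%:E + (Y w ^+ 2)%:E)%E by exact: integrableD.
apply: le_integrable iS => //.
  by apply/measurable_EFinP; exact: measurable_funM.
move=> w _; rewrite /= lee_fin normrM (ger0_norm (addr_ge0 (sqr_ge0 _) (sqr_ge0 _))).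
rewrite -(real_normK (num_real (X w))) -(real_normK (num_real (Y w))).
have := sqr_ge0 (`|X w| - `|Y w|); have : 0 <= `|X w| * `|Y w| by rewrite mulr_ge0.
lra.
Qed.

Lemma sq_integrable_int X : sq_integrable X -> P.-integrable setT (EFin \o X).
Proof.
move=> hX; have h1 : sq_integrable (fun=> 1).
  by split => //; exact: finite_measure_integrable_cst.
have := sq_integrable_mul hX h1; apply: eq_integrable => // w _.
by rewrite /= mulr1.
Qed.

Lemma sq_integrableD X Y : sq_integrable X -> sq_integrable Y ->
  sq_integrable (fun w => X w + Y w).
Proof.
move=> hX hY; have iXY := sq_integrable_mul hX hY.
case: hX hY => mX iX [mY iY]; split; first exact: measurable_funD.
have i1 : P.-integrable setT (fun w => (X w ^+ 2)%:E + (Y w ^+ 2)%:E)%E by exact: integrableD.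
have i2 : P.-integrable setT (fun w => (2%:E * (X w * Y w)%:E))%E by exact: integrableZl.
have := integrableD measurableT i1 i2; apply: eq_integrable => // w _ /=.
by rewrite -EFinM -!EFinD; congr EFin; ring.
Qed.

Lemma sq_integrableZ c X : sq_integrable X -> sq_integrable (fun w => c * X w).
Proof.
move=> [mX iX]; split; first exact: measurable_funM.
have := integrableZl measurableT (c ^+ 2) iX; apply: eq_integrable => // w _ /=.
by rewrite -EFinM exprMn.
Qed.

Definition inner_product X Y := \int[P]_w (X w * Y w).

Lemma inner_productC X Y : inner_product X Y = inner_product Y X.
Proof. by apply: eq_Rintegral => w _; rewrite mulrC. Qed.

Lemma inner_productDl X Y Z : sq_integrable X -> sq_integrable Y -> sq_integrable Z ->
  inner_product (fun w => X w + Y w) Z = inner_product X Z + inner_product Y Z.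
Proof.
move=> hX hY hZ; rewrite /inner_product -RintegralD//; last 2 first.
- exact: sq_integrable_mul.
- exact: sq_integrable_mul.
by apply: eq_Rintegral => w _; rewrite mulrDl.
Qed.

Lemma inner_productZl c X Z : sq_integrable X -> sq_integrable Z ->
  inner_product (fun w => c * X w) Z = c * inner_product X Z.
Proof.
move=> hX hZ; rewrite /inner_product -RintegralZl//; last exact: sq_integrable_mul.
by apply: eq_Rintegral => w _; rewrite mulrA.
Qed.

Lemma integral_sqr_lin2 (a b : R) X Y : sq_integrable X -> sq_integrable Y ->
  (\int[P]_w ((a * X w + b * Y w) ^+ 2)%:E =
   (a ^+ 2 * inner_product X X + 2 * a * b * inner_product X Y + b ^+ 2 * inner_product Y Y)%:E)%E.
Proof.
move=> hX hY; have haX := sq_integrableZ a hX; have hbY := sq_integrableZ b hY.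
have hS := sq_integrableD haX hbY.
rewrite -[LHS]fineK; last by apply: integral_fune_fin_num => //; case: hS.
congr EFin; rewrite -[LHS]/(inner_product (fun w => a * X w + b * Y w) (fun w => a * X w + b * Y w)).
rewrite inner_productDl// !inner_productZl// [inner_product X _]inner_productC [inner_product Y (fun _ => _ + _)]inner_productC.
by rewrite !inner_productDl// !inner_productZl// [inner_product Y X]inner_productC; ring.
Qed.

Lemma sqr_integral_eq0 X : measurable_fun [set: T] X ->
  (\int[P]_w (X w ^+ 2)%:E = 0)%E -> {ae P, forall w, X w = 0}.
Proof.
move=> mX X0.
have mX2 : measurable_fun [set: T] (fun w => (X w ^+ 2)%:E).
  by apply/measurable_EFinP; exact: measurable_funX.
have := ae_eq_integral_abs P measurableT mX2 => -[+ _].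
under eq_integral do rewrite gee0_abs ?lee_fin ?sqr_ge0//.
move=> /(_ X0); apply: filterS => w /(_ I) [] /eqP.
by rewrite sqrf_eq0 => /eqP.
Qed.

Lemma centered_gaussian_ae X Y v : centered_gaussian P X v -> measurable_fun [set: T] Y ->
  {ae P, forall w, Y w = X w} -> centered_gaussian P Y v.
Proof.
move=> [mX v0 XA] mY XY; split => // A mA; rewrite -XA//.
have mXA : measurable (X @^-1` A) by rewrite -[X in measurable X]setTI; exact: mX.
have mYA : measurable (Y @^-1` A) by rewrite -[X in measurable X]setTI; exact: mY.
have h : (\int[P]_w (\1_(Y @^-1` A) w)%:E = \int[P]_w (\1_(X @^-1` A) w)%:E :> \bar R)%E.
  apply: ae_eq_integral => //.
  - by apply/measurable_EFinP; exact: measurable_indic.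
  - by apply/measurable_EFinP; exact: measurable_indic.
  apply: filterS XY => w XYw _; congr EFin; rewrite !indicE; congr ((_ : bool)%:R).
  by apply/idP/idP; rewrite !inE/= XYw.
by move: h; rewrite !integral_indic// !setIT.
Qed.

End square_integrable.

Section gaussian_noise.
Context {R : realType} d (T : measurableType d) (P : probability T R).
Context (beta : R) (beta_gt0 : 0 < beta) (beta_lt1 : beta < 1).
Context (W : (R * R -> R) -> {RV P >-> R}) (noiseW : colored_noise beta W).
Implicit Types A B : set (R * R).

Definition noise_ip A B : R := fine (noise_cov beta \1_A \1_B).

Lemma bounded_borel_integrand A : bounded_borel A -> integrand (\1_A : R * R -> R).
Proof. by move=> bA; right; exists A. Qed.

Lemma bounded_borel_measurable A : bounded_borel A -> measurable A.
Proof. by case. Qed.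

(** Bounded sets lie in boxes, so [noise_cov_le] applies with slices that do not move. *)
Lemma noise_cov_fin A B : bounded_borel A -> bounded_borel B ->
  noise_cov beta \1_A \1_B \is a fin_num.
Proof.
move=> [mA [M [_ hM]] A0] [mB [N [_ hN]] B0].
(* [bounded_set] provides a bound by every number strictly above M, hence the margin 1. *)
have hA q : A q -> `|q.1| <= `|M| + 1 /\ `|q.2| <= `|M| + 1.
  move=> Aq; have := hM (`|M| + 1) _ q Aq.
  rewrite (le_lt_trans (ler_norm M)) ?ltrDl// => /(_ isT).
  by rewrite /= prod_normE ge_max => /andP[].
have hB q : B q -> `|q.2| <= `|N| + 1.
  move=> Bq; have := hN (`|N| + 1) _ q Bq.
  rewrite (le_lt_trans (ler_norm N)) ?ltrDl// => /(_ isT).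
  by rewrite /= prod_normE ge_max => /andP[].
have M0 : 0 < `|M| + 1 by rewrite ltr_wpDl.
have N0 : 0 < `|N| + 1 by rewrite ltr_wpDl.
have := @noise_cov_le _ beta beta_gt0 beta_lt1 A B 0 (`|M| + 1) (2 * (`|M| + 1)) (2 * (`|N| + 1))
  (fun=> - (`|M| + 1)) (fun=> - (`|N| + 1)) mA mB (lexx 0) M0 (mulr_gt0 (ltr0Sn R 1) M0) (mulr_gt0 (ltr0Sn R 1) N0).
have c1 s y : A (s, y) -> 0 <= s <= 0 + (`|M| + 1) /\ - (`|M| + 1) <= y <= - (`|M| + 1) + 2 * (`|M| + 1).
  move=> Asy; have [/= h1] := hA _ Asy; have /= s0 := A0 _ Asy.
  rewrite ger0_norm// in h1; rewrite ler_norml => /andP[h2 h3].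
  by split; apply/andP; split; lra.
have c2 s y : B (s, y) -> - (`|N| + 1) <= y <= - (`|N| + 1) + 2 * (`|N| + 1).
  move=> Bsy; have := hB _ Bsy; rewrite ler_norml => /andP[/= h2 h3].
  by apply/andP; split; lra.
move=> /(_ c1 c2) h; rewrite ge0_fin_numE ?(le_lt_trans h) ?ltry//.
apply: integral_ge0 => s _; apply: (cov_slice_ge0 beta s); exact: indic_nonneg_mfun.
Qed.

Lemma noise_mfun f : measurable_fun [set: T] (W f).
Proof. exact: measurable_funPT. Qed.

Lemma noise_sq_integrable A : bounded_borel A -> sq_integrable P (W \1_A).
Proof.
move=> bA; have iA := bounded_borel_integrand bA; split; first exact: noise_mfun.
apply/integrableP; split; first by apply/measurable_EFinP; apply: measurable_funX; exact: noise_mfun.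
under eq_integral do rewrite gee0_abs ?lee_fin ?sqr_ge0//.
case: noiseW => _ _ /(_ _ _ iA iA); rewrite unlock /= => E.
have -> : (\int[P]_w (W \1_A w ^+ 2)%:E = noise_cov beta \1_A \1_A)%E.
  by rewrite -E; apply: eq_integral => w _; rewrite expr2.
by have := noise_cov_fin bA bA; rewrite fin_numElt => /andP[].
Qed.

Lemma noise_inner_product A B : bounded_borel A -> bounded_borel B ->
  inner_product P (W \1_A) (W \1_B) = noise_ip A B.
Proof.
move=> bA bB; case: noiseW => _ _ /(_ _ _ (bounded_borel_integrand bA) (bounded_borel_integrand bB)).
by rewrite unlock /inner_product /Rintegral /noise_ip => <-.
Qed.

Lemma noise_mean A : bounded_borel A -> (\int[P]_w (W \1_A w)%:E = 0)%E.
Proof.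
by move=> bA; case: noiseW => _ /(_ _ (bounded_borel_integrand bA)); rewrite unlock.
Qed.

(** The process hypothesis gives normality with unspecified parameters; the covariance of the noise
    supplies the two moments that determine the law. *)
Lemma noise_lin2_gaussian (a b : R) A B : bounded_borel A -> bounded_borel B ->
  centered_gaussian P (fun w => a * W \1_A w + b * W \1_B w)
    (a ^+ 2 * noise_ip A A + 2 * a * b * noise_ip A B + b ^+ 2 * noise_ip B B).
Proof.
move=> bA bB; have hA := noise_sq_integrable bA; have hB := noise_sq_integrable bB.
have hS := sq_integrableD (sq_integrableZ a hA) (sq_integrableZ b hB).
apply: gaussian_rv_centered.
- case: noiseW => G _ _.
  have := G 2%N (fun i => if i == ord0 then \1_A else \1_B) (fun i => if i == ord0 then a else b).
  have -> : (fun w => \sum_(k < 2) (if k == ord0 then a else b) *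
      W (if k == ord0 then \1_A else \1_B) w) = (fun w => a * W \1_A w + b * W \1_B w).
    by apply/funext => w; rewrite big_ord_recl big_ord1.
  by apply => k; case: ifP => _; exact: bounded_borel_integrand.
- by case: hS.
- exact: sq_integrable_int.
- have iA := sq_integrable_int (sq_integrableZ a hA).
  have iB := sq_integrable_int (sq_integrableZ b hB).
  under eq_integral do rewrite EFinD.
  rewrite integralD//.
  have Z c C : bounded_borel C -> (\int[P]_w (c * W \1_C w)%:E = 0)%E.
    move=> bC; under eq_integral do rewrite EFinM.
    rewrite integralZl//; last exact: sq_integrable_int (noise_sq_integrable bC).
    by rewrite noise_mean// mule0.
  by rewrite !Z// adde0.
by rewrite integral_sqr_lin2// !noise_inner_product.
Qed.

Lemma noise_gaussian (a : R) A : bounded_borel A ->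
  centered_gaussian P (fun w => a * W \1_A w) (a ^+ 2 * noise_ip A A).
Proof.
move=> bA; have := noise_lin2_gaussian a 0 bA bA.
have -> : (fun w => a * W \1_A w + 0 * W \1_A w) = (fun w => a * W \1_A w).
  by apply/funext => w; rewrite mul0r addr0.
by rewrite mulr0 mul0r addr0 expr0n mul0r addr0.
Qed.

Lemma noise_ipDl A1 A2 B : bounded_borel A1 -> bounded_borel A2 -> bounded_borel B ->
  A1 `&` A2 = set0 -> noise_ip (A1 `|` A2) B = noise_ip A1 B + noise_ip A2 B.
Proof.
move=> b1 b2 bB A120.
have E : \1_(A1 `|` A2) = (fun q => \1_A1 q + \1_A2 q) :> (R * R -> R).
  apply/funext => q; rewrite !indicE in_setU.
  have H : ~ (A1 q /\ A2 q) by move=> h; have : (A1 `&` A2) q := h; rewrite A120.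
  have [/set_mem q1|q1] := boolP (q \in A1); have [/set_mem q2|q2] := boolP (q \in A2) => //=.
  - by case: H.
  - by rewrite addr0.
  - by rewrite add0r.
  - by rewrite addr0.
rewrite /noise_ip E noise_covDl; [|exact: indic_nonneg_mfun (bounded_borel_measurable b1)|
  exact: indic_nonneg_mfun (bounded_borel_measurable b2)|
  exact: indic_nonneg_mfun (bounded_borel_measurable bB)].
by rewrite fineD//; exact: noise_cov_fin.
Qed.

Lemma noise_ipC A B : bounded_borel A -> bounded_borel B -> noise_ip A B = noise_ip B A.
Proof.
move=> bA bB; rewrite /noise_ip noise_covC//; apply: indic_nonneg_mfun.
- exact: bounded_borel_measurable bA.
- exact: bounded_borel_measurable bB.
Qed.

Lemma bounded_borelD A B : bounded_borel A -> bounded_borel B -> bounded_borel (A `\` B).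
Proof.
move=> [mA bA A0] [mB _ _]; split; first exact: measurableD.
- by case: bA => M [Mr hM]; exists M; split => // x Mx q [Aq _]; exact: (hM x Mx q Aq).
- by move=> q [/A0].
Qed.

(* The variance of W A' - W A - W (A' \ A) vanishes by bilinearity of noise_cov. *)
Lemma noise_setD A B : bounded_borel A -> bounded_borel B -> A `<=` B ->
  {ae P, forall w, W \1_B w - W \1_A w = W \1_(B `\` A) w}.
Proof.
move=> bA bB AB; have bD := bounded_borelD bB bA.
have BE : B = A `|` (B `\` A) by rewrite setDUK.
have D0 : A `&` (B `\` A) = set0 by rewrite setIDA setDIl setDv setI0 || rewrite setDE setIA setIAC setICr set0I.
have hA := noise_sq_integrable bA; have hB := noise_sq_integrable bB.
have hD := noise_sq_integrable bD.
pose Y w := W \1_A w + 1 * W \1_(B `\` A) w.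
have hD1 := sq_integrableZ 1 hD.
have hY : sq_integrable P Y by exact: sq_integrableD.
pose X w := 1 * W \1_B w + (- 1) * Y w.
have mX : measurable_fun [set: T] X.
  by case: (sq_integrableD (sq_integrableZ 1 hB) (sq_integrableZ (- 1) hY)).
have eY Z : sq_integrable P Z -> inner_product P Y Z =
    inner_product P (W \1_A) Z + inner_product P (W \1_(B `\` A)) Z.
  by move=> hZ; rewrite (inner_productDl hA hD1 hZ) (inner_productZl 1 hD hZ) mul1r.
have eB C : bounded_borel C -> noise_ip B C = noise_ip A C + noise_ip (B `\` A) C.
  by move=> bC; rewrite {1}BE noise_ipDl.
have X0 : (\int[P]_w (X w ^+ 2)%:E = 0)%E.
  rewrite (integral_sqr_lin2 1 (- 1) hB hY); congr EFin.
  rewrite [inner_product P (W \1_B) Y]inner_productC (eY _ hB) (eY _ hY).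
  rewrite [inner_product P (W \1_A) Y]inner_productC (eY _ hA).
  rewrite [inner_product P (W \1_(B `\` A)) Y]inner_productC (eY _ hD).
  rewrite !noise_inner_product// (noise_ipC bA bB) (noise_ipC bD bB).
  rewrite (eB _ bB) (noise_ipC bA bB) (noise_ipC bD bB) (eB _ bA) (eB _ bD).
  move: (noise_ip A A + _ + _) => q; clear; ring.
apply: filterS (sqr_integral_eq0 mX X0) => w; rewrite /X /Y => h.
by apply/eqP; rewrite -subr_eq0 -h; apply/eqP; ring.
Qed.

End gaussian_noise.

(** * Increments of the wave solution *)

Section light_cones.
Context {R : realType}.
Implicit Types a b : R.

Definition cone a b : set (R * R) :=
  [set q | [/\ 0 <= q.1, q.1 + q.2 <= a & q.1 - q.2 <= b]].

Lemma bounded_borel_cone a b : bounded_borel (cone a b).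
Proof.
have mle (f : R * R -> R) c : measurable_fun [set: R * R] f -> measurable [set q | f q <= c].
  by move=> mf; rewrite -[X in measurable X]setTI; apply: measurable_fun_le.
have m1 : measurable_fun [set: R * R] (fun q : R * R => - q.1).
  by apply: measurableT_comp => //; exact: measurable_fst.
have m2 : measurable_fun [set: R * R] (fun q : R * R => q.1 + q.2) by exact: measurable_funD.
have m3 : measurable_fun [set: R * R] (fun q : R * R => q.1 - q.2) by exact: measurable_funB.
split.
- have -> : cone a b = [set q | - q.1 <= 0] `&` ([set q | q.1 + q.2 <= a] `&` [set q | q.1 - q.2 <= b]).
    apply/seteqP; split=> q /=; rewrite oppr_le0; first by case.
    by case=> h1 [h2 h3]; split.
  by apply: measurableI; [exact: mle|apply: measurableI; exact: mle].
- exists (`|a| + `|b|); split; first exact: num_real.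
  move=> x Mx q [/= q1 q2 q3]; rewrite /= (le_trans _ (ltW Mx))// prod_normE ge_max.
  have ha := ler_norm a; have hb := ler_norm b.
  have na := normr_ge0 a; have nb := normr_ge0 b.
  move: (q.1) (q.2) q1 q2 q3 => y z q1 q2 q3.
  by apply/andP; split; rewrite ler_norml; apply/andP; split; lra.
- by move=> q [].
Qed.

Lemma strip_cone a a' b : strip a a' b = cone a' b `\` cone a b.
Proof.
apply/seteqP; split=> q /=.
  by case=> h1 h2 h3 h4; split; [split|case=> _ h _; move: h; rewrite leNgt h2].
case=> -[h1 h2 h3] h4; split=> //; rewrite ltNge; apply/negP => h; apply: h4; split=> //.
Qed.

Lemma sub_cone a a' b b' : a <= a' -> b <= b' -> cone a b `<=` cone a' b'.
Proof. by move=> aa bb q [h1 h2 h3]; split=> //; [exact: le_trans aa|exact: le_trans bb]. Qed.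

Lemma bounded_borel_strip a a' b : bounded_borel (strip a a' b).
Proof. by rewrite strip_cone; apply: bounded_borelD; exact: bounded_borel_cone. Qed.

Lemma sub_strip a a' b b' : b <= b' -> strip a a' b `<=` strip a a' b'.
Proof. by move=> bb q [h1 h2 h3 h4]; split=> //; exact: le_trans bb. Qed.

Lemma sqrt2_mul : Num.sqrt 2 * Num.sqrt 2 = 2 :> R.
Proof. by rewrite -expr2 sqr_sqrtr. Qed.

Lemma sqrt2_gt0 : 0 < Num.sqrt 2 :> R.
Proof. by rewrite sqrtr_gt0. Qed.

(* In the characteristic coordinates s + y and s - y a light cone is a quadrant cut off at s = 0. *)
Lemma light_coneE (tau l : R) :
  light_cone ((tau + l) / Num.sqrt 2) ((- tau + l) / Num.sqrt 2) =
  cone (Num.sqrt 2 * l) (Num.sqrt 2 * tau).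
Proof.
set t := (tau + l) / _; set x := (- tau + l) / _.
have s0 := sqrt2_gt0.
have e1 : t + x = Num.sqrt 2 * l.
  rewrite /t /x -mulrDl; have -> : tau + l + (- tau + l) = 2 * l by ring.
  by rewrite -{1}sqrt2_mul; field; rewrite gt_eqF.
have e2 : t - x = Num.sqrt 2 * tau.
  rewrite /t /x -mulrBl; have -> : tau + l - (- tau + l) = 2 * tau by ring.
  by rewrite -{1}sqrt2_mul; field; rewrite gt_eqF.
apply/seteqP; split=> q /=.
  case=> h1 h2; rewrite ler_norml => /andP[h3 h4]; split=> //; lra.
case=> h1 h2 h3; split=> //; first lra.
by rewrite ler_norml; apply/andP; split; lra.
Qed.

End light_cones.

Section increments.
Context {R : realType} d (T : measurableType d) (P : probability T R).
Context (beta : R) (beta_gt0 : 0 < beta) (beta_lt1 : beta < 1).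
Context (W : (R * R -> R) -> {RV P >-> R}) (noiseW : colored_noise beta W).
Context (u : R -> R -> {RV P >-> R}) (solu : wave_solution W u).
Context (lambda : R) (lambda_gt0 : 0 < lambda).
Implicit Types tau h : R.

Definition increment tau h (w : T) : R := utilde u tau (lambda + h) w - utilde u tau lambda w.

Definition istrip tau h : set (R * R) :=
  strip (Num.sqrt 2 * lambda) (Num.sqrt 2 * (lambda + h)) (Num.sqrt 2 * tau).

Definition ivar tau h : R := 4^-1 * noise_ip beta (istrip tau h) (istrip tau h).

Lemma measurable_increment tau h : measurable_fun [set: T] (increment tau h).
Proof. by apply: measurable_funB; exact: measurable_funPT. Qed.

Lemma bounded_borel_istrip tau h : bounded_borel (istrip tau h).
Proof. exact: bounded_borel_strip. Qed.

Lemma utilde_ae tau l : 0 <= tau -> 0 <= l ->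
  {ae P, forall w, utilde u tau l w = 2^-1 * W \1_(cone (Num.sqrt 2 * l) (Num.sqrt 2 * tau)) w}.
Proof.
move=> tau0 l0; rewrite -light_coneE; case: solu => H _.
by apply: H; rewrite divr_ge0 ?sqrtr_ge0// addr_ge0.
Qed.

(** The strip is a difference of nested cones. The null set depends on [tau] and [h], so the
    identity yields laws at fixed parameters and no statement uniform in [tau]. *)
Lemma increment_ae tau h : 0 <= tau -> 0 < h ->
  {ae P, forall w, increment tau h w = 2^-1 * W \1_(istrip tau h) w}.
Proof.
move=> tau0 h0; have lh : 0 <= lambda + h by rewrite addr_ge0 ?ltW.
have s0 := sqrt2_gt0 (R := R).
have sub : cone (Num.sqrt 2 * lambda) (Num.sqrt 2 * tau) `<=`
    cone (Num.sqrt 2 * (lambda + h)) (Num.sqrt 2 * tau).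
  by apply: sub_cone => //; rewrite ler_pM2l// lerDl ltW.
have H := noise_setD beta_gt0 beta_lt1 noiseW (bounded_borel_cone _ _) (bounded_borel_cone _ _) sub.
have := utilde_ae tau0 lh; have := utilde_ae tau0 (ltW lambda_gt0).
apply: filterS3 H => w E1 E2 E3.
by rewrite /increment E3 E2 -mulrBr E1 /istrip strip_cone.
Qed.

Lemma increment_sub_ae tau tau' h : 0 <= tau -> tau <= tau' -> 0 < h ->
  {ae P, forall w, increment tau' h w - increment tau h w =
     2^-1 * W \1_(istrip tau' h `\` istrip tau h) w}.
Proof.
move=> tau0 tt h0; have s0 := sqrt2_gt0 (R := R).
have sub : istrip tau h `<=` istrip tau' h by apply: sub_strip; rewrite ler_pM2l.
have H := noise_setD beta_gt0 beta_lt1 noiseW (bounded_borel_istrip _ _) (bounded_borel_istrip _ _) sub.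
have := increment_ae (le_trans tau0 tt) h0; have := increment_ae tau0 h0.
by apply: filterS3 H => w E1 E2 E3; rewrite E3 E2 -mulrBr E1.
Qed.

Lemma gt0_powRD (x a b : R) : 0 < x -> x `^ (a + b) = x `^ a * x `^ b.
Proof. by move=> x0; apply: powRD; apply/implyP => _; rewrite gt_eqF. Qed.

Lemma powR_sqrt2 p : Num.sqrt 2 `^ p = 2 `^ (p / 2) :> R.
Proof. by rewrite -powR12_sqrt// -powRrM mulrC. Qed.

(** This is where K originates: the strip has width sqrt 2 h in the characteristic coordinate and
    contains a parallelogram of duration (tau + lambda) / sqrt 2; the powers of 2 combine with the
    factor 1/4 into K^2 / 2. *)
Lemma ivar_ge tau h : 0 <= tau -> 0 < h ->
  K_const beta ^+ 2 / 2 * (tau + lambda) * h `^ (2 - beta) <= ivar tau h.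
Proof.
move=> tau0 h0; have s0 := sqrt2_gt0 (R := R).
have b1 : 0 < 1 - beta by rewrite subr_gt0.
have b2 : 0 < 2 - beta by rewrite subr_gt0 (lt_trans beta_lt1)// ltr1n.
have bS := bounded_borel_istrip tau h.
have lt1 : Num.sqrt 2 * lambda < Num.sqrt 2 * (lambda + h) by rewrite ltr_pM2l// ltrDl.
have gt0 : 0 < Num.sqrt 2 * lambda + Num.sqrt 2 * tau
  by rewrite ltr_pwDl//; [exact: mulr_gt0|rewrite mulr_ge0// ltW].
have := noise_cov_strip_ge beta_lt1 lt1 gt0 (bounded_borel_measurable bS).
rewrite -/(istrip tau h) -(fineK (noise_cov_fin beta_gt0 beta_lt1 bS bS)) lee_fin -/(noise_ip _ _ _) => H.
rewrite /ivar; apply: le_trans (ler_wpM2l _ H); last by rewrite invr_ge0.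
have -> : Num.sqrt 2 * (lambda + h) - Num.sqrt 2 * lambda = Num.sqrt 2 * h by ring.
rewrite powRM ?(ltW s0) ?(ltW h0)// powR_sqrt2 /K_const sqr_sqrtr; last first.
  by rewrite divr_ge0 ?powR_ge0// mulr_ge0// ltW.
have E : 2 `^ ((1 - beta) / 2) * 2 = Num.sqrt 2 * 2 `^ ((2 - beta) / 2) :> R.
  have E1 : 2 = 2 `^ 1 :> R by rewrite powRr1.
  rewrite -(powR12_sqrt (ler0n R 2)) [X in _ * X]E1 -!gt0_powRD//.
  by congr (_ `^ _); field.
rewrite le_eqVlt; apply/orP; left; apply/eqP.
transitivity ((2 `^ ((1 - beta) / 2) * 2) * (tau + lambda) * h `^ (2 - beta) / (4 * ((2 - beta) * (1 - beta)))).
  by field; rewrite !gt_eqF.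
by rewrite E; field; rewrite !gt_eqF.
Qed.

Lemma ivar_gt0 tau h : 0 <= tau -> 0 < h -> 0 < ivar tau h.
Proof.
move=> tau0 h0; apply: lt_le_trans (ivar_ge tau0 h0).
rewrite mulr_gt0 ?powR_gt0// mulr_gt0 ?ltr_wpDl// divr_gt0// exprn_gt0// sqrtr_gt0.
rewrite divr_gt0 ?powR_gt0// mulr_gt0 ?subr_gt0//.
by rewrite (lt_trans beta_lt1)// ltr1n.
Qed.

Lemma sqrtr_neq0 (v : R) : 0 < v -> Num.sqrt v != 0.
Proof. by move=> v0; rewrite sqrtr_eq0 -ltNge. Qed.

Definition normalized_increment tau h (w : T) : R := increment tau h w / Num.sqrt (ivar tau h).

Lemma measurable_normalized_increment tau h : measurable_fun [set: T] (normalized_increment tau h).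
Proof. by apply: measurable_funM => //; exact: measurable_increment. Qed.

Lemma normalized_noise_pair (X Y : T -> R) A B (g g' : R) :
  bounded_borel A -> bounded_borel B ->
  measurable_fun [set: T] X -> measurable_fun [set: T] Y ->
  {ae P, forall w, X w = 2^-1 * W \1_A w} -> {ae P, forall w, Y w = 2^-1 * W \1_B w} ->
  g != 0 -> g' != 0 ->
  4^-1 * noise_ip beta A A = g ^+ 2 -> 4^-1 * noise_ip beta B B = g' ^+ 2 ->
  gaussian_pair P (fun w => X w / g) (fun w => Y w / g') (4^-1 * noise_ip beta A B / (g * g')).
Proof.
move=> bA bB mX mY XA YB g0 g'0 gE g'E s t.
have H := noise_lin2_gaussian beta_gt0 beta_lt1 noiseW (s / (2 * g)) (t / (2 * g')) bA bB.
have -> : s ^+ 2 + 2 * s * t * (4^-1 * noise_ip beta A B / (g * g')) + t ^+ 2 =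
    (s / (2 * g)) ^+ 2 * noise_ip beta A A +
    2 * (s / (2 * g)) * (t / (2 * g')) * noise_ip beta A B +
    (t / (2 * g')) ^+ 2 * noise_ip beta B B.
  have -> : noise_ip beta A A = 4 * g ^+ 2 by rewrite -gE mulrA mulfV ?mul1r.
  have -> : noise_ip beta B B = 4 * g' ^+ 2 by rewrite -g'E mulrA mulfV ?mul1r.
  by move: (noise_ip beta A B) => q; field; rewrite g0 g'0.
apply: centered_gaussian_ae H _ _.
  by apply: measurable_funD; apply: measurable_funM => //; exact: measurable_funM.
move: XA YB; apply: filterS2 => w E E'; rewrite E E'.
by move: (W _ w) (W _ w) => x y; field; rewrite g0 g'0.
Qed.

Lemma normalized_increment_pair tau h h' : 0 <= tau -> 0 < h -> 0 < h' ->
  gaussian_pair P (normalized_increment tau h) (normalized_increment tau h')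
    (4^-1 * noise_ip beta (istrip tau h) (istrip tau h') /
     (Num.sqrt (ivar tau h) * Num.sqrt (ivar tau h'))).
Proof.
move=> tau0 h0 h'0; have v0 := ivar_gt0 tau0 h0; have v'0 := ivar_gt0 tau0 h'0.
apply: normalized_noise_pair.
- exact: bounded_borel_istrip.
- exact: bounded_borel_istrip.
- exact: measurable_increment.
- exact: measurable_increment.
- exact: increment_ae.
- exact: increment_ae.
- exact: (sqrtr_neq0 v0).
- exact: (sqrtr_neq0 v'0).
- exact: (esym (sqr_sqrtr (ltW v0))).
- exact: (esym (sqr_sqrtr (ltW v'0))).
Qed.

Lemma normalized_increment_gaussian tau h : 0 <= tau -> 0 < h ->
  centered_gaussian P (normalized_increment tau h) 1.
Proof.
move=> tau0 h0; have := normalized_increment_pair tau0 h0 h0 1 0.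
rewrite mulr0 mul0r addr0 expr0n addr0 expr1n.
have -> // : (fun w => 1 * normalized_increment tau h w + 0 * normalized_increment tau h w) =
    normalized_increment tau h.
by apply/funext => w; rewrite mul1r mul0r addr0.
Qed.

Lemma noise_ip_ge0 A B : bounded_borel A -> bounded_borel B -> 0 <= noise_ip beta A B.
Proof.
move=> bA bB; apply: fine_ge0; apply: integral_ge0 => s _.
apply: (cov_slice_ge0 beta s); apply: indic_nonneg_mfun.
- exact: bounded_borel_measurable bA.
- exact: bounded_borel_measurable bB.
Qed.

Lemma noise_ip_istrip_le (m : R) : 0 <= m -> exists2 C, 0 < C & forall tau h h',
  0 <= tau -> tau <= m -> 0 < h' -> h' <= h -> h <= 1 ->
  noise_ip beta (istrip tau h') (istrip tau h) <= C * h' * h `^ (1 - beta).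
Proof.
move=> m0; have s0 := sqrt2_gt0 (R := R).
have b1 : 0 < 1 - beta by rewrite subr_gt0.
pose k := Num.sqrt 2 * (lambda + 1) + Num.sqrt 2 * m.
have k0 : 0 < k by rewrite ltr_pwDl// ?mulr_gt0 ?mulr_ge0 ?(ltW s0)// addr_gt0.
have Q0 : 0 < 3 * Num.sqrt 2 `^ (1 - beta) / (1 - beta).
  by rewrite divr_gt0// mulr_gt0// powR_gt0.
exists (k * Num.sqrt 2 * (3 * Num.sqrt 2 `^ (1 - beta) / (1 - beta))).
  by apply: mulr_gt0 => //; exact: mulr_gt0.
move=> tau h h' tau0 taum h'0 hh h1; have h0 : 0 < h by exact: lt_le_trans hh.
have bS := bounded_borel_istrip tau h; have bS' := bounded_borel_istrip tau h'.
have e1 : Num.sqrt 2 * tau <= Num.sqrt 2 * m by rewrite ler_pM2l.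
have e2 : Num.sqrt 2 * (lambda + h') <= Num.sqrt 2 * (lambda + 1).
  by rewrite ler_pM2l// lerD2l (le_trans hh).
have e3 : 0 <= Num.sqrt 2 * (lambda + 1) by rewrite mulr_ge0 ?addr_ge0 ?(ltW s0) ?(ltW lambda_gt0).
have e4 : 0 <= Num.sqrt 2 * m by rewrite mulr_ge0 ?(ltW s0).
rewrite -lee_fin /noise_ip fineK; last exact: noise_cov_fin.
have c1 s y : istrip tau h' (s, y) -> 0 <= s <= 0 + k /\
    Num.sqrt 2 * lambda - s <= y <= Num.sqrt 2 * lambda - s + Num.sqrt 2 * h'.
  by case=> /= q1 q2 q3 q4; rewrite /k; split; apply/andP; split; lra.
have c2 s y : istrip tau h (s, y) ->
    Num.sqrt 2 * lambda - s <= y <= Num.sqrt 2 * lambda - s + Num.sqrt 2 * h.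
  by case=> /= q1 q2 q3 q4; apply/andP; split; lra.
have := noise_cov_le beta_gt0 beta_lt1 (bounded_borel_measurable bS') (bounded_borel_measurable bS)
  (lexx 0) k0 (mulr_gt0 s0 h'0) (mulr_gt0 s0 h0) c1 c2.
move=> /le_trans; apply; rewrite lee_fin powRM ?(ltW s0) ?(ltW h0)//.
rewrite le_eqVlt; apply/orP; left; apply/eqP; ring.
Qed.

(** The difference of the two strips lies in a rectangle with sides la, lb in characteristic
    coordinates, lasting a time (la + lb) / 2. Its time slices have length at most min(la, lb), and
    (la + lb) / 2 times this minimum is at most la lb: the bound is linear in tau' - tau. Slices of
    length la in the potential supply the remaining h^(1 - beta). *)
Lemma increment_sub_gaussian : exists2 C, 0 < C & forall tau tau' h,
  0 <= tau -> tau < tau' -> 0 < h ->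
  exists2 v, centered_gaussian P (fun w => increment tau' h w - increment tau h w) v &
    v <= C * (tau' - tau) * h `^ (2 - beta).
Proof.
have s0 := sqrt2_gt0 (R := R).
have b1 : 0 < 1 - beta by rewrite subr_gt0.
pose Q := 3 * Num.sqrt 2 `^ (1 - beta) / (1 - beta).
have Q0 : 0 < Q by rewrite divr_gt0// mulr_gt0// powR_gt0.
exists Q => // tau tau' h tau0 tt h0.
have tau'0 : 0 <= tau' by exact: le_trans (ltW tt).
set A := istrip tau' h `\` istrip tau h.
have bA : bounded_borel A by apply: bounded_borelD; exact: bounded_borel_istrip.
exists (2^-1 ^+ 2 * noise_ip beta A A).
  apply: centered_gaussian_ae (noise_gaussian beta_gt0 beta_lt1 noiseW 2^-1 bA) _ _.
    by apply: measurable_funB; exact: measurable_increment.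
  exact: (increment_sub_ae tau0 (ltW tt) h0).
set la := Num.sqrt 2 * h; set lb := Num.sqrt 2 * (tau' - tau).
have la0 : 0 < la by rewrite mulr_gt0.
have lb0 : 0 < lb by rewrite mulr_gt0 ?subr_gt0.
pose a := Num.sqrt 2 * lambda; pose b := Num.sqrt 2 * tau.
have a0 : 0 < a by rewrite mulr_gt0.
have b0 : 0 <= b by rewrite mulr_ge0 ?(ltW s0).
have AE s y : A (s, y) -> [/\ 0 <= s, a < s + y, s + y <= a + la, b < s - y & s - y <= b + lb].
  case=> -[/= q1 q2 q3 q4] q5; split=> //.
  - by rewrite /a /la; lra.
  - rewrite ltNge; apply/negP => q6; apply: q5; split=> //=.
  - by rewrite /b /lb; lra.
have kp : 0 < (la + lb) / 2 by rewrite divr_gt0// addr_gt0.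
have k0 : 0 <= (a + b) / 2 by rewrite divr_ge0// addr_ge0// ltW.
have bound l c : 0 < l -> (la + lb) / 2 * l <= la * lb ->
    (forall s y, A (s, y) -> c s <= y <= c s + l) ->
    2^-1 ^+ 2 * noise_ip beta A A <= Q * (tau' - tau) * h `^ (2 - beta).
  move=> l0 lab hc.
  have c1 s y : A (s, y) -> (a + b) / 2 <= s <= (a + b) / 2 + (la + lb) / 2 /\ c s <= y <= c s + l.
    move=> /[dup] /hc h1 /AE[q1 q2 q3 q4 q5]; split=> //; apply/andP; split; lra.
  have c2 s y : A (s, y) -> a - s <= y <= a - s + la.
    by move=> /AE[q1 q2 q3 q4 q5]; apply/andP; split; lra.
  have := noise_cov_le beta_gt0 beta_lt1 (bounded_borel_measurable bA) (bounded_borel_measurable bA)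
    k0 kp l0 la0 c1 c2.
  rewrite -(fineK (noise_cov_fin beta_gt0 beta_lt1 bA bA)) lee_fin -/(noise_ip _ _ _) => H.
  have q0 : 0 <= 3 * la `^ (1 - beta) / (1 - beta).
    by rewrite divr_ge0 ?(ltW b1)// mulr_ge0// powR_ge0.
  have H2 : noise_ip beta A A <= la * lb * (3 * la `^ (1 - beta) / (1 - beta)).
    by apply: (le_trans H); rewrite ler_wpM2r.
  apply: (@le_trans _ _ (2^-1 ^+ 2 * (la * lb * (3 * la `^ (1 - beta) / (1 - beta))))).
    by rewrite ler_wpM2l// exprn_ge0// invr_ge0.
  have -> : h `^ (2 - beta) = h * h `^ (1 - beta).
    by rewrite -{2}(powRr1 (ltW h0)) -gt0_powRD//; congr (_ `^ _); ring.
  rewrite powRM ?(ltW s0) ?(ltW h0)// /la /lb.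
  have -> : 2^-1 ^+ 2 * (Num.sqrt 2 * h * (Num.sqrt 2 * (tau' - tau)) *
      (3 * (Num.sqrt 2 `^ (1 - beta) * h `^ (1 - beta)) / (1 - beta))) =
     (Num.sqrt 2 * Num.sqrt 2) / 4 * (Q * (tau' - tau) * (h * h `^ (1 - beta))).
    by rewrite /Q; field; rewrite gt_eqF.
  rewrite sqrt2_mul ler_piMl//; last lra.
  have t0 : 0 <= tau' - tau by rewrite subr_ge0 ltW.
  exact: (mulr_ge0 (mulr_ge0 (ltW Q0) t0) (mulr_ge0 (ltW h0) (powR_ge0 _ _))).
have [lab|lab] := leP la lb.
- apply: (bound la (fun s => a - s)) => //.
    by have := ler_wpM2r (ltW la0) lab; lra.
  by move=> s y /AE[q1 q2 q3 q4 q5]; apply/andP; split; lra.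
- apply: (bound lb (fun s => s - b - lb)) => //.
    by have := ler_wpM2r (ltW lb0) (ltW lab); lra.
  by move=> s y /AE[q1 q2 q3 q4 q5]; apply/andP; split; lra.
Qed.

End increments.

(** * Chaining and comparison of scales *)

Section chaining.
Context {R : realType}.
Implicit Types (f : R -> R) (x a : R).

Lemma dyadic_trunc_step x k : 0 <= x ->
  Num.truncn (x * 2 ^+ k.+1) = ((Num.truncn (x * 2 ^+ k)).*2)%N \/
  Num.truncn (x * 2 ^+ k.+1) = ((Num.truncn (x * 2 ^+ k)).*2.+1)%N.
Proof.
move=> x0; set n := Num.truncn (x * 2 ^+ k); set y := x * 2 ^+ k.+1.
have yE : y = 2 * (x * 2 ^+ k) by rewrite /y exprS mulrCA.
have /andP[h1 h2] := truncn_itv (mulr_ge0 x0 (exprn_ge0 k (ler0n R 2))).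
have y0 : 0 <= y by rewrite mulr_ge0// exprn_ge0.
have l1 : (n.*2 <= Num.truncn y)%N.
  by rewrite truncn_ge_nat// -mul2n natrM yE ler_pM2l.
have l2 : (Num.truncn y < n.+1.*2)%N.
  by rewrite truncn_lt_nat// -mul2n natrM yE ltr_pM2l.
move: l1 l2; rewrite doubleS leq_eqVlt ltnS => /orP[/eqP <-|l1 l2]; first by left.
by right; apply/eqP; rewrite eqn_leq l2.
Qed.

(** Successive dyadic truncations of x either coincide or are neighbours at the finer level. The
    increments telescope, the sum of (9/10)^k over k > J is 9 (9/10)^J <= 9, and continuity at x
    closes the chain. *)
Lemma dyadic_chaining f a (m J : nat) x : 0 <= a -> 0 <= x -> x <= m%:R ->
  (forall e, 0 < e -> exists2 d, 0 < d &
     forall y, 0 <= y -> `|y - x| < d -> `|f y - f x| < e) ->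
  (forall k i, (J <= k)%N -> (i < m * 2 ^ k)%N ->
     `|f (i.+1%:R / 2 ^+ k) - f (i%:R / 2 ^+ k)| <= a * (9 / 10) ^+ k) ->
  `|f x - f ((Num.truncn (x * 2 ^+ J))%:R / 2 ^+ J)| <= 9 * a.
Proof.
move=> a0 x0 xm fx H; pose g k := f ((Num.truncn (x * 2 ^+ k))%:R / 2 ^+ k).
have p k : 0 < 2 ^+ k :> R by exact: exprn_gt0.
have step k : (J <= k)%N -> `|g k.+1 - g k| <= a * (9 / 10) ^+ k.+1.
  move=> Jk; rewrite /g.
  have half (n : nat) : n.*2%:R / 2 ^+ k.+1 = n%:R / 2 ^+ k :> R.
    by rewrite exprS -mul2n natrM; field; rewrite gt_eqF.
  have [->|E] := dyadic_trunc_step k x0.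
    by rewrite half subrr normr0 mulr_ge0// exprn_ge0// divr_ge0.
  rewrite E -half; apply: H; first exact: leq_trans Jk _.
  have L : (Num.truncn (x * 2 ^+ k.+1) <= m * 2 ^ k.+1)%N.
    rewrite -(ler_nat R) natrM natrX.
    have /andP[h _] := truncn_itv (mulr_ge0 x0 (exprn_ge0 k.+1 (ler0n R 2))).
    by apply: (le_trans h); rewrite ler_wpM2r// exprn_ge0.
  by move: L; rewrite E.
have sum k : (J <= k)%N -> `|g k - g J| <= a * (9 * (9 / 10) ^+ J - 9 * (9 / 10) ^+ k).
  elim: k => [|k IH].
    by rewrite leqn0 => /eqP ->; rewrite !subrr normr0 mulr0.
  rewrite leq_eqVlt => /orP[/eqP ->|]; first by rewrite !subrr normr0 mulr0.
  rewrite ltnS => Jk; have := step _ Jk; have := IH Jk.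
  have := ler_normD (g k.+1 - g k) (g k - g J); rewrite addrA subrK.
  rewrite (exprS _ k); move: (_ ^+ k) (_ ^+ J) => b b' h1 h2 h3; lra.
apply/ler_addgt0Pr => e e0; have [d d0 fd] := fx e e0.
(* A level beyond J with 2^(-k) < d. *)
pose k := (J + Num.truncn (d^-1)).+1.
have dk : `|(Num.truncn (x * 2 ^+ k))%:R / 2 ^+ k - x| < d.
  have /andP[h1 h2] := truncn_itv (mulr_ge0 x0 (ltW (p k))).
  have E1 : (Num.truncn (x * 2 ^+ k))%:R / 2 ^+ k <= x by rewrite ler_pdivrMr.
  have E2 : x - (2 ^+ k)^-1 < (Num.truncn (x * 2 ^+ k))%:R / 2 ^+ k.
    by rewrite ltr_pdivlMr// mulrBl mulVf ?gt_eqF// ltrBlDr natr1.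
  have E3 : (2 ^+ k)^-1 < d.
    rewrite invf_plt ?posrE//; apply: (@lt_le_trans _ _ k%:R).
      apply: lt_le_trans (truncnS_gt _) _.
      by rewrite ler_nat /k ltnS leq_addl.
    by rewrite -natrX ler_nat ltnW// ltn_expl.
  by rewrite ler0_norm ?subr_le0//; lra.
have k0 : (J <= k)%N by rewrite /k -addnS leq_addr.
have := fd _ (divr_ge0 (ler0n _ _) (ltW (p k))) dk; rewrite -/(g k).
have := sum _ k0; rewrite -/(g J) => h1 h2.
have h3 := ler_distD (g k) (f x) (g J).
apply: (le_trans h3); rewrite addrC (distrC _ (g k)) lerD ?(ltW h2)//; apply: (le_trans h1).
have q0 : 0 <= (9 / 10) ^+ k :> R by rewrite exprn_ge0// divr_ge0.
have q1 : (9 / 10) ^+ J <= 1 :> R by rewrite exprn_ile1 ?divr_ge0//; lra.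
rewrite [leRHS]mulrC ler_wpM2l//; lra.
Qed.

End chaining.

Section increment_paths.
Context {R : realType} d (T : measurableType d) (P : probability T R).
Context (beta : R) (beta_gt0 : 0 < beta) (beta_lt1 : beta < 1).
Context (W : (R * R -> R) -> {RV P >-> R}) (noiseW : colored_noise beta W).
Context (u : R -> R -> {RV P >-> R}) (solu : wave_solution W u).
Context (lambda : R) (lambda_gt0 : 0 < lambda).
Implicit Types tau h l : R.

Lemma utilde_continuous tau l w : 0 <= tau -> 0 <= l -> forall e, 0 < e ->
  exists2 r, 0 < r & forall y, 0 <= y -> `|y - tau| < r ->
    `|utilde u y l w - utilde u tau l w| < e.
Proof.
move=> tau0 l0 e e0; case: solu => _ /(_ w) /subspace_continuousP H.
pose z (y : R) := ((y + l) / Num.sqrt 2, (- y + l) / Num.sqrt 2).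
have z0 y : 0 <= y -> 0 <= (z y).1 by move=> y0; rewrite divr_ge0 ?sqrtr_ge0// addr_ge0.
have := H (z tau) (z0 _ tau0) => /cvgrPdist_lt /(_ e e0).
rewrite near_withinE => /nbhs_ballP [r r0 Hr]; exists r => // y y0 yr.
rewrite distrC; apply: (Hr (z y)); last exact: z0.
have s1 : 1 <= Num.sqrt 2 :> R by rewrite -[X in X <= _]sqrtr1 ler_sqrt// ler1n.
have s0 := sqrt2_gt0 (R := R).
have B : `|(y - tau) / Num.sqrt 2| < r.
  rewrite normrM normfV (gtr0_norm s0) ltr_pdivrMr//; apply: (lt_le_trans yr).
  by rewrite ler_peMr// ltW.
split; rewrite /ball /=.
- by rewrite distrC -mulrBl opprD addrACA subrr addr0.
- rewrite -mulrBl.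
  have -> : - tau + l - (- y + l) = y - tau by ring.
  exact: B.
Qed.

Lemma increment_continuous tau h w : 0 <= tau -> 0 < h -> forall e, 0 < e ->
  exists2 r, 0 < r & forall y, 0 <= y -> `|y - tau| < r ->
    `|increment u lambda y h w - increment u lambda tau h w| < e.
Proof.
move=> tau0 h0 e e0; have e20 : 0 < e / 2 by rewrite divr_gt0.
have [r r0 H] := @utilde_continuous tau lambda w tau0 (ltW lambda_gt0) _ e20.
have [r' r'0 H'] := @utilde_continuous tau (lambda + h) w tau0 (ltW (addr_gt0 lambda_gt0 h0)) _ e20.
exists (Num.min r r'); first by rewrite lt_min r0.
move=> y y0; rewrite lt_min => /andP[yr yr'].
have {H} H := H y y0 yr; have {H'} H' := H' y y0 yr'; rewrite /increment.
move: (utilde _ _ _ _) (utilde _ _ _ _) (utilde _ _ _ _) (utilde _ _ _ _) H H' => a b c f H H'.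
have -> : b - f - (a - c) = b - a - (f - c) by ring.
by apply: (le_lt_trans (ler_normB _ _)); lra.
Qed.

End increment_paths.

Section probability_unions.
Context {R : realType} d (T : measurableType d) (P : probability T R).

Lemma probability_exists_lt (A : nat -> set T) (c : R) n :
  (forall i, (i < n)%N -> measurable (A i)) ->
  (forall i, (i < n)%N -> (P (A i) <= c%:E)%E) ->
  measurable [set w | exists2 i, (i < n)%N & A i w] /\
  (P [set w | exists2 i, (i < n)%N & A i w] <= (n%:R * c)%:E)%E.
Proof.
elim: n => [|n IH] mA pA.
  have -> : [set w | exists2 i, (i < 0)%N & A i w] = set0.
    by apply/seteqP; split=> // w [].
  by split; [exact: measurable0|rewrite measure0 mul0r].
have [||mB pB] := IH.
- by move=> i ni; apply: mA; exact: ltnW.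
- by move=> i ni; apply: pA; exact: ltnW.
have mAn := mA n (ltnSn n); have pAn := pA n (ltnSn n).
have -> : [set w | exists2 i, (i < n.+1)%N & A i w] =
    [set w | exists2 i, (i < n)%N & A i w] `|` A n.
  apply/seteqP; split=> w /=.
    by case=> i; rewrite ltnS leq_eqVlt => /orP[/eqP ->|ni Ai]; [right|left; exists i].
  by case=> [[i ni Ai]|An]; [exists i => //; exact: ltnW|exists n].
split; first exact: measurableU.
apply: (le_trans (measureU2 P mB mAn)).
by rewrite -natr1 mulrDl mul1r EFinD; exact: leeD.
Qed.

Lemma probability_exists_ge (A : nat -> set T) (c : R) J : 0 <= c ->
  (forall k, (J <= k)%N -> measurable (A k)) ->
  (forall k, (J <= k)%N -> (P (A k) <= (c * 2^-1 ^+ k)%:E)%E) ->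
  measurable [set w | exists2 k, (J <= k)%N & A k w] /\
  (P [set w | exists2 k, (J <= k)%N & A k w] <= (2 * c * 2^-1 ^+ J)%:E)%E.
Proof.
move=> c0 mA pA.
have -> : [set w | exists2 k, (J <= k)%N & A k w] = \bigcup_k A (J + k)%N.
  apply/seteqP; split=> w /=.
    by case=> k Jk Ak; exists (k - J)%N => //; rewrite subnKC.
  by case=> k _ Ak; exists (J + k)%N => //; exact: leq_addr.
have mF k : measurable (A (J + k)%N) by apply: mA; exact: leq_addr.
have mU : measurable (\bigcup_k A (J + k)%N) by exact: bigcup_measurable.
split=> //; apply: (le_trans (generalized_Boole_inequality P mF mU)).
apply: lime_le; first by apply: is_cvg_nneseries.
apply: nearW => n.
apply: (@le_trans _ _ (\sum_(0 <= k < n) (c * 2^-1 ^+ (J + k))%:E)%E).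
  by apply: lee_sum => k _; apply: pA; exact: leq_addr.
have E : \sum_(0 <= k < n) c * 2^-1 ^+ (J + k) = 2 * c * 2^-1 ^+ J * (1 - 2^-1 ^+ n).
  elim: n => [|n IH]; first by rewrite big_geq// expr0 subrr mulr0.
  by rewrite big_nat_recr//= IH exprD exprS; field.
rewrite sumEFin E lee_fin ler_piMr//.
by rewrite mulr_ge0// ?exprn_ge0 ?invr_ge0// mulr_ge0.
Qed.

Lemma measurable_forall_norm_le (X : nat -> T -> R) (c : R) n :
  (forall i, measurable_fun [set: T] (X i)) ->
  measurable [set w | forall i, (i < n)%N -> `|X i w| <= c].
Proof.
move=> mX.
have -> : [set w | forall i, (i < n)%N -> `|X i w| <= c] =
    \bigcap_i [set w | (i < n)%N -> `|X i w| <= c].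
  by apply/seteqP; split=> [w H i _|w H i]; [exact: H|exact: (H i)].
apply: bigcapT_measurable => i; case: (i < n)%N; last first.
  have -> : [set w | false -> `|X i w| <= c] = setT by apply/seteqP; split.
  exact: measurableT.
have -> : [set w | true -> `|X i w| <= c] = [set w | `|X i w| <= c].
  by apply/seteqP; split=> w /= H; [exact: H|move=> _].
rewrite -[X in measurable X]setTI; apply: measurable_fun_le => //.
by apply: measurableT_comp => //; exact: mX.
Qed.

End probability_unions.

(** * Near independence of the scales *)

Section independence_across_scales.
Context {R : realType} d (T : measurableType d) (P : probability T R).
Context (beta : R) (beta_gt0 : 0 < beta) (beta_lt1 : beta < 1).
Context (W : (R * R -> R) -> {RV P >-> R}) (noiseW : colored_noise beta W).
Context (u : R -> R -> {RV P >-> R}) (solu : wave_solution W u).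
Context (lambda : R) (lambda_gt0 : 0 < lambda).
Implicit Types tau h : R.

Lemma K_const_gt0 : 0 < K_const beta.
Proof.
rewrite sqrtr_gt0 divr_gt0 ?powR_gt0// mulr_gt0 ?subr_gt0//.
by rewrite (lt_trans beta_lt1)// ltr1n.
Qed.

Lemma sqrt_powR (x p : R) : Num.sqrt (x `^ p) = x `^ (p / 2).
Proof. by rewrite -powR12_sqrt ?powR_ge0// -powRrM. Qed.

(** The algebra of the next bound: a, b are h'^(1 - beta/2), h^(1 - beta/2), the orders of the
    standard deviations; x, y, z are h'^(beta/2), h^(1 - beta), h^(beta/2); rho is (h' /
    h)^(beta/2). *)
Lemma correlation_bound (C c a b x y z rho i v v' h' : R) :
  0 < C -> 0 < c -> 0 < a -> 0 < b -> 0 <= rho ->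
  h' = a * x -> y * z = b -> rho * z = x ->
  0 <= i -> i <= C * h' * y -> c * a ^+ 2 <= v -> c * b ^+ 2 <= v' ->
  `|4^-1 * i / (Num.sqrt v * Num.sqrt v')| <= C / (4 * c) * rho.
Proof.
move=> C0 c0 a0 b0 r0 h'E bE xE i0 iC av bv.
have v0 : 0 < v by apply: lt_le_trans av; rewrite mulr_gt0// exprn_gt0.
have v'0 : 0 < v' by apply: lt_le_trans bv; rewrite mulr_gt0// exprn_gt0.
have sc : Num.sqrt c * Num.sqrt c = c by rewrite -expr2 sqr_sqrtr// ltW.
have sc0 : 0 < Num.sqrt c by rewrite sqrtr_gt0.
have root q t : 0 < q -> 0 < t -> c * q ^+ 2 <= t -> Num.sqrt c * q <= Num.sqrt t.
  move=> q0 t0 H; rewrite -ler_sqr ?nnegrE ?sqrtr_ge0 ?mulr_ge0 ?(ltW sc0) ?(ltW q0)//.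
  by rewrite exprMn !sqr_sqrtr ?(ltW c0) ?(ltW t0).
have s1 := root _ _ a0 v0 av; have s2 := root _ _ b0 v'0 bv.
have s3 : c * (a * b) <= Num.sqrt v * Num.sqrt v'.
  rewrite -sc mulrACA; apply: ler_pM => //; rewrite mulr_ge0 ?(ltW sc0) ?(ltW a0) ?(ltW b0)//.
have p0 : 0 < Num.sqrt v * Num.sqrt v' by rewrite mulr_gt0 ?sqrtr_gt0.
rewrite ger0_norm; last by rewrite divr_ge0 ?(ltW p0)// mulr_ge0// invr_ge0.
rewrite ler_pdivrMr//; apply: (@le_trans _ _ (C / (4 * c) * rho * (c * (a * b)))).
  have -> : C / (4 * c) * rho * (c * (a * b)) = 4^-1 * (C * h' * y).
    by rewrite h'E -bE -xE; field; rewrite gt_eqF.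
  by rewrite ler_pM2l// invr_gt0.
by rewrite ler_wpM2l// mulr_ge0// divr_ge0 ?(ltW C0)// mulr_ge0// ltW.
Qed.

Lemma increment_correlation (m : R) : 0 <= m -> exists2 C, 0 < C & forall tau h h',
  0 <= tau -> tau <= m -> 0 < h' -> h' <= h -> h <= 1 ->
  `|4^-1 * noise_ip beta (istrip lambda tau h') (istrip lambda tau h) /
    (Num.sqrt (ivar beta lambda tau h') * Num.sqrt (ivar beta lambda tau h))| <=
  C * (h' / h) `^ (beta / 2).
Proof.
move=> m0; have [C C0 HC] := noise_ip_istrip_le beta_gt0 beta_lt1 lambda_gt0 m0.
pose c := K_const beta ^+ 2 / 2 * lambda.
have c0 : 0 < c by rewrite mulr_gt0// divr_gt0// exprn_gt0// K_const_gt0.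
exists (C / (4 * c)); first by rewrite divr_gt0// mulr_gt0.
move=> tau h h' tau0 taum h'0 hh h1; have h0 := lt_le_trans h'0 hh.
have iv k : 0 < k -> c * (k `^ (1 - beta / 2)) ^+ 2 <= ivar beta lambda tau k.
  move=> k0; apply: le_trans (ivar_ge beta_gt0 beta_lt1 lambda_gt0 tau0 k0).
  have -> : (k `^ (1 - beta / 2)) ^+ 2 = k `^ (2 - beta).
    by rewrite expr2 -gt0_powRD//; congr (_ `^ _); field.
  rewrite ler_wpM2r ?powR_ge0// ler_wpM2l ?lerDr//.
  by rewrite divr_ge0// exprn_ge0// ltW// K_const_gt0.
have bS k := bounded_borel_istrip lambda tau k.
apply: (@correlation_bound C c (h' `^ (1 - beta / 2)) (h `^ (1 - beta / 2))
  (h' `^ (beta / 2)) (h `^ (1 - beta)) (h `^ (beta / 2)) _ _ _ _ h') => //.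
- exact: powR_gt0.
- exact: powR_gt0.
- exact: powR_ge0.
- by rewrite -gt0_powRD// subrK powRr1// ltW.
- by rewrite -gt0_powRD//; congr (_ `^ _); field.
- by rewrite -powRM ?(ltW h0) ?divr_ge0 ?(ltW h0) ?(ltW h'0)// divfK// gt_eqF.
- exact: noise_ip_ge0.
- exact: HC.
- exact: iv.
- exact: iv.
Qed.

Lemma gaussian_pairC (X Y : T -> R) rho : gaussian_pair P X Y rho -> gaussian_pair P Y X rho.
Proof.
move=> H s t; have := H t s.
have -> : t ^+ 2 + 2 * t * s * rho + s ^+ 2 = s ^+ 2 + 2 * s * t * rho + t ^+ 2 by ring.
have -> // : (fun w => t * X w + s * Y w) = (fun w => s * Y w + t * X w).
by apply/funext => w; rewrite addrC.
Qed.

Lemma scale_ratio_powR (M k j i : nat) : (0 < M)%N -> 8 <= k%:R * beta -> (i < j)%N ->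
  (M%:R^-1 ^+ (k * j.+1) / M%:R^-1 ^+ (k * i.+1)) `^ (beta / 2) <= expR (- 4 * ln M%:R).
Proof.
move=> M0 k8 ij; have m0 : 0 < M%:R :> R by rewrite ltr0n.
have m1 : 1 <= M%:R :> R by rewrite ler1n.
have -> : M%:R^-1 ^+ (k * j.+1) / M%:R^-1 ^+ (k * i.+1) = M%:R^-1 ^+ (k * (j - i)) :> R.
  have -> : (k * j.+1 = k * (j - i) + k * i.+1)%N.
    by rewrite -mulnDr addnS subnK// ltnW.
  by rewrite exprD mulfK// expf_neq0// invr_eq0 gt_eqF.
rewrite /powR gt_eqF ?exprn_gt0 ?invr_gt0// ler_expR lnXn ?invr_gt0// lnV ?posrE//.
have l0 : 0 <= ln M%:R :> R by exact: ln_ge0.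
have : 8 <= (k * (j - i))%:R * beta.
  apply: (le_trans k8); rewrite ler_pM2r// ler_nat leq_pmulr// subn_gt0//.
rewrite -(mulr_natr (- ln M%:R)); move: ((k * (j - i))%:R) => q q8.
have := ler_wpM2r l0 q8; lra.
Qed.

(* At the scales M^(- k (n + 1)) the correlations are at most M^(- 3), which the second moment method tolerates. *)
Lemma increments_small_probability (r m : R) : 0 < r -> r < 1 -> 0 <= m ->
  exists (k : nat) (C A : R), [/\ (0 < k)%N, 0 < C & forall M tau, (0 < M)%N -> A <= M%:R -> 0 <= tau -> tau <= m ->
    (P [set w | forall n, (n < M)%N ->
         (`|normalized_increment beta u lambda tau (M%:R^-1 ^+ (k * n.+1)) w| <=
         r * Num.sqrt (2 * r * ln M%:R))%R] <= (C * expR (- (1 - r) * ln M%:R))%:E)%E].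
Proof.
move=> r0 r1 m0; have [C C0 HC] := gaussian_maximum_small P r0 r1.
have [A A0 HA] := increment_correlation m0.
(* With k beta >= 8 the ratio of two scales raised to beta / 2 is at most M^(-4); one factor M pays
   for the constant [A], leaving M^(-3). *)
pose k := (Num.truncn (8 / beta)).+1.
have k8 : 8 <= k%:R * beta by rewrite -ler_pdivrMr// ltW// truncnS_gt.
exists k, C, A; split=> // M tau M0 AM tau0 taum.
have mi0 n : 0 < M%:R^-1 ^+ (k * n) :> R by rewrite exprn_gt0// invr_gt0 ltr0n.
have mi1 i j : (i <= j)%N -> M%:R^-1 ^+ (k * j) <= M%:R^-1 ^+ (k * i) :> R.
  by move=> ij; rewrite ler_wiXn2l ?invr_ge0// ?invf_le1 ?ler1n ?ltr0n// leq_mul2l ij orbT.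
apply: (HC M (fun n : 'I_M => normalized_increment beta u lambda tau (M%:R^-1 ^+ (k * n.+1)))) => //.
- by move=> i; exact: (normalized_increment_gaussian beta_gt0 beta_lt1 noiseW solu lambda_gt0 tau0 (mi0 _)).
- move=> i j.
  wlog ij : i j / (i < j)%N.
    move=> H ij; have : (i < j)%N || (j < i)%N by rewrite -neq_ltn.
    case/orP => [l|l]; first exact: H.
    have [|rho H1 H2] := H j i l; first by rewrite eq_sym.
    exact: (ex_intro2 _ _ rho (gaussian_pairC H1) H2).
  move=> _; eexists.
    exact: (gaussian_pairC (normalized_increment_pair beta_gt0 beta_lt1 noiseW solu lambda_gt0 tau0 (mi0 _) (mi0 _))).
  apply: (le_trans (HA _ _ _ tau0 taum (mi0 _) _ _)).
  + by apply: mi1; rewrite ltnS ltnW.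
  + by have := mi1 0%N i.+1 (leq0n _); rewrite muln0 expr0.
  apply: (@le_trans _ _ (M%:R * expR (- 4 * ln M%:R))).
    exact: (ler_pM (ltW A0) (powR_ge0 _ _) AM (scale_ratio_powR M0 k8 ij)).
  have m0' : 0 < M%:R :> R by rewrite ltr0n.
  rewrite -{1}(lnK (x := M%:R)) ?posrE// -expRD ler_expR; lra.
- apply: measurable_forall_norm_le => i; exact: measurable_normalized_increment.
- by move=> w H i; apply: H.
Qed.

End independence_across_scales.

(** * Oscillation in tau between grid points *)

Section small_oscillations.
Context {R : realType} d (T : measurableType d) (P : probability T R).
Context (beta : R) (beta_gt0 : 0 < beta) (beta_lt1 : beta < 1).
Context (W : (R * R -> R) -> {RV P >-> R}) (noiseW : colored_noise beta W).
Context (u : R -> R -> {RV P >-> R}) (solu : wave_solution W u).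
Context (lambda : R) (lambda_gt0 : 0 < lambda).

(* Since (9/10)^2 > 1/2, the squared threshold decays more slowly in k than the variance 2^(- k) h^(2 - beta). *)
Definition large_step (h : R) k i : set T :=
  [set w | (9 / 10) ^+ k * h `^ (1 - beta / 2) <=
    `|increment u lambda (i.+1%:R / 2 ^+ k) h w - increment u lambda (i%:R / 2 ^+ k) h w| ].

Lemma measurable_large_step h k i : measurable (large_step h k i).
Proof.
apply: (@measurable_norm_ge _ _ _ (fun w => increment u lambda (i.+1%:R / 2 ^+ k) h w -
  increment u lambda (i%:R / 2 ^+ k) h w)).
by apply: measurable_funB; exact: measurable_increment.
Qed.

(** Variance over squared threshold is of order 2^(-k) (100/81)^k = (50/81)^k. As (50/81)^2 <= 1/2,
    the tail bound of order 2 Q gives 2^(- Q k), uniformly in [h]. *)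
Lemma large_step_probability (Q : nat) : exists2 C, 0 < C & forall h k i, 0 < h ->
  (P (large_step h k i) <= (C * (2^-1 ^+ k) ^+ Q)%:E)%E.
Proof.
have [C C0 HC] := increment_sub_gaussian beta_gt0 beta_lt1 noiseW solu lambda_gt0.
exists (2 * (2 * Q)`!%:R * (4 * C) ^+ (2 * Q)).
  by rewrite !mulr_gt0 ?exprn_gt0 ?ltr0n ?fact_gt0// mulr_gt0.
move=> h k i h0; have p0 : 0 < 2 ^+ k :> R by exact: exprn_gt0.
have t0 : 0 <= i%:R / 2 ^+ k :> R by rewrite divr_ge0// ltW.
have t1 : i%:R / 2 ^+ k < i.+1%:R / 2 ^+ k :> R by rewrite ltr_pM2r ?invr_gt0// ltr_nat.
have [v gv vC] := HC _ _ _ t0 t1 h0.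
have x0 : 0 < (9 / 10) ^+ k * h `^ (1 - beta / 2) by rewrite mulr_gt0 ?powR_gt0// exprn_gt0// divr_gt0.
apply: (le_trans (centered_gaussian_tail (2 * Q) gv x0)).
have v0 : 0 <= v by case: gv.
rewrite lee_fin -[leRHS]mulrA ler_pM2l; last by rewrite mulr_gt0// ltr0n fact_gt0.
have H : 4 * v / ((9 / 10) ^+ k * h `^ (1 - beta / 2)) ^+ 2 <= 4 * C * (50 / 81) ^+ k.
  rewrite ler_pdivrMr ?exprn_gt0// (exprMn 2).
  have -> : (h `^ (1 - beta / 2)) ^+ 2 = h `^ (2 - beta).
    by rewrite expr2 -gt0_powRD//; congr (_ `^ _); field.
  have E : (50 / 81) ^+ k * ((9 / 10) ^+ k) ^+ 2 = (2 ^+ k)^-1 :> R.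
    by rewrite exprAC -exprMn -exprVn; congr (_ ^+ k); field.
  have -> : 4 * C * (50 / 81) ^+ k * (((9 / 10) ^+ k) ^+ 2 * h `^ (2 - beta)) =
     4 * (C * (2 ^+ k)^-1 * h `^ (2 - beta)) by rewrite -E; ring.
  rewrite ler_pM2l//; apply: (le_trans vC).
  have -> : i.+1%:R / 2 ^+ k - i%:R / 2 ^+ k = (2 ^+ k)^-1 :> R.
    by rewrite -natr1; field; rewrite gt_eqF.
  by [].
have q0 : 0 <= 4 * v / ((9 / 10) ^+ k * h `^ (1 - beta / 2)) ^+ 2.
  exact: (divr_ge0 (mulr_ge0 (ler0n _ 4) v0) (exprn_ge0 2 (ltW x0))).
apply: (@le_trans _ _ ((4 * C * (50 / 81) ^+ k) ^+ (2 * Q))).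
  by apply: lerXn2r => //; rewrite nnegrE ?(le_trans q0).
rewrite exprMn ler_pM2l; last by rewrite exprn_gt0// mulr_gt0.
rewrite exprM; apply: lerXn2r; rewrite ?nnegrE ?exprn_ge0 ?divr_ge0 ?invr_ge0//.
rewrite exprAC; apply: lerXn2r; rewrite ?nnegrE ?exprn_ge0 ?divr_ge0 ?invr_ge0//.
by rewrite expr2; lra.
Qed.

Lemma large_steps_probability (Q m : nat) : exists2 C, 0 <= C & forall J (h : nat -> R),
  (forall n, 0 < h n) ->
  let B := [set w | exists2 k, (J <= k)%N & exists2 i, (i < m * 2 ^ k)%N &
              exists2 n, (n < 2 ^ (Q * J))%N & large_step (h n) k i w] in
  measurable B /\ (P B <= (C * 2^-1 ^+ J)%:E)%E.
Proof.
(* For k >= J there are at most 2^(Q k) scales and m 2^k steps; the order Q + 2 leaves a summable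
   2^(-k). *)
have [C C0 HC] := large_step_probability (Q + 2).
exists (2 * (m%:R * C)); first by rewrite !mulr_ge0// ltW.
move=> J h h0 /=; apply: (@probability_exists_ge _ _ _ P
  (fun k => [set w | exists2 i, (i < m * 2 ^ k)%N & exists2 n, (n < 2 ^ (Q * J))%N & large_step (h n) k i w])
  (m%:R * C)).
- by rewrite mulr_ge0// ltW.
- move=> k Jk; apply: (@proj1 _ _ (@probability_exists_lt _ _ _ P _ 1 _ _ _)) => i _.
    apply: (@proj1 _ _ (@probability_exists_lt _ _ _ P _ 1 _ _ _)) => n _.
      exact: measurable_large_step.
    exact: probability_le1 (measurable_large_step _ _ _).
  apply: probability_le1; apply: (@proj1 _ _ (@probability_exists_lt _ _ _ P _ 1 _ _ _)) => n _.
    exact: measurable_large_step.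
  exact: probability_le1 (measurable_large_step _ _ _).
- move=> k Jk.
  have H i := @probability_exists_lt _ _ _ P (fun n => large_step (h n) k i) _ (2 ^ (Q * J))
    (fun n _ => measurable_large_step (h n) k i) (fun n _ => HC (h n) k i (h0 n)).
  have [_ H2] := @probability_exists_lt _ _ _ P
     (fun i => [set w | exists2 n, (n < 2 ^ (Q * J))%N & large_step (h n) k i w]) _ (m * 2 ^ k)
     (fun i _ => (H i).1) (fun i _ => (H i).2).
  apply: (le_trans H2); rewrite lee_fin !natrM !natrX.
  have E : m%:R * C * 2^-1 ^+ k = m%:R * 2 ^+ k * (2 ^+ (Q * k) * (C * (2^-1 ^+ k) ^+ (Q + 2))) :> R.
    rewrite mulnC exprM; have : 2 ^+ k * 2^-1 ^+ k = 1 :> R by rewrite -exprMn mulfV ?expr1n.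
    rewrite exprD; move: (2 ^+ k) (2^-1 ^+ k) => p q pq.
    have -> : m%:R * p * (p ^+ Q * (C * (q ^+ Q * q ^+ 2))) = m%:R * C * (p * q) * (p * q) ^+ Q * q.
      by rewrite exprMn; ring.
    by rewrite pq expr1n !mulr1.
  rewrite E ler_wpM2l ?mulr_ge0 ?exprn_ge0// ler_wpM2r ?mulr_ge0 ?exprn_ge0 ?invr_ge0 ?(ltW C0)//.
  by rewrite ler_weXn2l ?ler1n// leq_mul2l Jk orbT.
Qed.

End small_oscillations.

(** * Deterministic comparison of scales *)

Section asymptotics.
Context {R : realType}.
Implicit Types (r b c x : R).

(** Here x stands for ln M, b for ln k, and b + x + ln x dominates log log(1 / h_n). With y = sqrt x
    one has ln x <= 2 y and b <= b y, so (b + 2) y <= (1/r - 1) y^2 is enough. *)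
Lemma log_asymptotics r b c : 0 < r -> r < 1 -> 0 <= b -> 0 <= c ->
  exists X, forall x, X <= x -> [/\ 2 <= x, c <= Num.sqrt x & b + x + ln x <= x / r].
Proof.
move=> r0 r1 b0 c0; pose a := r^-1 - 1.
have a0 : 0 < a by rewrite subr_gt0 invf_gt1.
pose N := 2 + c + (b + 2) / a.
have f0 : 0 <= (b + 2) / a by apply: divr_ge0 (ltW a0); lra.
exists (N ^+ 2) => x xN.
have N0 : 0 <= N by rewrite !addr_ge0.
have yN : N <= Num.sqrt x by rewrite -(ger0_norm N0) -sqrtr_sqr ler_wsqrtr.
have x0 : 0 <= x by apply: le_trans xN; exact: exprn_ge0.
move: yN (sqr_sqrtr x0); set y := Num.sqrt x => yN yx.
have N2 : 2 <= N by rewrite /N -addrA lerDl addr_ge0.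
have y2 : 2 <= y by exact: le_trans yN.
have yc : c <= y by apply: le_trans yN; rewrite /N; lra.
have ya : b + 2 <= a * y.
  by rewrite mulrC -ler_pdivrMr//; apply: le_trans yN; rewrite /N; lra.
split=> //; rewrite -yx.
- by rewrite expr2; nra.
- have y0 : 0 < y by lra.
  have lny : ln y <= y.
    by have := le_ln1Dx (x := y - 1); rewrite addrCA subrr addr0; move/(_ _); lra.
  rewrite lnXn// [y ^+ 2 / r](_ : _ = a * y * y + y ^+ 2); last by rewrite /a; ring.
  have : (b + 2) * y <= a * y * y by rewrite ler_pM2r.
  have : b <= b * y by rewrite ler_peMr//; lra.
  by rewrite mulr2n; lra.
Qed.

(** Bookkeeping of the losses: x = ln M, H = h^(2 - beta), L = log log(1/h), D and D' are the
    increments at the grid point and at tau, with tl and tl' these times plus lambda. The threshold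
    and the passage from tl to tl' cost r^2, the oscillation one more r, and replacing x by L the
    fourth. *)
Lemma increment_ratio_ge (K r x l tl tl' H L D D' v : R) :
  0 < K -> 0 < r -> r < 1 -> 2 <= x -> 0 < l -> l <= tl' -> r * tl' <= tl -> 0 < H ->
  0 < L -> L <= x / r -> K ^+ 2 / 2 * tl * H <= v ->
  r * Num.sqrt (2 * r * x) < `|D / Num.sqrt v| -> `|D' - D| <= 9 * Num.sqrt H ->
  9 <= r ^+ 2 * (1 - r) * K * Num.sqrt l * Num.sqrt x ->
  r ^+ 4 * K <= `|D'| / Num.sqrt (tl' * H * L).
Proof.
move=> K0 r0 r1 x2 l0 ltl tl'tl H0 L0 Lx vge Dge DD x9.
have x0 : 0 < x by lra.
have tl'0 : 0 < tl' by exact: lt_le_trans ltl.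
have tl0 : 0 < tl by apply: lt_le_trans tl'tl; exact: mulr_gt0.
have v0 : 0 < v by apply: lt_le_trans vge; rewrite !mulr_gt0 ?exprn_gt0 ?invr_gt0.
pose S := Num.sqrt (tl' * H * x).
have S0 : 0 <= S by exact: sqrtr_ge0.
have S2 : S ^+ 2 = tl' * H * x by rewrite sqr_sqrtr// !mulr_ge0 ?ltW.
have rt t : 0 < t -> Num.sqrt t ^+ 2 = t by move=> t0; rewrite sqr_sqrtr// ltW.
have h1 : r ^+ 2 * K * S <= r * Num.sqrt (2 * r * x) * Num.sqrt v.
  rewrite -ler_sqr ?nnegrE ?mulr_ge0 ?sqrtr_ge0 ?exprn_ge0 ?(ltW r0) ?(ltW K0)//.
  rewrite !exprMn S2 !rt ?mulr_gt0//.
  have e1 : K ^+ 2 / 2 * (r * tl') * H <= v.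
    by apply: le_trans vge; rewrite ler_pM2r// ler_pM2l// divr_gt0// exprn_gt0.
  have e2 : 0 <= r ^+ 2 * (2 * r * x) by rewrite !mulr_ge0 ?exprn_ge0 ?ltW.
  by have := ler_wpM2l e2 e1; apply: le_trans; rewrite le_eqVlt; apply/orP; left; apply/eqP; field.
have h2 : r ^+ 2 * K * S <= `|D|.
  apply: (le_trans h1); rewrite ltW// -ltr_pdivlMr ?sqrtr_gt0//.
  by move: Dge; rewrite normrM normfV (ger0_norm (sqrtr_ge0 v)).
have h3 : 9 * Num.sqrt H <= r ^+ 2 * (1 - r) * K * S.
  apply: (@le_trans _ _ (r ^+ 2 * (1 - r) * K * Num.sqrt l * Num.sqrt x * Num.sqrt H)).
    by rewrite ler_wpM2r ?sqrtr_ge0.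
  have c0 : 0 <= r ^+ 2 * (1 - r) * K by rewrite !mulr_ge0 ?exprn_ge0 ?subr_ge0 ?ltW.
  rewrite -!(mulrA (r ^+ 2 * (1 - r) * K)) ler_wpM2l// -ler_sqr ?nnegrE ?mulr_ge0 ?sqrtr_ge0//.
  by rewrite S2 !exprMn !rt// [leRHS]mulrAC !ler_pM2r.
have h4 : r ^+ 3 * K * S <= `|D'|.
  have := ler_normB D' (D' - D); rewrite opprB addrCA subrr addr0 => q1.
  have -> : r ^+ 3 * K * S = r ^+ 2 * K * S - r ^+ 2 * (1 - r) * K * S by ring.
  by lra.
rewrite ler_pdivlMr ?sqrtr_gt0 ?mulr_gt0//; apply: le_trans h4.
have -> : r ^+ 4 * K * Num.sqrt (tl' * H * L) = r ^+ 3 * K * (r * Num.sqrt (tl' * H * L)) by ring.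
rewrite ler_wpM2l ?mulr_ge0 ?exprn_ge0 ?(ltW r0) ?(ltW K0)//.
rewrite -ler_sqr ?nnegrE ?mulr_ge0 ?sqrtr_ge0 ?(ltW r0)//.
rewrite exprMn rt ?mulr_gt0// S2 mulrCA ler_pM2l ?mulr_gt0//.
have rL : r * L <= x by rewrite mulrC -ler_pdivlMr.
apply: le_trans rL; rewrite ler_pM2r// expr2; nra.
Qed.

End asymptotics.

(** * Law of the iterated logarithm *)

Section almost_sure_limits.
Context {R : realType}.

(** The points lying in all B_J with J >= J0 form a set of probability at most every P(B_J), hence
    zero; a countable union over J0 remains. The bounds are available from the threshold [A] on. *)
Lemma negligible_eventually d (T : measurableType d) (P : probability T R)
    (B : nat -> set T) (C A : R) : 0 <= C ->
  (forall J, A <= J%:R -> measurable (B J) /\ (P (B J) <= (C * 2^-1 ^+ J)%:E)%E) ->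
  P.-negligible [set w | exists J0, forall J, (J0 <= J)%N -> B J w].
Proof.
move=> C0 HB.
apply: (@negligibleS _ _ _ _ (\bigcup_J0 [set w | forall J, (J0 <= J)%N -> B J w])).
  by move=> w [J0 H]; exists J0.
apply: negligible_bigcup => J0; pose N := maxn J0 (Num.truncn A).+1.
have AN J : A <= (N + J)%:R.
  apply/ltW/(lt_le_trans (truncnS_gt A)); rewrite ler_nat.
  by apply: leq_trans (leq_addr _ _); exact: leq_maxr.
apply: (@negligibleS _ _ _ _ (\bigcap_J B (N + J)%N)).
  by move=> w H J _; apply: H; apply: leq_trans (leq_addr _ _); exact: leq_maxl.
have mI : measurable (\bigcap_J B (N + J)%N).
  by apply: bigcapT_measurable => J; case: (HB _ (AN J)).
apply/(negligibleP P mI)/eqP; rewrite eq_le measure_ge0 andbT.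
apply/lee_addgt0Pr => e e0; rewrite add0e.
pose J := (Num.truncn (C / e)).+1; have [mB pB] := HB _ (AN J).
have sub : \bigcap_J B (N + J)%N `<=` B (N + J)%N by move=> w; exact.
apply: (le_trans (le_measure _ _ _ sub)); rewrite ?inE//.
apply: (le_trans pB); rewrite lee_fin exprVn ler_pdivrMr ?exprn_gt0//.
rewrite mulrC -ler_pdivrMr//; apply/ltW/(lt_le_trans (truncnS_gt _)).
rewrite -/J -natrX ler_nat; apply/ltnW/(leq_ltn_trans (leq_addl N J)).
exact: ltn_expl.
Qed.

Lemma limf_esup_right_ge (f : R -> R) (c : R) :
  (forall e, 0 < e -> exists h, [/\ 0 < h, h < e & c <= f h]) ->
  (c%:E <= limf_esup (fun h => (f h)%:E) 0^'+)%E.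
Proof.
move=> H; apply: le_ereal_inf_tmp => _ [V FV <-].
have /nbhs_ballP [e e0 He] : nbhs (0 : R) [set h | 0 < h -> V h] by exact: FV.
have [h [h0 he ch]] := H e e0.
apply: (@le_trans _ _ (f h)%:E); first by rewrite lee_fin.
apply: ereal_sup_ubound; exists h => //; apply: He => //.
by rewrite /ball /= sub0r normrN gtr0_norm.
Qed.

Lemma expR_ln2 n : expR (- (n%:R * ln 2)) = 2^-1 ^+ n :> R.
Proof. by rewrite expRN expRM_natl lnK ?posrE// exprVn. Qed.

End almost_sure_limits.

Section lower_bound.
Context {R : realType} d (T : measurableType d) (P : probability T R).
Context (beta : R) (beta_gt0 : 0 < beta) (beta_lt1 : beta < 1).
Context (W : (R * R -> R) -> {RV P >-> R}) (noiseW : colored_noise beta W).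
Context (u : R -> R -> {RV P >-> R}) (solu : wave_solution W u).
Context (lambda : R) (lambda_gt0 : 0 < lambda).
Implicit Types tau h : R.

Definition lil_ratio tau h (w : T) : R :=
  `|increment u lambda tau h w| /
  Num.sqrt ((tau + lambda) * h `^ (2 - beta) * ln (ln (1 / h))).

Definition small_increments r (k M : nat) tau : set T :=
  [set w | forall n, (n < M)%N ->
     `|normalized_increment beta u lambda tau (M%:R^-1 ^+ (k * n.+1)) w| <=
     r * Num.sqrt (2 * r * ln M%:R)].

(** ln(1/h) = k (n + 1) ln M with n + 1 <= M. It exceeds 1, so the iterated logarithm is
    positive. *)
Lemma log_log_scale (k M n : nat) : (0 < k)%N -> (0 < M)%N -> (n < M)%N -> 2 <= ln (M%:R : R) ->
  0 < ln (ln (1 / ((M%:R : R)^-1 ^+ (k * n.+1)))) <= ln (k%:R : R) + ln (M%:R : R) + ln (ln (M%:R : R)).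
Proof.
move=> k0 M0 nM x2; have m0 : 0 < M%:R :> R by rewrite ltr0n.
have x0 : 0 < ln M%:R :> R by lra.
have q0 : 0 < (k * n.+1)%:R :> R by rewrite ltr0n muln_gt0 k0.
rewrite div1r exprVn invrK lnXn// -(mulr_natl (ln M%:R)) lnM ?posrE//.
have lk : 0 <= ln (k * n.+1)%:R :> R by rewrite ln_ge0// ler1n muln_gt0 k0.
apply/andP; split.
  by rewrite ltr_wpDl// ln_gt0//; lra.
rewrite lerD2r natrM lnM ?posrE ?ltr0n// lerD2l ler_ln ?posrE ?ltr0n//.
by rewrite ler_nat.
Qed.

(** A pathwise statement: outside both exceptional events, the dyadic truncation t of tau has a
    scale with a large normalized increment, and chaining transfers it to tau at the same scale. *)
Lemma lil_ratio_good_scale (r : R) (m J k M : nat) tau w :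
  0 < r -> r < 1 -> (0 < k)%N -> (0 < M)%N -> 0 <= tau -> tau <= m%:R ->
  2 <= ln M%:R :> R -> ln k%:R + ln M%:R + ln (ln M%:R) <= ln M%:R / r ->
  9 <= r ^+ 2 * (1 - r) * K_const beta * Num.sqrt lambda * Num.sqrt (ln M%:R) ->
  2^-1 ^+ J <= (1 - r) * lambda ->
  ~ (exists2 i, (i < (m * 2 ^ J).+1)%N & small_increments r k M (i%:R / 2 ^+ J) w) ->
  ~ (exists2 k', (J <= k')%N & exists2 i, (i < m * 2 ^ k')%N &
      exists2 n, (n < M)%N & large_step beta u lambda (M%:R^-1 ^+ (k * n.+1)) k' i w) ->
  exists h, [/\ 0 < h, h <= M%:R^-1 & r ^+ 4 * K_const beta <= lil_ratio tau h w].
Proof.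
move=> r0 r1 k0 M0 tau0 taum x2 xr x9 J2 nsmall nlarge.
have p0 : 0 < 2 ^+ J :> R by exact: exprn_gt0.
set i := Num.truncn (tau * 2 ^+ J).
have /andP[i1 i2] := truncn_itv (mulr_ge0 tau0 (ltW p0)).
(* The index m 2^J does occur, for tau = m. *)
have im : (i < (m * 2 ^ J).+1)%N.
  by rewrite ltnS -(ler_nat R) natrM natrX (le_trans i1)// ler_wpM2r// ltW.
pose t : R := i%:R / 2 ^+ J.
have t0 : 0 <= t by rewrite divr_ge0// ltW.
have [n nM big] : exists2 n, (n < M)%N & r * Num.sqrt (2 * r * ln M%:R) <
    `|normalized_increment beta u lambda t (M%:R^-1 ^+ (k * n.+1)) w|.
  apply: contrapT => H; apply: nsmall; exists i => // n nM.
  by rewrite leNgt; apply/negP => Hn; apply: H; exists n.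
set h := M%:R^-1 ^+ (k * n.+1) in big.
have h0 : 0 < h by rewrite exprn_gt0// invr_gt0 ltr0n.
exists h; split=> //.
  have M1 : M%:R^-1 <= 1 :> R by rewrite invf_le1 ?ltr0n// ler1n.
  by rewrite -[leRHS]expr1 ler_wiXn2l ?invr_ge0// muln_gt0 k0.
have /andP[L0 Lx] := log_log_scale k0 M0 nM x2.
have osc : `|increment u lambda tau h w - increment u lambda t h w| <= 9 * Num.sqrt (h `^ (2 - beta)).
  have -> : Num.sqrt (h `^ (2 - beta)) = h `^ (1 - beta / 2).
    by rewrite sqrt_powR; congr (_ `^ _); field.
  apply: (@dyadic_chaining _ (fun s => increment u lambda s h w) _ m J tau) => //.
  - exact: powR_ge0.
  - move=> e e0; exact: (increment_continuous solu lambda_gt0 w tau0 h0 e0).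
  - move=> k' i' Jk im'; rewrite leNgt; apply/negP => H; apply: nlarge.
    exists k' => //; exists i' => //; exists n => //; rewrite /large_step /= mulrC; exact: ltW.
apply: (@increment_ratio_ge _ (K_const beta) r (ln M%:R) lambda (t + lambda) (tau + lambda)
  _ _ (increment u lambda t h w) _ (ivar beta lambda t h)) => //.
- exact: K_const_gt0.
- by rewrite lerDr.
(* The mesh is at most (1 - r) lambda, hence r (tau + lambda) <= t + lambda. *)
- have tt : tau <= t + 2^-1 ^+ J.
    rewrite exprVn -[_^-1]mul1r -mulrDl ler_pdivlMr// natr1; exact: ltW.
  have : r * tau <= tau by rewrite ler_piMl// ltW.
  rewrite mulrDr; lra.
- exact: powR_gt0.
- exact: le_trans xr.
- exact: (ivar_ge beta_gt0 beta_lt1 lambda_gt0 t0 h0).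
Qed.

Lemma lil_lower_bound_negligible (r : R) (m : nat) : 0 < r -> r < 1 ->
  P.-negligible [set w | ~ forall tau, 0 <= tau -> tau <= m%:R ->
    ((r ^+ 4 * K_const beta)%:E <= limf_esup (fun h => (lil_ratio tau h w)%:E) 0^'+)%E].
Proof.
move=> r0 r1.
have [k [C [A [k0 C0 HA]]]] :=
  increments_small_probability beta_gt0 beta_lt1 noiseW solu lambda_gt0 r0 r1 (ler0n R m).
have r10 : 0 < 1 - r by rewrite subr_gt0.
(* With (1 - r) Q >= 2 each grid point fails with probability O(4^(-J)), which leaves O(2^(-J))
   after the union over m 2^J + 1 points. *)
pose Q := (Num.truncn (2 / (1 - r))).+1.
have Q2 : 2 <= (1 - r) * Q%:R by rewrite mulrC -ler_pdivrMr// ltW// truncnS_gt.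
have [C' C'0 HC'] := large_steps_probability beta_gt0 beta_lt1 noiseW solu lambda_gt0 Q m.
pose c := r ^+ 2 * (1 - r) * K_const beta * Num.sqrt lambda.
have c0 : 0 < c by rewrite !mulr_gt0 ?exprn_gt0 ?K_const_gt0 ?sqrtr_gt0.
have k1 : 1 <= k%:R :> R by rewrite ler1n.
have [X HX] := log_asymptotics r0 r1 (ln_ge0 k1) (divr_ge0 (ler0n R 9) (ltW c0)).
pose M J := (2 ^ (Q * J))%N.
pose h J n : R := (M J)%:R^-1 ^+ (k * n.+1).
have M0 J : (0 < M J)%N by rewrite expn_gt0.
have JM J : (J <= M J)%N.
  by apply: leq_trans (ltnW (ltn_expl (Q * J) _)) => //; rewrite leq_pmull.
have h0 J n : 0 < h J n by rewrite exprn_gt0// invr_gt0 ltr0n.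
pose S J := [set w | exists2 i, (i < (m * 2 ^ J).+1)%N & small_increments r k (M J) (i%:R / 2 ^+ J) w].
pose L J := [set w | exists2 k', (J <= k')%N & exists2 i, (i < m * 2 ^ k')%N &
      exists2 n, (n < M J)%N & large_step beta u lambda (h J n) k' i w].
have v0 : 0 <= ((1 - r) * lambda)^-1 by rewrite invr_ge0 ltW// mulr_gt0.
(* The sum dominates the three thresholds at once: on M, on ln M and on the mesh 2^(-J). It bounds
   J, which suffices since J <= M and J <= 2^J. *)
pose A' := `|A| + expR X + ((1 - r) * lambda)^-1.
have A'1 J : A' <= J%:R -> A <= (M J)%:R.
  move=> AJ; apply: (le_trans (ler_norm A)); apply: (@le_trans _ _ J%:R); last by rewrite ler_nat.
  by apply: le_trans AJ; rewrite /A' -addrA lerDl addr_ge0 ?expR_ge0.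
have A'2 J : A' <= J%:R -> X <= ln (M J)%:R.
  move=> AJ; rewrite -ler_expR lnK ?posrE ?ltr0n//; apply: (@le_trans _ _ J%:R); last by rewrite ler_nat.
  by apply: le_trans AJ; rewrite /A' addrAC lerDr addr_ge0.
have A'3 J : A' <= J%:R -> 2^-1 ^+ J <= (1 - r) * lambda.
  move=> AJ; rewrite exprVn invf_ple ?posrE ?exprn_gt0 ?mulr_gt0//.
  apply: (@le_trans _ _ J%:R); last by rewrite -natrX ler_nat ltnW// ltn_expl.
  by apply: le_trans AJ; rewrite /A' lerDr addr_ge0 ?expR_ge0.
apply: (@negligibleS _ _ _ _ [set w | exists J0, forall J, (J0 <= J)%N -> (S J `|` L J) w]); last first.
  apply: (@negligible_eventually _ _ _ _ _ (m.+1%:R * C + C') A').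
    by rewrite addr_ge0// mulr_ge0// ltW.
  move=> J AJ; have [mL pL] := HC' J (h J) (h0 J).
  have p0 : 0 < 2 ^+ J :> R by exact: exprn_gt0.
  have mS1 i : measurable (small_increments r k (M J) (i%:R / 2 ^+ J)).
    apply: measurable_forall_norm_le => n; exact: measurable_normalized_increment.
  have pS1 i : (i < (m * 2 ^ J).+1)%N ->
      (P (small_increments r k (M J) (i%:R / 2 ^+ J)) <= (C * 2^-1 ^+ (2 * J))%:E)%E.
    move=> im; apply: (le_trans (HA (M J) _ (M0 J) (A'1 _ AJ) _ _)).
    - by rewrite divr_ge0// ltW.
    - by rewrite ler_pdivrMr// -natrX -natrM ler_nat.
    rewrite lee_fin ler_pM2l// -expR_ln2 ler_expR /M natrX lnXn// -(mulr_natl (ln 2)) !natrM.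
    have l2 : 0 <= J%:R * ln 2 :> R by rewrite mulr_ge0// ln_ge0// ler1n.
    have := ler_wpM2r l2 Q2; rewrite !mulrA; lra.
  have [mS pS] := probability_exists_lt (fun i _ => mS1 i) pS1.
  split; first exact: measurableU.
  apply: (le_trans (measureU2 P mS mL)).
  rewrite mulrDl EFinD; apply: leeD => //; apply: (le_trans pS); rewrite lee_fin.
  have E : m.+1%:R * C * 2^-1 ^+ J = m.+1%:R * 2 ^+ J * (C * 2^-1 ^+ (2 * J)) :> R.
    have e : 2 ^+ J * 2^-1 ^+ J = 1 :> R by rewrite -exprMn mulfV ?expr1n.
    rewrite mul2n -addnn exprD; move: (2 ^+ J) (2^-1 ^+ J) e => p q e.
    have -> : m.+1%:R * p * (C * (q * q)) = m.+1%:R * C * (p * q) * q by ring.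
    by rewrite e mulr1.
  rewrite E ler_wpM2r ?mulr_ge0 ?exprn_ge0 ?invr_ge0 ?(ltW C0)//.
  by rewrite -natrX -natrM ler_nat mulSn -add1n leq_add2r expn_gt0.
move=> w /= Hw; apply: contrapT => HB; apply: Hw => tau tau0 taum.
apply: limf_esup_right_ge => e e0.
(* The second entry gives M >= J > 1/e, so that the good scale, at most 1/M, is below e. *)
pose J0 := maxn (Num.truncn A').+1 (Num.truncn e^-1).+1.
have [J J0J nB] : exists2 J, (J0 <= J)%N & ~ (S J `|` L J) w.
  apply: contrapT => H; apply: HB; exists J0 => J J0J.
  by apply: contrapT => nB; apply: H; exists J.
have AJ : A' <= J%:R.
  apply/ltW/(lt_le_trans (truncnS_gt A')); rewrite ler_nat.
  by apply: leq_trans J0J; exact: leq_maxl.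
have [x2 xc xr] := HX _ (A'2 _ AJ).
have [nS nL] : ~ S J w /\ ~ L J w by split=> H; apply: nB; [left|right].
have x9 : 9 <= c * Num.sqrt (ln (M J)%:R) by rewrite mulrC -ler_pdivrMr.
have [h' [h'0 h'M hr]] := lil_ratio_good_scale r0 r1 k0 (M0 J) tau0 taum x2 xr x9 (A'3 _ AJ) nS nL.
exists h'; split=> //; apply: (le_lt_trans h'M).
rewrite invf_plt ?posrE ?ltr0n//; apply: (lt_le_trans (truncnS_gt _)).
by rewrite ler_nat; apply: leq_trans (JM J); apply: leq_trans J0J; exact: leq_maxr.
Qed.

End lower_bound.

Unset Implicit Arguments.

Theorem proposition3p1 (R : realType) (d : measure_display)
    (T : measurableType d) (P : probability T R)
    (P_complete : measure_is_complete P)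
    (beta : R) (beta_gt0 : 0 < beta) (beta_lt1 : beta < 1)
    (W : (R * R -> R) -> {RV P >-> R}) (noiseW : colored_noise beta W)
    (u : R -> R -> {RV P >-> R}) (solu : wave_solution W u)
    (lambda : R) (lambda_gt0 : 0 < lambda) :
  let E := [set w : T | forall tau : R, 0 <= tau ->
    ((K_const beta)%:E <=
     limf_esup (fun h : R =>
       (`|utilde u tau (lambda + h) w - utilde u tau lambda w|
        / Num.sqrt ((tau + lambda) * h `^ (2 - beta) * ln (ln (1 / h))))%:E)
       0^'+)%E] in
  measurable E /\ P E = 1%E.
Proof.
move=> E; have K0 := K_const_gt0 beta_lt1.
(* Countably many levels increasing to 1; the shift by 2 makes them positive from j = 0 on. *)
pose r (j : nat) : R := 1 - j.+2%:R^-1.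
have r0 j : 0 < r j by rewrite subr_gt0 invf_lt1 ?ltr1n.
have r1 j : r j < 1 by rewrite gtrBl invr_gt0.
have nE : P.-negligible (~` E).
  apply: (@negligibleS _ _ _ _ (\bigcup_j \bigcup_m [set w | ~ forall tau, 0 <= tau -> tau <= m%:R ->
      ((r j ^+ 4 * K_const beta)%:E <=
       limf_esup (fun h => (lil_ratio beta u lambda tau h w)%:E) 0^'+)%E])); last first.
    apply: negligible_bigcup => j; apply: negligible_bigcup => m.
    exact: (lil_lower_bound_negligible beta_gt0 beta_lt1 noiseW solu lambda_gt0).
  move=> w nEw; apply: contrapT => Hw; apply: nEw => tau tau0.
  have H j : ((r j ^+ 4 * K_const beta)%:E <=
      limf_esup (fun h => (lil_ratio beta u lambda tau h w)%:E) 0^'+)%E.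
    have taum : tau <= (Num.truncn tau).+1%:R by rewrite ltW// truncnS_gt.
    apply: contrapT => nj; apply: Hw; exists j => //; exists (Num.truncn tau).+1 => //= Hj.
    by apply: nj; exact: Hj.
  change ((K_const beta)%:E <= limf_esup (fun h => (lil_ratio beta u lambda tau h w)%:E) 0^'+)%E.
  (* By r^4 >= 1 - 4 (1 - r) the loss at level j is at most 4 K / (j + 2) <= e. *)
  apply/lee_addgt0Pr => e e0; pose j := Num.truncn (4 * K_const beta / e).
  apply: (@le_trans _ _ ((r j ^+ 4 * K_const beta)%:E + e%:E)%E); last by rewrite leeD2r.
  rewrite -EFinD lee_fin.
  have r4 : 1 - 4 * j.+2%:R^-1 <= r j ^+ 4.
    have := ltW (r0 j); rewrite /r; move: (j.+2%:R^-1) => x x1.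
    have -> : (1 - x) ^+ 4 = 1 - 4 * x + (x ^+ 2 * (2 + 4 * (1 - x) + x ^+ 2)) by ring.
    by rewrite lerDl mulr_ge0 ?sqr_ge0// !addr_ge0 ?sqr_ge0 ?mulr_ge0.
  have je : 4 * K_const beta * j.+2%:R^-1 <= e.
    rewrite ler_pdivrMr// [leRHS]mulrC -ler_pdivrMr//; apply: le_trans (ltW (truncnS_gt _)) _.
    by rewrite ler_nat.
  have aux (a x y b : R) : 0 <= a -> 1 - 4 * x <= y -> 4 * a * x <= b -> a <= y * a + b.
    by move=> a0 h1 h2; have := ler_wpM2r a0 h1; lra.
  exact: aux (ltW K0) r4 je.
(* [E] is an uncountable intersection over tau; its measurability comes from the completeness of
   [P]. *)
have mE : measurable (~` E) by exact: P_complete.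
have mE' : measurable E by rewrite -[E]setCK; exact: measurableC.
split=> //; rewrite -[E]setCK probability_setC//.
by have /(negligibleP P mE) -> := nE; rewrite sube0.
Qed.
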